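(* The Bicomplex radial formal powers are a complete system of solutions for the radial Vekua equation; that is, for any $W\in\operatorname{V}_f(\Omega;\mathbb{B})$ and any compact $K\subset\Omega$, there exists a sequence $\{S_n\}\subset\mathscr{S}_f(\Omega;\mathbb{B})$ such that $S_n\to W$ uniformly on $K$. Furthermore, if $\Omega=B_{\varrho_\Omega}^{\mathbb{C}}(0)$, then (for every such $W$) there exist constants $\{A_n\}_{n=0}^\infty\subset\mathbb{B}$ such that $$W(z)=\sum_{n=0}^\infty\mathcal{Z}_f^{(n)}(A_n;z),\qquad z\in B_{\varrho_\Omega}^{\mathbb{C}}(0),$$ and the series converges absolutely and uniformly on compact subsets of $B_{\varrho_\Omega}^{\mathbb{C}}(0)$.
   Context: $\mathbb{B}$ is the algebra of bicomplex numbers $W=u+\mathbf{j}v$, $u,v\in\mathbb{C}$, $\mathbf{j}^2=-1$, $\mathbf{j}i=i\mathbf{j}$; $\operatorname{Sc}W=u$, $\operatorname{Vec}W=v$, $\overline{W}=u-\mathbf{j}v$, $|W|_{\mathbb{B}}=\sqrt{|u|^2+|v|^2}$. $C^k(\Omega;\mathbb{B})$ is defined componentwise. For $z=x+iy$, $\widehat z=x+\mathbf{j}y\in\mathbb{B}$, and $\overline{\boldsymbol{\partial}}=\frac12\left(\frac{\partial}{\partial x}+\mathbf{j}\frac{\partial}{\partial y}\right)$. $B_R^{\mathbb{C}}(0)$ is the open disk of radius $R$ centred at $0$. Setting. $\Omega\subset\mathbb{C}$ is a bounded domain star-shaped with respect to $z=0$ (that is, $0\in\Omega$ and $[0,z]\subset\Omega$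 for all $z\in\Omega$), and $\varrho_\Omega=\sup_{z\in\Omega}|z|$. The function $q_f\in C^1[0,\varrho_\Omega]$ is complex-valued, and $f\in C^2[0,\varrho_\Omega]$ is complex-valued, nowhere zero on $[0,\varrho_\Omega]$, satisfies $f''(r)+\frac1rf'(r)-q_f(r)f(r)=0$ on $(0,\varrho_\Omega)$, and is normalized by $f(0)=1$, $\lim_{r\to0^+}rf'(r)=0$; $f$ is identified with the radial function $z\mapsto f(|z|)$, assumed to be in $C^2(\overline\Omega)$. Put $q_{\frac1f}=2\left(\frac{f'}{f}\right)^2-q_f$, the potential associated in the same way to $\frac1f$. For $g\in\{f,\frac1f\}$ let $G^g\in C^2([0,\varrho_\Omega]\times[0,1])$ be the kernel (known to exist) satisfying $$r\left(G^g_{rr}(r,t)-q_g(r)G^g(r,t)\right)-G^g_r(r,t)+2(1-t)G^g_{rt}(r,t)=0,$$ $$G^g(r,0)=\int_0^r\tau q_g(\tau)\,d\tau,\qquad G^g(0,t)=0,$$ and define, for complex-valued $h\in C(\Omega)$, $\mathbf{T}_gh(z)=h(z)+\int_0^1\sigma\,G^g(|z|,1-\sigma^2)\,h(\sigma^2z)\,d\sigma$. Put $\mathcal{T}_fW=\mathbf{T}_f\operatorname{Sc}W+\mathbf{j}\,\mathbf{T}_{\frac1f}\operatorname{Vec}W$ for $W\in C(\Omega;\mathbb{B})$. $\operatorname{V}_f(\Omega;\mathbb{B})$ is the set of $W\in C^1(\Omega;\mathbb{B})$ satisfying the (radial main) Vekua equation $\overline{\boldsymbol{\partial}}W=\frac{\overline{\boldsymbol{\partial}}f}{f}\overline{W}$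 in $\Omega$. Formal powers: for $n\geqslant0$, $\mathcal{Z}_f^{(n)}(1;z)=\mathcal{T}_f[\widehat z^n]$ and $\mathcal{Z}_f^{(n)}(\mathbf{j};z)=\mathcal{T}_f[\mathbf{j}\widehat z^n]$ (the basic Bicomplex radial formal powers), and for $A\in\mathbb{B}$, $\mathcal{Z}_f^{(n)}(A;z)=\operatorname{Sc}(A)\mathcal{Z}_f^{(n)}(1;z)+\operatorname{Vec}(A)\mathcal{Z}_f^{(n)}(\mathbf{j};z)$. $\mathscr{S}_f(\Omega;\mathbb{B})$ is the set of all finite sums $\sum_{n=0}^N\mathcal{Z}_f^{(n)}(A_n;z)$ with $A_n\in\mathbb{B}$ (radial formal polynomials), i.e. the complex linear span of all $\mathcal{Z}_f^{(n)}(1;\cdot),\mathcal{Z}_f^{(n)}(\mathbf{j};\cdot)$. Absolute convergence is with respect to $|\cdot|_{\mathbb{B}}$. *)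

(* Defs.v *)
(* Stdlib reals with Coquelicot; C is Coquelicot's type R * R of complex numbers,
   so a point z = (x, y) of the plane is at the same time a complex number. *)
From Stdlib Require Import Reals List.
From Coquelicot Require Import Coquelicot.
Local Open Scope R_scope.

(** * Bicomplex numbers *)

(* W = u + j v is the pair (u, v) of complex numbers. *)
Definition B : Type := (C * C)%type.

(* Sums and series in B are taken in this real normed module; its topology is
   that of Bnorm below. *)
Definition B_NormedModule : NormedModule R_AbsRing :=
  prod_NormedModule R_AbsRing C_R_NormedModule C_R_NormedModule.

Definition Sc (W : B) : C := fst W.
Definition Vec (W : B) : C := snd W.
Definition B1 : B := (RtoC 1, RtoC 0).
Definition Bj : B := (RtoC 0, RtoC 1).
Definition Bplus (W1 W2 : B) : B := (Sc W1 + Sc W2, Vec W1 + Vec W2)%C.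
Definition Bminus (W1 W2 : B) : B := (Sc W1 - Sc W2, Vec W1 - Vec W2)%C.
Definition Bmult (W1 W2 : B) : B :=
  (Sc W1 * Sc W2 - Vec W1 * Vec W2, Sc W1 * Vec W2 + Vec W1 * Sc W2)%C.
Definition Bscal (c : C) (W : B) : B := (c * Sc W, c * Vec W)%C.
Definition Bconj (W : B) : B := (Sc W, - Vec W)%C.
Definition Bnorm (W : B) : R := sqrt (Cmod (Sc W) ^ 2 + Cmod (Vec W) ^ 2).

Fixpoint Bpow (W : B) (n : nat) : B :=
  match n with
  | O => B1
  | S m => Bmult W (Bpow W m)
  end.

Definition hat (z : C) : B := (RtoC (Re z), RtoC (Im z)).

(** * Derivatives and classes C^k of complex-valued functions *)

Definition ex_CDerive (f : R -> C) (x : R) : Prop :=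
  ex_derive (fun t => Re (f t)) x /\ ex_derive (fun t => Im (f t)) x.

Definition CDerive (f : R -> C) (x : R) : C :=
  (Derive (fun t => Re (f t)) x, Derive (fun t => Im (f t)) x).

Definition ex_Dx (F : C -> C) (z : C) : Prop :=
  ex_CDerive (fun x => F (x, Im z)) (Re z).
Definition ex_Dy (F : C -> C) (z : C) : Prop :=
  ex_CDerive (fun y => F (Re z, y)) (Im z).
Definition Dx (F : C -> C) (z : C) : C := CDerive (fun x => F (x, Im z)) (Re z).
Definition Dy (F : C -> C) (z : C) : C := CDerive (fun y => F (Re z, y)) (Im z).

Fixpoint Ck (k : nat) (U : C -> Prop) (F : C -> C) : Prop :=
  continuous_on U F /\
  match k with
  | O => True
  | S m => (forall z, U z -> ex_Dx F z /\ ex_Dy F z) /\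
           Ck m U (Dx F) /\ Ck m U (Dy F)
  end.

Definition closure (U : C -> Prop) (z : C) : Prop :=
  forall eps : R, 0 < eps -> exists w : C, U w /\ Cmod (w - z) < eps.

Definition extends_to_closure (U : C -> Prop) (F : C -> C) : Prop :=
  exists Fe : C -> C,
    continuous_on (closure U) Fe /\ (forall z, U z -> Fe z = F z).

Fixpoint partials_extend (k : nat) (U : C -> Prop) (F : C -> C) : Prop :=
  extends_to_closure U F /\
  match k with
  | O => True
  | S m => (forall z, U z -> ex_Dx F z /\ ex_Dy F z) /\
           partials_extend m U (Dx F) /\ partials_extend m U (Dy F)
  end.

(* F is C^k on the closure of the open set U: F is continuous there, and its
   partial derivatives of order at most k exist in U and extend continuously to
   the closure. *)
Definition Ck_closure (k : nat) (U : C -> Prop) (F : C -> C) : Prop :=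
  continuous_on (closure U) F /\ partials_extend k U F.

Definition extends_to_segment (a b : R) (f : R -> C) : Prop :=
  exists fe : R -> C,
    continuous_on (fun r => a <= r <= b) fe /\
    (forall r, a < r < b -> fe r = f r).

Fixpoint derivs_extend (k : nat) (a b : R) (f : R -> C) : Prop :=
  extends_to_segment a b f /\
  match k with
  | O => True
  | S m => (forall r, a < r < b -> ex_CDerive f r) /\
           derivs_extend m a b (CDerive f)
  end.

(* C^k [a, b], with the same convention at the endpoints. *)
Definition Ck_segment (k : nat) (a b : R) (f : R -> C) : Prop :=
  continuous_on (fun r => a <= r <= b) f /\ derivs_extend k a b f.

(** * The domain *)

(* Connectedness is not listed: it follows from star-shapedness. *)
Definition star_shaped_bounded_domain (Omega : C -> Prop) : Prop :=
  open Omega /\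
  (exists M : R, forall z, Omega z -> Cmod z <= M) /\
  Omega (RtoC 0) /\
  (forall (z : C) (s : R), Omega z -> 0 <= s <= 1 -> Omega (RtoC s * z)%C).

Definition is_sup_modulus (Omega : C -> Prop) (rho : R) : Prop :=
  is_lub (fun r => exists z : C, Omega z /\ r = Cmod z) rho.

(* Compactness by open covers; Stdlib's [compact] is about subsets of R only. *)
Definition compactC (K : C -> Prop) : Prop :=
  forall (I : Type) (U : I -> C -> Prop),
    (forall i, open (U i)) ->
    (forall z, K z -> exists i, U i z) ->
    exists l : list I, forall z, K z -> exists i, In i l /\ U i z.

(** * The radial Vekua equation *)

Definition radial (f : R -> C) (z : C) : C := f (Cmod z).

Definition dbar (W : C -> B) (z : C) : B :=
  let Wx : B := (Dx (fun w => Sc (W w)) z, Dx (fun w => Vec (W w)) z) in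
  let Wy : B := (Dy (fun w => Sc (W w)) z, Dy (fun w => Vec (W w)) z) in
  Bscal (RtoC (1 / 2)) (Bplus Wx (Bmult Bj Wy)).

Definition dbar_complex (u : C -> C) : C -> B := dbar (fun z => (u z, RtoC 0)).

Definition Vekua (Omega : C -> Prop) (f : R -> C) (W : C -> B) : Prop :=
  Ck 1 Omega (fun z => Sc (W z)) /\
  Ck 1 Omega (fun z => Vec (W z)) /\
  (forall z, Omega z ->
     dbar W z =
     Bmult (Bscal (/ radial f z)%C (dbar_complex (radial f) z)) (Bconj (W z))).

(** * The generating function f and the transmutation operators *)

Definition generating_function
    (Omega : C -> Prop) (rho : R) (qf f : R -> C) : Prop :=
  Ck_segment 1 0 rho qf /\
  Ck_segment 2 0 rho f /\
  (forall r, 0 <= r <= rho -> f r <> RtoC 0) /\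
  (forall r, 0 < r < rho ->
     (CDerive (CDerive f) r + RtoC (1 / r) * CDerive f r - qf r * f r
      = RtoC 0)%C) /\
  f 0 = RtoC 1 /\
  filterlim (fun r => (RtoC r * CDerive f r)%C) (at_right 0) (locally (RtoC 0)) /\
  Ck_closure 2 Omega (radial f).

(* The potential of 1/f. [CDerive f] is two-sided, so this is meant on (0, rho);
   the values at the endpoints are never relevant below. *)
Definition q_inv (qf f : R -> C) (r : R) : C :=
  (RtoC 2 * (CDerive f r / f r) * (CDerive f r / f r) - qf r)%C.

Definition rectangle (rho : R) (p : C) : Prop :=
  0 < fst p < rho /\ 0 < snd p < 1.

(* G is a function of the pair (r, t), so that Dx and Dy are the derivatives in r
   and in t. The differential equation, imposed in the open rectangle, holds on
   the closed one for the continuous extensions. *)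
Definition is_kernel (rho : R) (q : R -> C) (G : R * R -> C) : Prop :=
  Ck_closure 2 (rectangle rho) G /\
  (forall r t, rectangle rho (r, t) ->
     (RtoC r * (Dx (Dx G) (r, t) - q r * G (r, t)) - Dx G (r, t)
      + RtoC (2 * (1 - t)) * Dy (Dx G) (r, t) = RtoC 0)%C) /\
  (forall r, 0 <= r <= rho ->
     G (r, 0) =
     RInt (V := C_R_CompleteNormedModule) (fun tau => (RtoC tau * q tau)%C) 0 r) /\
  (forall t, 0 <= t <= 1 -> G (0, t) = RtoC 0).

Definition transmute (G : R * R -> C) (h : C -> C) (z : C) : C :=
  (h z +
   RInt (V := C_R_CompleteNormedModule)
     (fun s : R =>
        (RtoC s * G (Cmod z, (1 - s ^ 2)%R) * h (RtoC (s ^ 2)%R * z))%C) 0 1)%C.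

(* Gf and Gi are the kernels for f and for 1/f. *)
Definition TB (Gf Gi : R * R -> C) (W : C -> B) (z : C) : B :=
  (transmute Gf (fun w => Sc (W w)) z, transmute Gi (fun w => Vec (W w)) z).

(** * Formal powers *)

Definition Z1 (Gf Gi : R * R -> C) (n : nat) : C -> B :=
  TB Gf Gi (fun z => Bpow (hat z) n).
Definition Zj (Gf Gi : R * R -> C) (n : nat) : C -> B :=
  TB Gf Gi (fun z => Bmult Bj (Bpow (hat z) n)).
Definition Zpow (Gf Gi : R * R -> C) (n : nat) (A : B) (z : C) : B :=
  Bplus (Bscal (Sc A) (Z1 Gf Gi n z)) (Bscal (Vec A) (Zj Gf Gi n z)).

Definition formal_polynomial
    (Omega : C -> Prop) (Gf Gi : R * R -> C) (S : C -> B) : Prop :=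
  exists (N : nat) (A : nat -> B),
    forall z, Omega z ->
      S z = sum_n (G := B_NormedModule) (fun n => Zpow Gf Gi n (A n) z) N.

Definition converges_uniformly_on
    (K : C -> Prop) (S : nat -> C -> B) (W : C -> B) : Prop :=
  forall eps : R, 0 < eps ->
    exists N : nat, forall n : nat, (N <= n)%nat ->
      forall z, K z -> Bnorm (Bminus (S n z) (W z)) < eps.

(* Main.v *)
Require Import Defs.
From Stdlib Require Import Factorial Reals Lra Lia List ClassicalEpsilon FunctionalExtensionality.
From Coquelicot Require Import Coquelicot.
Local Open Scope R_scope.

(** For a kernel [G], the operator
      [T_G h (z) = h (z) + int_0^1 s G (|z|, 1 - s^2) h (s^2 z) ds]
    is a Volterra perturbation of the identity along the rays issued from the
    origin. Write [G], [H] for the kernels of [f] and of [1/f], [a = f'/f],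
    [E = r d/dr] and [Theta = d/dtheta]. Away from the origin the Vekua equation
    for [W = u + j v] is the system
      [E u - Theta v = r a u],   [Theta u + E v = - r a v]
    ([Vekua_at_polar]); identities between continuous functions then extend to the
    origin. The operators commute with [Theta] ([transmute_angular]) and satisfy
      [E T_G h = r a T_G h + T_H (E h)],   [E T_H h = - r a T_H h + T_G (E h)]
    ([V_euler]). Hence a pair [(phi, psi)] of functions of class C^1 satisfies the
    Cauchy-Riemann equations exactly when [T_G phi + j T_H psi] solves the Vekua
    equation ([transmutation_Vekua], [Vekua_preimage]); in particular the formal
    powers, images of [(x + j y)^n] and [j (x + j y)^n], are solutions.

    The intertwining relations come from a first-order system linking the kernels:
      [r G_r = r a G + (G - H) - (1 - t) (G_t - H_t)],
    and the same with [G], [H] exchanged and [- a] instead of [a]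
    ([first_order_system]). Let [X] be [G_r + H_r - a (G - H)], so that the two
    equations have the sum [r X = 0], and let [Y = 0] be their difference. The
    second-order equations for [G] and [H] become
      [r X_r - X + 2 (1 - t) X_t = - a Y],   [Y_r = - r a X],
    with zero data on [t = 0] and [r = 0]. The left-hand side of the first one is
    essentially a derivative along the curves [r^2 (1 - t) = const]
    ([char_bound]). Iterating the two integral inequalities gives
    [|X| <= M (A r)^(2j) / (2j)!] for every [j], so that [X = Y = 0]. The same
    estimate along the characteristics yields [|G_r| <= A r] ([kd_bound]), which
    compensates the lack of smoothness of [|z|] at the origin: [T_G] preserves the
    class C^1 ([V_C1]), and the Neumann series inverting [T_G] converges together
    with its first derivatives ([V_inverse]).

    Separating the parts without and with the factor [i], a bicomplex function
    [phi + j psi] satisfying the Cauchy-Riemann equations is [F1 + i F2], where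
    [F1], [F2] are holomorphic functions with values [x + j y], that is, ordinary
    holomorphic functions ([Vekua_holomorphic_pair]). So it remains to approximate
    [F1] and [F2] by polynomials, because the transmutation of a polynomial is a
    formal polynomial ([formal_polynomial_TB]) and the transmutation operators are
    bounded in the uniform norm on star-shaped sets ([TB_bound]). In a disk one
    takes the Taylor polynomials ([disc_Taylor]). In a star-shaped domain
    [F ((t + h) z)] is expanded in powers of [h z]; the coefficients are
    derivatives of [F] at [t z], which are limits of polynomials by induction on
    the number of steps from the origin ([appr_dilation], [Runge_star]). The
    necessary facts on holomorphic functions are obtained from Cauchy's formula,
    proved by contracting the circle to a point ([Cauchy_formula]). *)

(** * Complex-valued functions of a real variable *)

(** [Dx] also names an unrelated notion of real analysis. *)
Notation Dx := Defs.Dx.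

(** [f : R -> C] has the derivative [l] at [x]; the integral of [f : R -> C]. Both
    are taken in [C] as a real normed space. *)
Notation CD f x l := (@is_derive R_AbsRing C_R_NormedModule f x l).
Notation CInt f a b := (@RInt C_R_CompleteNormedModule f a b).

(** [C * R] and [R * R] with the product topology. *)
Notation CR := (prod_UniformSpace C_UniformSpace R_UniformSpace).
Notation RR := (prod_UniformSpace R_UniformSpace R_UniformSpace).

(** States at type [C] an equation whose type is another name of [C]. *)
Ltac eqC := match goal with |- @eq _ ?a ?b => change (@eq C a b) end.

Lemma Ceq (a b : C) : Re a = Re b -> Im a = Im b -> a = b.
Proof. destruct a, b; simpl; intros -> ->; reflexivity. Qed.

Lemma Ceq_sub (a b : C) : (a - b)%C = RtoC 0 -> a = b.
Proof. intros H. replace a with (a - b + b)%C by ring. rewrite H; ring. Qed.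

Lemma Re_le (z : C) : Rabs (Re z) <= Cmod z.
Proof. apply re_le_Cmod. Qed.

Lemma Im_le (z : C) : Rabs (Im z) <= Cmod z.
Proof. eapply Rle_trans; [apply Rmax_r|apply (Rmax_Cmod z)]. Qed.

Lemma Cmod_le_sum (z : C) : Cmod z <= Rabs (Re z) + Rabs (Im z).
Proof.
  replace z with (RtoC (Re z) + Ci * RtoC (Im z))%C
    by (apply Ceq; unfold Ci, Re, Im; simpl; ring).
  eapply Rle_trans; [apply Cmod_triangle|].
  rewrite Cmod_mult, !Cmod_R.
  replace (Cmod Ci) with 1 by
    (unfold Cmod, Ci; simpl; replace (0 * (0*1) + 1*(1*1)) with 1 by ring;
     now rewrite sqrt_1).
  unfold Ci, Re, Im; simpl.
  replace (fst z + (0 * snd z - 1 * 0)) with (fst z) by ring.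
  replace (0 + (0 * 0 + 1 * snd z)) with (snd z) by ring.
  right; ring.
Qed.

Lemma continuous_C_iff {T : UniformSpace} (F : T -> C) (x : T) :
  continuous F x <->
  continuous (fun t => Re (F t)) x /\ continuous (fun t => Im (F t)) x.
Proof.
  split.
  - intros H; split.
    + apply (continuous_comp F fst); [exact H|].
      destruct (F x); apply continuous_fst.
    + apply (continuous_comp F snd); [exact H|].
      destruct (F x); apply continuous_snd.
  - intros [H1 H2]. apply filterlim_locally. intros eps.
    apply filterlim_locally with (eps := eps) in H1.
    apply filterlim_locally with (eps := eps) in H2.
    generalize (filter_and _ _ H1 H2). apply filter_imp.
    intros t [A1 A2]; split; assumption.
Qed.

Lemma continuous_C_eps {T : UniformSpace} (F : T -> C) (x : T) :
  continuous F x <->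
  (forall eps, 0 < eps -> locally x (fun y => Cmod (F y - F x) < eps)).
Proof.
  split.
  - intros H eps He. apply continuous_C_iff in H. destruct H as [H1 H2].
    assert (He2 : 0 < eps / 2) by lra.
    apply filterlim_locally with (eps := mkposreal _ He2) in H1.
    apply filterlim_locally with (eps := mkposreal _ He2) in H2.
    generalize (filter_and _ _ H1 H2). apply filter_imp. intros y [A1 A2].
    eapply Rle_lt_trans; [apply Cmod_le_sum|].
    unfold ball in A1, A2; simpl in A1, A2; unfold AbsRing_ball, abs, minus, plus, opp in A1, A2;
    simpl in A1, A2. unfold Re, Im, Cminus, Cplus, Copp in *; simpl in *. lra.
  - intros H. apply continuous_C_iff.
    split; apply filterlim_locally; intros eps;
    generalize (H eps (cond_pos eps)); apply filter_imp; intros y Hy;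
    unfold ball; simpl; unfold AbsRing_ball, abs, minus, plus, opp; simpl.
    + eapply Rle_lt_trans; [|exact Hy]. apply (Re_le (F y - F x)%C).
    + eapply Rle_lt_trans; [|exact Hy]. apply (Im_le (F y - F x)%C).
Qed.

(** The topology of [C] is that of the product [R * R]; here it is described by
    disks. *)
Lemma locally_disc (z : C) (P : C -> Prop) :
  locally z P <-> exists d, 0 < d /\ forall w, Cmod (w - z) < d -> P w.
Proof.
  split.
  - intros [e He]. exists e; split; [apply cond_pos|]. intros w Hw. apply He.
    split; unfold ball; simpl; unfold AbsRing_ball, abs, minus, plus, opp; simpl.
    + eapply Rle_lt_trans; [|exact Hw]. apply (Re_le (w - z)%C).
    + eapply Rle_lt_trans; [|exact Hw]. apply (Im_le (w - z)%C).
  - intros [d [Hd H]]. assert (Hd2 : 0 < d / 2) by lra.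
    exists (mkposreal _ Hd2). intros w [A1 A2]. apply H.
    unfold ball in A1, A2; simpl in A1, A2; unfold AbsRing_ball, abs, minus, plus, opp in A1, A2;
    simpl in A1, A2.
    eapply Rle_lt_trans; [apply Cmod_le_sum|].
    unfold Re, Im, Cminus, Cplus, Copp; simpl. lra.
Qed.

Lemma locally_R (x : R) (P : R -> Prop) :
  locally x P <-> exists d, 0 < d /\ forall y, Rabs (y - x) < d -> P y.
Proof.
  split.
  - intros [e He]. exists e; split; [apply cond_pos|]. intros w Hw. now apply He.
  - intros [d [Hd H]]. exists (mkposreal _ Hd). intros w A. now apply H.
Qed.

Lemma locally_CR (z : C) (s : R) (P : C * R -> Prop) :
  locally (T := prod_UniformSpace C_UniformSpace R_UniformSpace) (z, s) P <->
  exists d, 0 < d /\ forall w u, Cmod (w - z) < d -> Rabs (u - s) < d -> P (w, u).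
Proof.
  split.
  - intros [e He]. exists e; split; [apply cond_pos|]. intros w u Hw Hu. apply He.
    split; [|exact Hu].
    split; unfold ball; simpl; unfold AbsRing_ball, abs, minus, plus, opp; simpl.
    + eapply Rle_lt_trans; [|exact Hw]. apply (Re_le (w - z)%C).
    + eapply Rle_lt_trans; [|exact Hw]. apply (Im_le (w - z)%C).
  - intros [d [Hd H]]. assert (Hd2 : 0 < d / 2) by lra.
    exists (mkposreal _ Hd2). intros [w u] [[A1 A2] A3].
    unfold ball in A1, A2, A3; simpl in A1, A2, A3;
    unfold AbsRing_ball, abs, minus, plus, opp in A1, A2, A3;
    simpl in A1, A2, A3. apply H.
    + eapply Rle_lt_trans; [apply Cmod_le_sum|].
      unfold Re, Im, Cminus, Cplus, Copp; simpl. lra.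
    + unfold Rminus; lra.
Qed.

(** * Algebra of continuous functions *)

Lemma continuous_Cplus {T : UniformSpace} (F G : T -> C) x :
  continuous F x -> continuous G x -> continuous (fun t => F t + G t)%C x.
Proof. exact (continuous_plus (V := C_R_NormedModule) F G x). Qed.

Lemma continuous_Copp {T : UniformSpace} (F : T -> C) x :
  continuous F x -> continuous (fun t => - F t)%C x.
Proof. exact (continuous_opp (V := C_R_NormedModule) F x). Qed.

Lemma continuous_Cminus {T : UniformSpace} (F G : T -> C) x :
  continuous F x -> continuous G x -> continuous (fun t => F t - G t)%C x.
Proof. exact (continuous_minus (V := C_R_NormedModule) F G x). Qed.

Lemma continuous_Cmult {T : UniformSpace} (F G : T -> C) x :
  continuous F x -> continuous G x -> continuous (fun t => F t * G t)%C x.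
Proof.
  intros H1 H2. apply continuous_C_iff in H1; apply continuous_C_iff in H2.
  destruct H1 as [a b], H2 as [c d]. apply continuous_C_iff. split; simpl.
  - apply (continuous_minus (V := R_NormedModule)
             (fun t => Re (F t) * Re (G t)) (fun t => Im (F t) * Im (G t)));
    now apply (continuous_mult (K := R_AbsRing)).
  - apply (continuous_plus (V := R_NormedModule)
             (fun t => Re (F t) * Im (G t)) (fun t => Im (F t) * Re (G t)));
    now apply (continuous_mult (K := R_AbsRing)).
Qed.

Lemma continuous_RtoC {T : UniformSpace} (F : T -> R) x :
  continuous F x -> continuous (fun t => RtoC (F t)) x.
Proof.
  intros H. apply continuous_C_iff; split; simpl; [exact H|apply continuous_const].
Qed.

Lemma continuous_Cpair {T : UniformSpace} (f g : T -> R) x :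
  continuous f x -> continuous g x -> continuous (fun t => (f t, g t) : C) x.
Proof. intros H K. apply continuous_C_iff; split; assumption. Qed.

Lemma continuous_Cmod {T : UniformSpace} (F : T -> C) x :
  continuous F x -> continuous (fun t => Cmod (F t)) x.
Proof.
  intros H. apply filterlim_locally. intros eps.
  generalize (proj1 (continuous_C_eps F x) H eps (cond_pos eps)). apply filter_imp.
  intros y Hy. unfold ball; simpl; unfold AbsRing_ball, abs, minus, plus, opp; simpl.
  eapply Rle_lt_trans; [|exact Hy].
  generalize (Cmod_triangle (F y - F x) (F x)) (Cmod_triangle (F x - F y) (F y)).
  replace (F y - F x + F x)%C with (F y) by ring.
  replace (F x - F y + F y)%C with (F x) by ring.
  replace (F x - F y)%C with (- (F y - F x))%C by ring. rewrite Cmod_opp.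
  intros A1 A2. apply Rabs_le; lra.
Qed.

Lemma continuous_Rmult {T : UniformSpace} (f g : T -> R) x :
  continuous f x -> continuous g x -> continuous (fun t => f t * g t) x.
Proof. exact (continuous_mult (K := R_AbsRing) f g x). Qed.

Lemma continuous_Rplus {T : UniformSpace} (f g : T -> R) x :
  continuous f x -> continuous g x -> continuous (fun t => f t + g t) x.
Proof. exact (continuous_plus (V := R_NormedModule) f g x). Qed.

Lemma continuous_Rminus {T : UniformSpace} (f g : T -> R) x :
  continuous f x -> continuous g x -> continuous (fun t => f t - g t) x.
Proof. exact (continuous_minus (V := R_NormedModule) f g x). Qed.

Lemma continuous_Ropp {T : UniformSpace} (f : T -> R) x :
  continuous f x -> continuous (fun t => - f t) x.
Proof. exact (continuous_opp (V := R_NormedModule) f x). Qed.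

Lemma continuous_Rpow {T : UniformSpace} (f : T -> R) n x :
  continuous f x -> continuous (fun t => f t ^ n) x.
Proof.
  intros H. induction n; simpl; [apply continuous_const|].
  now apply continuous_Rmult.
Qed.

Lemma continuous_Rinv_fun {T : UniformSpace} (f : T -> R) x :
  continuous f x -> f x <> 0 -> continuous (fun t => / f t) x.
Proof.
  intros H K. apply (continuous_comp f Rinv); [exact H|].
  now apply continuous_Rinv.
Qed.

Lemma continuous_Cinv {T : UniformSpace} (F : T -> C) x :
  continuous F x -> F x <> 0%C -> continuous (fun t => / F t)%C x.
Proof.
  intros H K. assert (H' := H). apply continuous_C_iff in H'. destruct H' as [H1 H2].
  assert (N : fst (F x) ^ 2 + snd (F x) ^ 2 <> 0).
  { intros E. apply K. apply Ceq; unfold Re, Im; simpl; nra. }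
  assert (M : continuous (fun t => / (Re (F t) ^ 2 + Im (F t) ^ 2)) x).
  { apply (continuous_Rinv_fun (fun t => Re (F t) ^ 2 + Im (F t) ^ 2));
    [apply continuous_Rplus; now apply continuous_Rpow|exact N]. }
  apply continuous_C_iff; split.
  - exact (continuous_Rmult _ _ x H1 M).
  - exact (continuous_Rmult _ _ x (continuous_Ropp _ x H2) M).
Qed.

Lemma continuous_Re {T : UniformSpace} (F : T -> C) x :
  continuous F x -> continuous (fun t => Re (F t)) x.
Proof. intros H; apply continuous_C_iff in H; tauto. Qed.

Lemma continuous_Im {T : UniformSpace} (F : T -> C) x :
  continuous F x -> continuous (fun t => Im (F t)) x.
Proof. intros H; apply continuous_C_iff in H; tauto. Qed.

Lemma continuous_Cconst {T : UniformSpace} (c : C) (x : T) :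
  continuous (fun _ => c) x.
Proof. apply continuous_const. Qed.

Lemma continuous_Cid (z : C) : continuous (fun w : C => w) z.
Proof. apply (continuous_id (U:=C_UniformSpace)). Qed.

Lemma continuous_Rid (z : R) : continuous (fun w : R => w) z.
Proof. apply (continuous_id (U:=R_UniformSpace)). Qed.

Lemma continuous_fst' {T U : UniformSpace} (p : T * U) :
  @continuous (prod_UniformSpace T U) T (fun q => fst q) p.
Proof. destruct p; apply continuous_fst. Qed.

Lemma continuous_snd' {T U : UniformSpace} (p : T * U) :
  @continuous (prod_UniformSpace T U) U (fun q => snd q) p.
Proof. destruct p; apply continuous_snd. Qed.

Lemma continuous_ext_C {T : UniformSpace} (F G : T -> C) x :
  locally x (fun t => F t = G t) -> continuous F x -> continuous G x.
Proof.
  intros H K. apply (continuous_ext_loc (U:=C_UniformSpace) G F x); [|exact K].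
  exact H.
Qed.

Lemma continuous_Cext {T : UniformSpace} (F G : T -> C) x :
  (forall t, F t = G t) -> continuous F x -> continuous G x.
Proof. intros H. apply continuous_ext_C. now apply filter_forall. Qed.

Lemma continuous_Cpow {T : UniformSpace} (F : T -> C) n x :
  continuous F x -> continuous (fun t => F t ^ n)%C x.
Proof.
  intros H. induction n; simpl; [apply continuous_Cconst|now apply continuous_Cmult].
Qed.

Lemma continuous_Rabs_fun {T : UniformSpace} (f : T -> R) x :
  continuous f x -> continuous (fun t => Rabs (f t)) x.
Proof. intros H. apply (continuous_comp f Rabs); [exact H|apply continuous_Rabs]. Qed.

Create HintDb cont discriminated.

(** [cont] proves continuity by structural descent; what remains at the leaves is
    looked up among the hypotheses and in the database. *)
Ltac cont_leaf := cbn [fst snd]; solve [auto 3 with cont | eauto 3 with cont].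

Ltac cont_step :=
  lazymatch goal with
  | |- @continuous _ _ (fun _ => ?c) _ => apply continuous_const
  | |- @continuous ?T _ (fun t => t) _ => apply (continuous_id (U := T))
  | |- @continuous ?T _ (fun t => Cplus (@?F t) (@?G t)) ?x => apply (@continuous_Cplus T F G x)
  | |- @continuous ?T _ (fun t => Cminus (@?F t) (@?G t)) ?x => apply (@continuous_Cminus T F G x)
  | |- @continuous ?T _ (fun t => Cmult (@?F t) (@?G t)) ?x => apply (@continuous_Cmult T F G x)
  | |- @continuous ?T _ (fun t => Cdiv (@?F t) (@?G t)) ?x =>
      apply (@continuous_Cmult T F (fun t => Cinv (G t)) x)
  | |- @continuous ?T _ (fun t => Copp (@?F t)) ?x => apply (@continuous_Copp T F x)
  | |- @continuous ?T _ (fun t => Cinv (@?F t)) ?x => apply (@continuous_Cinv T F x)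
  | |- @continuous ?T _ (fun t => Cpow (@?F t) ?n) ?x => apply (@continuous_Cpow T F n x)
  | |- @continuous ?T _ (fun t => RtoC (@?F t)) ?x => apply (@continuous_RtoC T F x)
  | |- @continuous ?T _ (fun t => Re (@?F t)) ?x => apply (@continuous_Re T F x)
  | |- @continuous ?T _ (fun t => Im (@?F t)) ?x => apply (@continuous_Im T F x)
  | |- @continuous ?T _ (fun t => Cmod (@?F t)) ?x => apply (@continuous_Cmod T F x)
  | |- @continuous ?T _ (fun t => Rplus (@?F t) (@?G t)) ?x => apply (@continuous_Rplus T F G x)
  | |- @continuous ?T _ (fun t => Rminus (@?F t) (@?G t)) ?x => apply (@continuous_Rminus T F G x)
  | |- @continuous ?T _ (fun t => Rmult (@?F t) (@?G t)) ?x => apply (@continuous_Rmult T F G x)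
  | |- @continuous ?T _ (fun t => Rdiv (@?F t) (@?G t)) ?x =>
      apply (@continuous_Rmult T F (fun t => Rinv (G t)) x)
  | |- @continuous ?T _ (fun t => Ropp (@?F t)) ?x => apply (@continuous_Ropp T F x)
  | |- @continuous ?T _ (fun t => Rinv (@?F t)) ?x => apply (@continuous_Rinv_fun T F x)
  | |- @continuous ?T _ (fun t => Rabs (@?F t)) ?x => apply (@continuous_Rabs_fun T F x)
  | |- @continuous ?T _ (fun t => pow (@?F t) ?n) ?x => apply (@continuous_Rpow T F n x)
  | |- @continuous ?T _ (fun t => @pair _ _ (@?F t) (@?G t)) ?x => apply (@continuous_Cpair T F G x)
  | |- @continuous (prod_UniformSpace (prod_UniformSpace ?T ?U) _) _ (fun p => fst (fst p)) ?x =>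
      apply (@continuous_comp _ (prod_UniformSpace T U) T (fun p => fst p) (fun p => fst p) x);
      apply continuous_fst'
  | |- @continuous (prod_UniformSpace (prod_UniformSpace ?T ?U) _) _ (fun p => snd (fst p)) ?x =>
      apply (@continuous_comp _ (prod_UniformSpace T U) U (fun p => fst p) (fun p => snd p) x);
      [apply continuous_fst'|apply continuous_snd']
  | |- @continuous (prod_UniformSpace _ _) _ (fun p => fst p) _ => apply continuous_fst'
  | |- @continuous (prod_UniformSpace _ _) _ (fun p => snd p) _ => apply continuous_snd'
  | |- @continuous ?T ?V (fun t => ?f (@?g t)) ?x =>
      first [ apply (@continuous_comp T C_UniformSpace V g f x); [|cont_leaf]
            | apply (@continuous_comp T R_UniformSpace V g f x); [|cont_leaf] ]
  end.

Ltac cont := intros; solve [repeat first [cont_leaf | cont_step]; cont_leaf | repeat first [cont_leaf | cont_step]].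

(** * Derivatives of complex-valued functions of a real variable *)

Lemma CD_iff (f : R -> C) (x : R) (l : C) :
  CD f x l <->
  is_derive (fun t => Re (f t)) x (Re l) /\ is_derive (fun t => Im (f t)) x (Im l).
Proof.
  split.
  - intros H. split.
    + apply (is_derive_ext (fun t => fst (f t))); [reflexivity|].
      unfold is_derive in *.
      apply (filterdiff_ext_lin _ (fun y : R => fst (scal (V := C_R_NormedModule) y l))); [|reflexivity].
      apply (filterdiff_comp (U:=R_NormedModule) (V:=C_R_NormedModule) (W:=R_NormedModule)
               f fst (fun y => scal y l) fst); [exact H|].
      apply filterdiff_linear. apply (is_linear_fst (U:=R_NormedModule) (V:=R_NormedModule)).
    + apply (is_derive_ext (fun t => snd (f t))); [reflexivity|].
      unfold is_derive in *.
      apply (filterdiff_ext_lin _ (fun y : R => snd (scal (V := C_R_NormedModule) y l))); [|reflexivity].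
      apply (filterdiff_comp (U:=R_NormedModule) (V:=C_R_NormedModule) (W:=R_NormedModule)
               f snd (fun y => scal y l) snd); [exact H|].
      apply filterdiff_linear. apply (is_linear_snd (U:=R_NormedModule) (V:=R_NormedModule)).
  - intros [H1 H2].
    apply (is_derive_ext (V := C_R_NormedModule)
      (fun t => plus (scal (Re (f t)) (RtoC 1 : C_R_NormedModule))
                     (scal (Im (f t)) (Ci : C_R_NormedModule)))).
    { intros t. apply Ceq; unfold Re, Im, Ci; simpl; unfold plus, scal, mult; simpl;
      unfold mult; simpl; ring. }
    replace l with (plus (scal (Re l) (RtoC 1 : C_R_NormedModule))
                     (scal (Im l) (Ci : C_R_NormedModule)))
     by (apply Ceq; unfold Re, Im, Ci; simpl; unfold plus, scal, mult; simpl;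
      unfold mult; simpl; ring).
    apply (is_derive_plus (V := C_R_NormedModule)).
    + apply (is_derive_scal_l (V := C_R_NormedModule)); exact H1.
    + apply (is_derive_scal_l (V := C_R_NormedModule)); exact H2.
Qed.

Lemma CD_ext (f g : R -> C) (x : R) (l : C) : (forall t, f t = g t) -> CD f x l -> CD g x l.
Proof. apply (is_derive_ext (V:=C_R_NormedModule)). Qed.

Lemma CD_ext_loc (f g : R -> C) (x : R) (l : C) :
  locally x (fun t => f t = g t) -> CD f x l -> CD g x l.
Proof. apply (is_derive_ext_loc (V:=C_R_NormedModule)). Qed.

Lemma CD_eq (f : R -> C) (x : R) (l l' : C) : CD f x l -> l = l' -> CD f x l'.
Proof. now intros H <-. Qed.

Lemma CD_const (c : C) (x : R) : CD (fun _ => c) x (RtoC 0).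
Proof. apply (is_derive_const (V := C_R_NormedModule)). Qed.

Lemma CD_plus (f g : R -> C) (x : R) (a b : C) :
  CD f x a -> CD g x b -> CD (fun t => f t + g t)%C x (a + b)%C.
Proof. apply (is_derive_plus (V := C_R_NormedModule)). Qed.

Lemma CD_minus (f g : R -> C) (x : R) (a b : C) :
  CD f x a -> CD g x b -> CD (fun t => f t - g t)%C x (a - b)%C.
Proof. apply (is_derive_minus (V := C_R_NormedModule)). Qed.

Lemma CD_opp (f : R -> C) (x : R) (a : C) : CD f x a -> CD (fun t => - f t)%C x (- a)%C.
Proof. apply (is_derive_opp (V := C_R_NormedModule)). Qed.

Lemma CD_mult (f g : R -> C) (x : R) (a b : C) :
  CD f x a -> CD g x b -> CD (fun t => f t * g t)%C x (a * g x + f x * b)%C.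
Proof.
  intros H K. apply CD_iff in H; apply CD_iff in K. destruct H as [H1 H2], K as [K1 K2].
  apply CD_iff; split.
  - apply (is_derive_ext (fun t => Re (f t) * Re (g t) - Im (f t) * Im (g t)));
      [reflexivity|].
    evar_last; [apply (is_derive_minus (V := R_NormedModule));
      apply Derive.is_derive_mult; eassumption|].
    unfold minus, plus, opp, Re, Im; simpl; ring.
  - apply (is_derive_ext (fun t => Re (f t) * Im (g t) + Im (f t) * Re (g t)));
      [reflexivity|].
    evar_last; [apply (is_derive_plus (V := R_NormedModule));
      apply Derive.is_derive_mult; eassumption|].
    unfold minus, plus, opp, Re, Im; simpl; ring.
Qed.

Lemma CD_RtoC (f : R -> R) (x a : R) : is_derive f x a -> CD (fun t => RtoC (f t)) x (RtoC a).
Proof.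
  intros H. apply CD_iff; split; simpl; [exact H|apply (is_derive_const (V:=R_NormedModule))].
Qed.

Lemma CD_comp (f : R -> C) (g : R -> R) (x : R) (a : C) (b : R) :
  CD f (g x) a -> is_derive g x b -> CD (fun t => f (g t)) x (RtoC b * a)%C.
Proof.
  intros H K. evar_last; [apply (is_derive_comp (V:=C_R_NormedModule) f g); eassumption|].
  rewrite <- scal_R_Cmult. reflexivity.
Qed.

Lemma CD_continuous (f : R -> C) (x : R) (l : C) : CD f x l -> continuous f x.
Proof.
  intros H. apply (ex_derive_continuous (V:=C_R_NormedModule)). now exists l.
Qed.

Lemma CD_unique (f : R -> C) (x : R) (a b : C) : CD f x a -> CD f x b -> a = b.
Proof.
  intros H K. apply CD_iff in H; apply CD_iff in K. destruct H as [H1 H2], K as [K1 K2].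
  apply Ceq; [rewrite <- (is_derive_unique _ _ _ H1); now apply is_derive_unique
   |rewrite <- (is_derive_unique _ _ _ H2); now apply is_derive_unique].
Qed.

Lemma CD_CDerive (f : R -> C) (x : R) (l : C) : CD f x l -> ex_CDerive f x /\ CDerive f x = l.
Proof.
  intros H. apply CD_iff in H. destruct H as [H1 H2]. split.
  - split; eexists; eassumption.
  - apply Ceq; unfold CDerive; simpl; now apply is_derive_unique.
Qed.

Lemma CDerive_CD (f : R -> C) (x : R) : ex_CDerive f x -> CD f x (CDerive f x).
Proof. intros [H K]. apply CD_iff; split; apply Derive_correct; assumption. Qed.

Lemma CD_inv (f : R -> C) (x : R) (a : C) :
  CD f x a -> f x <> 0%C -> CD (fun t => / f t)%C x (- a / (f x * f x))%C.
Proof.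
  intros H K. assert (H' := H). apply CD_iff in H'. destruct H' as [H1 H2].
  assert (N : Re (f x) ^ 2 + Im (f x) ^ 2 <> 0).
  { intros E. apply K. apply Ceq; simpl; nra. }
  assert (L : exists b : C, CD (fun t => / f t)%C x b).
  { set (n := fun t => Re (f t) ^ 2 + Im (f t) ^ 2).
    assert (Hn : exists dn, is_derive n x dn).
    { eexists. apply (is_derive_plus (V := R_NormedModule)); apply is_derive_pow;
      eassumption. }
    destruct Hn as [dn Hn].
    assert (P1 := is_derive_div _ n x _ _ H1 Hn N).
    assert (P2 := is_derive_div _ n x _ _ (is_derive_opp _ _ _ H2) Hn N).
    eexists (_, _). apply CD_iff; split; [exact P1|exact P2]. }
  destruct L as [b Hb].
  assert (E : (b * f x + / f x * a)%C = RtoC 0).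
  { apply (CD_unique (fun t => / f t * f t)%C x).
    - now apply CD_mult.
    - apply (CD_ext_loc (fun _ => RtoC 1)); [|apply CD_const].
      assert (Cf := CD_continuous _ _ _ H).
      assert (P : 0 < Cmod (f x)) by now apply Cmod_gt_0.
      generalize (proj1 (continuous_C_eps f x) Cf _ P). apply filter_imp.
      intros y Hy. rewrite Cinv_l; [reflexivity|]. intros Z. rewrite Z in Hy.
      replace (0 - f x)%C with (- f x)%C in Hy by ring. rewrite Cmod_opp in Hy. lra. }
  replace (- a / (f x * f x))%C with b; [exact Hb|].
  assert (E2 : b = (- (/ f x * a) / f x)%C).
  { replace b with ((b * f x + / f x * a) / f x - (/ f x * a) / f x)%C by (field; exact K).
    rewrite E. field; exact K. }
  rewrite E2. field. exact K.
Qed.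

(** * Mean value inequality *)

(** A function whose derivative is dominated by [p'] grows at most as [p]. *)
Lemma CD_mean_value (f f' : R -> C) (p p' : R -> R) (a b : R) :
  a <= b ->
  (forall x, a < x < b -> CD f x (f' x)) ->
  (forall x, a <= x <= b -> continuous f x) ->
  (forall x, a < x < b -> is_derive p x (p' x)) ->
  (forall x, a <= x <= b -> continuous p x) ->
  (forall x, a < x < b -> Cmod (f' x) <= p' x) ->
  Cmod (f b - f a) <= p b - p a.
Proof.
  intros Hab Hf Cf Hp Cp Hle.
  set (u := (f b - f a)%C).
  (* A unit (or zero) multiplier that turns the increment into its modulus. *)
  assert (E : exists e : C, Re (e * u)%C = Cmod u /\ Cmod e <= 1).
  { destruct (Req_dec (Cmod u) 0) as [Z|Z].
    - exists (RtoC 0). rewrite Cmod_0. split; [|lra]. rewrite Z. simpl; ring.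
    -
      exists (Cconj u / RtoC (Cmod u))%C. split.
      + replace (Cconj u / RtoC (Cmod u) * u)%C with (RtoC (Cmod u)); [reflexivity|].
        assert (Q : (RtoC (Cmod u) * RtoC (Cmod u) = u * Cconj u)%C).
        { rewrite <- Cmod2_conj, <- RtoC_mult. f_equal; ring. }
        assert (N2 : RtoC (Cmod u) <> 0%C) by (intros N2; apply Z; now apply RtoC_inj).
        replace (Cconj u / RtoC (Cmod u) * u)%C with ((u * Cconj u) / RtoC (Cmod u))%C
          by (field; exact N2).
        rewrite <- Q. field. exact N2.
      + rewrite Cmod_div by (intros N2; apply Z; now apply RtoC_inj).
        rewrite Cmod_R, Cmod_conj, Rabs_pos_eq by apply Cmod_ge_0.
        right; field; exact Z. }
  destruct E as [e [He1 He2]].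
  set (g := fun x => Re (e * f x)%C - p x).
  set (g' := fun x => if Rlt_dec a x then
                      (if Rlt_dec x b then Re (e * f' x)%C - p' x else 0) else 0).
  assert (G : g b - g a <= 0).
  { destruct (MVT_gen g a b g') as [c [_ Hc]].
    - rewrite Rmin_left, Rmax_right by exact Hab. intros x Hx. unfold g'.
      destruct (Rlt_dec a x); [|lra]. destruct (Rlt_dec x b); [|lra].
      apply (is_derive_minus (V := R_NormedModule)); [|now apply Hp].
      assert (D : CD (fun t => e * f t)%C x (0 * f x + e * f' x)%C)
        by (apply (CD_mult (fun _ => e)); [apply CD_const|now apply Hf]).
      apply CD_iff in D. destruct D as [D _].
      replace (Re (e * f' x)%C) with (Re (0 * f x + e * f' x)%C); [exact D|].
      f_equal. ring.
    - rewrite Rmin_left, Rmax_right by exact Hab. intros x Hx.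
      apply continuity_pt_filterlim.
      apply (continuous_Rminus (fun x => Re (e * f x)%C) p); [|now apply Cp].
      apply (continuous_Re (fun x => (e * f x)%C)).
      apply continuous_Cmult; [cont|now apply Cf].
    - rewrite Hc. assert (g' c <= 0); [|nra]. unfold g'.
      destruct (Rlt_dec a c); [|lra]. destruct (Rlt_dec c b); [|lra].
      assert (Re (e * f' c)%C <= Cmod (f' c)).
      { eapply Rle_trans; [apply Rle_abs|]. eapply Rle_trans; [apply Re_le|].
        rewrite Cmod_mult. generalize (Cmod_ge_0 (f' c)). nra. }
      generalize (Hle c ltac:(lra)). lra. }
  assert (K : Re (e * u)%C = Re (e * f b)%C - Re (e * f a)%C)
    by (unfold u; simpl; ring).
  unfold g in G. rewrite He1 in K. lra.
Qed.

Lemma CD_zero_const (f : R -> C) (a b : R) :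
  a <= b ->
  (forall x, a < x < b -> CD f x (RtoC 0)) ->
  (forall x, a <= x <= b -> continuous f x) -> f b = f a.
Proof.
  intros Hab Hf Cf.
  assert (H : Cmod (f b - f a) <= 0 - 0).
  { apply (CD_mean_value f (fun _ => RtoC 0) (fun _ => 0) (fun _ => 0)); auto.
    - intros; apply (is_derive_const (V := R_NormedModule)).
    - cont.
    - intros; rewrite Cmod_0; lra. }
  assert (Z : (f b - f a)%C = RtoC 0)
    by (apply Cmod_eq_0; generalize (Cmod_ge_0 (f b - f a)); lra).
  replace (f b) with (f b - f a + f a)%C by ring. rewrite Z. ring.
Qed.

(** The definition of the derivative by increments. *)
Lemma CD_eps (f : R -> C) (x0 : R) (l : C) :
  (forall eps, 0 < eps -> locally x0 (fun x =>
     Cmod (f x - f x0 - RtoC (x - x0) * l) <= eps * Rabs (x - x0))) ->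
  CD f x0 l.
Proof.
  intros H. split; [apply (is_linear_scal_l (V:=C_R_NormedModule))|].
  intros y Hy.
  apply (is_filter_lim_locally_unique (V:=AbsRing_NormedModule R_AbsRing)) in Hy. subst y.
  intros eps. generalize (H eps (cond_pos eps)). apply filter_imp.
  intros y Hle.
  refine (Rle_trans _ _ _ _ Hle). right. rewrite <- scal_R_Cmult, Cmod_norm. reflexivity.
Qed.

(** If [f'] stays within [eps] of [l] between [x0] and [x], the linear
    approximation of slope [l] has an error at most [eps |x - x0|]. *)
Lemma CD_increment (f f' : R -> C) (l : C) (x0 x eps : R) :
  0 <= eps ->
  (forall y, Rabs (y - x0) <= Rabs (x - x0) ->
     CD f y (f' y) /\ Cmod (f' y - l) <= eps) ->
  Cmod (f x - f x0 - RtoC (x - x0) * l) <= eps * Rabs (x - x0).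
Proof.
  intros He H.
  set (g := fun y => (f y - RtoC y * l)%C).
  assert (Hg : forall y, Rabs (y - x0) <= Rabs (x - x0) -> CD g y (f' y - l)%C).
  { intros y Hy. apply CD_minus; [now apply H|].
    apply CD_eq with (RtoC 1 * l + RtoC y * 0)%C; [|ring].
    apply CD_mult; [|apply CD_const]. apply CD_RtoC.
    apply (is_derive_id (K := R_AbsRing)). }
  assert (D : forall k y : R, is_derive (fun y => k * y) y k).
  { intros k y. auto_derive; [trivial|ring]. }
  destruct (Rle_dec x0 x) as [L|L].
  - replace (f x - f x0 - RtoC (x - x0) * l)%C with (g x - g x0)%C
      by (unfold g; rewrite RtoC_minus; ring).
    rewrite (Rabs_pos_eq (x - x0)) in * by lra.
    replace (eps * (x - x0)) with (eps * x - eps * x0) by ring.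
    apply (CD_mean_value g (fun y => (f' y - l)%C) (fun y => eps * y) (fun _ => eps));
      auto.
    + intros y Hy; apply Hg; rewrite Rabs_pos_eq; lra.
    + intros y Hy. eapply CD_continuous. apply Hg; rewrite Rabs_pos_eq; lra.
    + cont.
    + intros y Hy. apply H; rewrite Rabs_pos_eq; lra.
  - replace (f x - f x0 - RtoC (x - x0) * l)%C with (- (g x0 - g x))%C
      by (unfold g; rewrite RtoC_minus; ring).
    rewrite Cmod_opp. rewrite (Rabs_left (x - x0)) in * by lra.
    replace (eps * (-(x - x0))) with (eps * x0 - eps * x) by ring.
    apply (CD_mean_value g (fun y => (f' y - l)%C) (fun y => eps * y) (fun _ => eps));
      auto.
    + lra.
    + intros y Hy; apply Hg; rewrite Rabs_left; lra.
    + intros y Hy. eapply CD_continuous. apply Hg. rewrite Rabs_left1; lra.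
    + cont.
    + intros y Hy. apply H; rewrite Rabs_left; lra.
Qed.

(** * Integrals *)

(** The projection of the line on [[a, b]]; composing with it extends continuous
    functions. *)
Definition clamp (a b x : R) : R := Rmax a (Rmin b x).

Lemma clamp_in a b x : a <= b -> a <= clamp a b x <= b.
Proof. intros H; unfold clamp, Rmax, Rmin; repeat destruct Rle_dec; lra. Qed.

Lemma clamp_id a b x : a <= x <= b -> clamp a b x = x.
Proof. intros H; unfold clamp, Rmax, Rmin; repeat destruct Rle_dec; lra. Qed.

Lemma clamp_lip a b x y : Rabs (clamp a b x - clamp a b y) <= Rabs (x - y).
Proof.
  unfold clamp, Rmax, Rmin; repeat destruct Rle_dec;
  unfold Rabs; repeat destruct Rcase_abs; lra.
Qed.

Lemma continuous_clamp a b x : continuous (clamp a b) x.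
Proof.
  apply filterlim_locally. intros eps. apply locally_R. exists eps.
  split; [apply cond_pos|]. intros y Hy.
  eapply Rle_lt_trans; [apply clamp_lip|exact Hy].
Qed.

#[local] Hint Resolve continuous_clamp : cont.

Lemma ex_CInt (f : R -> C) (a b : R) : a <= b ->
  (forall x, a <= x <= b -> continuous f x) ->
  ex_RInt (V := C_R_CompleteNormedModule) f a b.
Proof.
  intros H K. apply (ex_RInt_continuous (V := C_R_CompleteNormedModule)).
  rewrite Rmin_left, Rmax_right by exact H. exact K.
Qed.

Lemma is_CInt (f : R -> C) (a b : R) : a <= b ->
  (forall x, a <= x <= b -> continuous f x) ->
  is_RInt (V := C_R_NormedModule) f a b (CInt f a b).
Proof. intros H K. now apply (RInt_correct (V := C_R_CompleteNormedModule)), ex_CInt. Qed.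

Lemma CInt_unique (f : R -> C) (a b : R) (l : C) :
  is_RInt (V := C_R_NormedModule) f a b l -> CInt f a b = l.
Proof. apply (is_RInt_unique (V := C_R_CompleteNormedModule)). Qed.

Lemma CInt_ext (f g : R -> C) (a b : R) : a <= b ->
  (forall x, a < x < b -> f x = g x) -> CInt f a b = CInt g a b.
Proof.
  intros H K. apply (RInt_ext (V := C_R_CompleteNormedModule)).
  rewrite Rmin_left, Rmax_right by exact H. exact K.
Qed.

Lemma CInt_plus (f g : R -> C) (a b : R) : a <= b ->
  (forall x, a <= x <= b -> continuous f x) ->
  (forall x, a <= x <= b -> continuous g x) ->
  CInt (fun x => f x + g x)%C a b = (CInt f a b + CInt g a b)%C.
Proof.
  intros H Kf Kg. apply CInt_unique.
  apply (is_RInt_plus (V := C_R_NormedModule)); now apply is_CInt.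
Qed.

Lemma CInt_minus (f g : R -> C) (a b : R) : a <= b ->
  (forall x, a <= x <= b -> continuous f x) ->
  (forall x, a <= x <= b -> continuous g x) ->
  CInt (fun x => f x - g x)%C a b = (CInt f a b - CInt g a b)%C.
Proof.
  intros H Kf Kg. apply CInt_unique.
  apply (is_RInt_minus (V := C_R_NormedModule)); now apply is_CInt.
Qed.

Lemma CInt_scal (c : C) (f : R -> C) (a b : R) : a <= b ->
  (forall x, a <= x <= b -> continuous f x) ->
  CInt (fun x => c * f x)%C a b = (c * CInt f a b)%C.
Proof.
  intros H Kf. apply CInt_unique.
  assert (I := is_CInt f a b H Kf).
  assert (I1 := is_RInt_fct_extend_fst (U:=R_NormedModule) (V:=R_NormedModule) f a b _ I).
  assert (I2 := is_RInt_fct_extend_snd (U:=R_NormedModule) (V:=R_NormedModule) f a b _ I).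
  apply (is_RInt_fct_extend_pair (U:=R_NormedModule) (V:=R_NormedModule)).
  - apply (is_RInt_minus (V:=R_NormedModule)
       (fun t => fst c * fst (f t)) (fun t => snd c * snd (f t)));
    apply (is_RInt_scal (V:=R_NormedModule)); assumption.
  - apply (is_RInt_plus (V:=R_NormedModule)
       (fun t => fst c * snd (f t)) (fun t => snd c * fst (f t)));
    apply (is_RInt_scal (V:=R_NormedModule)); assumption.
Qed.

Lemma CInt_const (c : C) (a b : R) : CInt (fun _ => c) a b = (RtoC (b - a) * c)%C.
Proof.
  rewrite (RInt_const (V := C_R_CompleteNormedModule)). apply scal_R_Cmult.
Qed.

(** The bound is the increment of a primitive [p] of a majorant [p'] of [|f|]. *)
Lemma CInt_bound (f : R -> C) (p p' : R -> R) (a b : R) : a <= b ->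
  (forall x, a <= x <= b -> continuous f x) ->
  (forall x, a <= x <= b -> is_derive p x (p' x)) ->
  (forall x, a <= x <= b -> continuous p' x) ->
  (forall x, a <= x <= b -> Cmod (f x) <= p' x) ->
  Cmod (CInt f a b) <= p b - p a.
Proof.
  intros H Kf Dp Cp Hle. rewrite Cmod_norm.
  apply (norm_RInt_le (V := C_R_NormedModule) f p' a b); auto.
  - intros x Hx. rewrite <- Cmod_norm. now apply Hle.
  - now apply is_CInt.
  - apply (is_RInt_derive (V := R_CompleteNormedModule));
    rewrite Rmin_left, Rmax_right by exact H; assumption.
Qed.

Lemma CInt_bound_const (f : R -> C) (M a b : R) : a <= b ->
  (forall x, a <= x <= b -> continuous f x) ->
  (forall x, a <= x <= b -> Cmod (f x) <= M) ->
  Cmod (CInt f a b) <= M * (b - a).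
Proof.
  intros H Kf Hle. replace (M * (b - a)) with (M * b - M * a) by ring.
  apply (CInt_bound f (fun x => M * x) (fun _ => M)); auto.
  - intros x _. auto_derive; [trivial|ring].
  - cont.
Qed.

(** Only the interior derivative matters in the fundamental theorem. *)
Lemma CInt_FTC (f f' : R -> C) (a b : R) : a <= b ->
  (forall x, a < x < b -> CD f x (f' x)) ->
  (forall x, a <= x <= b -> continuous f x) ->
  (forall x, a <= x <= b -> continuous f' x) ->
  CInt f' a b = (f b - f a)%C.
Proof.
  intros Hab Hf Cf Cf'.
  (* [f'] is extended to the line, so that its integral is differentiable also
     at the endpoints. *)
  set (g := fun x => f' (clamp a b x)).
  assert (Cg : forall x, continuous g x).
  { intros x. apply (continuous_comp (clamp a b) f'); [cont|].
    apply Cf', clamp_in, Hab. }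
  assert (I' : forall x, is_RInt (V := C_R_NormedModule) g a x (CInt g a x)).
  { intros x. apply (RInt_correct (V := C_R_CompleteNormedModule)).
    apply (ex_RInt_continuous (V := C_R_CompleteNormedModule)). auto. }
  assert (D : forall x, CD (fun x => CInt g a x) x (g x)).
  { intros x. apply (is_derive_RInt (V := C_R_NormedModule) g _ a x); [|apply Cg].
    now apply filter_forall. }
  rewrite (CInt_ext f' g a b Hab)
    by (intros x Hx; unfold g; rewrite clamp_id; [reflexivity|lra]).
  assert (E := CD_zero_const (fun x => CInt g a x - f x)%C a b Hab).
  simpl in E. rewrite (RInt_point (V := C_R_CompleteNormedModule) a g) in E.
  change (@zero (CompleteNormedModule.AbelianMonoid R_AbsRing C_R_CompleteNormedModule)) with (RtoC 0) in E.
  assert (E' : (CInt g a b - f b = 0 - f a)%C).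
  { apply E.
    - intros x Hx. apply CD_eq with (g x - f' x)%C.
      + apply CD_minus; [apply D|now apply Hf].
      + unfold g; rewrite clamp_id by lra. ring.
    - intros x Hx. apply continuous_Cminus; [|now apply Cf].
      eapply CD_continuous; apply D. }
  revert E'. generalize (CInt g a b) (f a) (f b). intros u v w E'.
  change (@eq C u (w - v)%C). replace u with (u - w + w)%C by ring. rewrite E'. ring.
Qed.

Lemma CInt_derive (f : R -> C) (a x : R) :
  (forall y, continuous f y) -> CD (fun x => CInt f a x) x (f x).
Proof.
  intros Cg. apply (is_derive_RInt (V := C_R_NormedModule) f _ a x); [|apply Cg].
  apply filter_forall. intros y. apply (RInt_correct (V := C_R_CompleteNormedModule)).
  apply (ex_RInt_continuous (V := C_R_CompleteNormedModule)). auto.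
Qed.

(** * Integrals depending on a parameter *)

(** Compactness of [[a, b]]: a property that holds near each point of
    [{z0} * [a, b]] holds on [U * [a, b]] for some neighbourhood [U] of [z0]. *)
Lemma tube {T : UniformSpace} (z0 : T) (a b : R) (P : T -> R -> Prop) :
  (forall s, a <= s <= b ->
     locally (T := prod_UniformSpace T R_UniformSpace) (z0, s)
       (fun p => P (fst p) (snd p))) ->
  locally z0 (fun z => forall s, a <= s <= b -> P z s).
Proof.
  intros H.
  destruct (Rle_dec a b) as [Hab|Hab]; [|apply filter_forall; intros; lra].
  (* The supremum of the [x] for which the statement holds on [[a, x]] is [b]. *)
  set (E := fun x => a <= x <= b /\ locally z0 (fun z => forall s, a <= s <= x -> P z s)).
  assert (Ea : E a).
  { split; [lra|]. destruct (H a ltac:(lra)) as [d Hd]. exists d. intros z Hz s Hs.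
    assert (s = a) by lra. subst s. apply (Hd (z, a)). split; [exact Hz|apply ball_center]. }
  destruct (completeness E) as [m [Hub Hlub]].
  { exists b. intros x [Hx _]. lra. }
  { now exists a. }
  assert (Hm : a <= m <= b).
  { split; [now apply Hub|]. apply Hlub. intros x [Hx _]; lra. }
  destruct (H m Hm) as [d Hd].
  assert (Em : exists x, E x /\ m - d < x).
  { apply Classical_Prop.NNPP. intros N. assert (m <= m - d).
    - apply Hlub. intros x Hx. apply Rnot_lt_le. intros L. apply N. now exists x.
    - generalize (cond_pos d). lra. }
  destruct Em as [x [[Hx Lx] Hmx]].
  assert (L2 : forall y, y <= b -> y < m + d -> locally z0 (fun z => forall s, a <= s <= y -> P z s)).
  { intros y Hy Hyd.
    assert (L3 : locally z0 (fun z => ball z0 d z)) by (exists d; auto).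
    generalize (filter_and _ _ Lx L3). apply filter_imp. intros z [A1 A2] s Hs.
    destruct (Rle_dec s x); [apply A1; lra|].
    apply (Hd (z, s)). split; [exact A2|]. simpl.
    change (Rabs (s - m) < d). apply Rabs_lt_between'. lra. }
  destruct (Rlt_dec m b) as [L|L].
  - exfalso. set (y := Rmin b (m + d / 2)).
    assert (Hy : m < y <= b /\ y < m + d).
    { generalize (cond_pos d). unfold y, Rmin; destruct Rle_dec; lra. }
    assert (y <= m); [|lra]. apply Hub. split; [lra|]. apply L2; lra.
  - apply L2; generalize (cond_pos d); lra.
Qed.

Lemma locally_uniform {T : UniformSpace} (F : T -> R -> C) (z0 : T) (a b e : R) :
  0 < e ->
  (forall s, a <= s <= b ->
     continuous (T := prod_UniformSpace T R_UniformSpace)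
       (fun p => F (fst p) (snd p)) (z0, s)) ->
  locally z0 (fun z => forall s, a <= s <= b -> Cmod (F z s - F z0 s) < e).
Proof.
  intros He Hc. apply tube. intros s Hs.
  assert (He2 : 0 < e / 2) by lra.
  assert (A1 := proj1 (continuous_C_eps _ _) (Hc s Hs) _ He2). cbn [fst snd] in A1.
  assert (A3 : locally (T := prod_UniformSpace T R_UniformSpace) (z0, s)
             (fun p => Cmod (F z0 (snd p) - F z0 s) < e / 2)).
  { destruct A1 as [d Hd]. exists d. intros [z u] [_ Hu].
    apply (Hd (z0, u)). split; [apply ball_center|exact Hu]. }
  generalize (filter_and _ _ A1 A3). apply filter_imp. intros [z u] [B1' B2]. simpl in *.
  replace (F z u - F z0 u)%C with ((F z u - F z0 s) + - (F z0 u - F z0 s))%C by ring.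
  eapply Rle_lt_trans; [apply Cmod_triangle|]. rewrite Cmod_opp. lra.
Qed.

Lemma CInt_param_continuous {T : UniformSpace} (F : T -> R -> C) (z0 : T) (a b : R) :
  a <= b ->
  (forall s, a <= s <= b ->
     continuous (T := prod_UniformSpace T R_UniformSpace)
       (fun p => F (fst p) (snd p)) (z0, s)) ->
  locally z0 (fun z => forall s, a <= s <= b -> continuous (F z) s) ->
  continuous (fun z => CInt (F z) a b) z0.
Proof.
  intros Hab Hc Hl. apply continuous_C_eps. intros eps He.
  set (e := eps / (b - a + 1)).
  assert (He' : 0 < e) by (apply Rdiv_lt_0_compat; lra).
  assert (C0 := locally_singleton _ _ Hl).
  generalize (filter_and _ _ (locally_uniform F z0 a b e He' Hc) Hl). apply filter_imp.
  intros z [A1 A2]. rewrite <- CInt_minus; auto.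
  apply Rle_lt_trans with (e * (b - a)).
  - apply CInt_bound_const; auto.
    + cont.
    + intros x Hx. left. now apply A1.
  - assert (e * (b - a + 1) = eps) by (unfold e; field; lra). lra.
Qed.

Lemma CInt_param_derive (F Fx : R -> R -> C) (x0 a b : R) :
  a <= b ->
  locally x0 (fun x => forall s, a <= s <= b ->
     CD (fun x => F x s) x (Fx x s) /\ continuous (F x) s) ->
  (forall s, a <= s <= b -> continuous (T := RR) (fun p => Fx (fst p) (snd p)) (x0, s)) ->
  CD (fun x => CInt (F x) a b) x0 (CInt (Fx x0) a b).
Proof.
  intros Hab Hl Hc. apply CD_eps. intros eps He.
  set (e := eps / (b - a + 1)).
  assert (He' : 0 < e) by (apply Rdiv_lt_0_compat; lra).
  assert (C0 : forall s, a <= s <= b -> continuous (Fx x0) s).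
  { intros s Hs. apply (continuous_comp_2 (fun _ => x0) (fun s => s) Fx);
    [cont|cont|now apply Hc]. }
  assert (L := filter_and _ _ (locally_uniform Fx x0 a b e He' Hc) Hl).
  apply locally_R in L. destruct L as [d [Hd L]].
  apply locally_R. exists d. split; [exact Hd|]. intros x Hx.
  assert (X0 : Rabs (x0 - x0) < d) by (rewrite Rminus_diag, Rabs_R0; exact Hd).
  rewrite <- CInt_scal by (auto; intros; now apply C0).
  assert (Cx : forall s, a <= s <= b -> continuous (F x) s) by (intros s Hs; now apply L).
  assert (Cx0 : forall s, a <= s <= b -> continuous (F x0) s) by (intros s Hs; now apply L).
  rewrite <- CInt_minus by auto. rewrite <- CInt_minus; auto.
  - apply Rle_trans with ((e * Rabs (x - x0)) * (b - a)).
    + apply CInt_bound_const; auto.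
      * cont.
      * intros s Hs. apply (CD_increment (fun x => F x s) (fun x => Fx x s)); [lra|].
        intros y Hy. split; [apply L; auto; lra|]. left. apply L; auto; lra.
    + assert (e * (b - a + 1) = eps) by (unfold e; field; lra).
      generalize (Rabs_pos (x - x0)). nra.
  - cont.
  - cont.
Qed.

(** * Functions of two real variables *)

(** It is enough that one of the two partial derivatives be continuous. *)
Lemma CD_chain (F Fx Fy : C -> C) (x y : R -> R) (x' y' s : R) :
  locally ((x s, y s) : C) (fun w => CD (fun t => F (t, Im w)) (Re w) (Fx w)) ->
  continuous Fx (x s, y s) ->
  CD (fun t => F (x s, t)) (y s) (Fy (x s, y s)) ->
  is_derive x s x' -> is_derive y s y' ->
  CD (fun s => F (x s, y s)) s
     (RtoC x' * Fx (x s, y s) + RtoC y' * Fy (x s, y s))%C.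
Proof.
  intros Hx Cx Hy Dx Dy.
  assert (A : forall (p : C -> R) ,
    (forall (f : R -> C) (u : R) (l : C), CD f u l -> is_derive (fun t => p (f t)) u (p l)) ->
    continuous (fun w => p (Fx w)) (x s, y s) ->
    is_derive (fun s => p (F (x s, y s))) s
     (x' * p (Fx (x s, y s)) + y' * p (Fy (x s, y s)))).
  { intros p Hp Cp.
    assert (L := is_derive_filterdiff (fun u v => p (F (u, v))) (x s) (y s)
                   (fun u v => p (Fx (u, v))) (p (Fy (x s, y s)))).
    assert (L2 := L ltac:(revert Hx; apply filter_imp; intros [u v]; apply Hp)
                    (Hp _ _ _ Hy) ltac:(apply (continuous_ext (T:=RR) (U:=R_UniformSpace) (fun w => p (Fx w)));
                      [intros [u v]; reflexivity|exact Cp])).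
    assert (L3 := filterdiff_comp'_2 (K:=R_AbsRing) (T:=R_NormedModule) (U:=R_NormedModule)
      (V:=R_NormedModule) (W:=R_NormedModule) x y (fun u v => p (F (u, v))) s
      (fun t => scal t x') (fun t => scal t y')
      (fun a b => plus (scal a (p (Fx (x s, y s)))) (scal b (p (Fy (x s, y s)))))
      Dx Dy L2).
    refine (filterdiff_ext_lin _ _ _ L3 _). intros t.
    unfold scal, plus; simpl; unfold mult; simpl. ring. }
  apply CD_iff; split.
  - replace (Re (RtoC x' * Fx (x s, y s) + RtoC y' * Fy (x s, y s))%C)
      with (x' * Re (Fx (x s, y s)) + y' * Re (Fy (x s, y s))) by (unfold Re, Im; simpl; ring).
    apply A; [intros f u l D; apply CD_iff in D; apply D|cont].
  - replace (Im (RtoC x' * Fx (x s, y s) + RtoC y' * Fy (x s, y s))%C)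
      with (x' * Im (Fx (x s, y s)) + y' * Im (Fy (x s, y s))) by (unfold Re, Im; simpl; ring).
    apply A; [intros f u l D; apply CD_iff in D; apply D|cont].
Qed.

(** [h] is of class C^1 on [U], with partial derivatives [hx] and [hy]. *)
Record C1on (U : C -> Prop) (h hx hy : C -> C) : Prop := {
  C1_cont : forall z, U z -> continuous h z;
  C1_contx : forall z, U z -> continuous hx z;
  C1_conty : forall z, U z -> continuous hy z;
  C1_derx : forall z, U z -> CD (fun t => h (t, Im z)) (Re z) (hx z);
  C1_dery : forall z, U z -> CD (fun t => h (Re z, t)) (Im z) (hy z)
}.

Arguments C1_cont {U h hx hy}.
Arguments C1_contx {U h hx hy}.
Arguments C1_conty {U h hx hy}.
Arguments C1_derx {U h hx hy}.
Arguments C1_dery {U h hx hy}.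

#[local] Hint Extern 2 (continuous _ _) =>
  first [ eapply C1_cont; [eassumption|auto] | eapply C1_contx; [eassumption|auto]
        | eapply C1_conty; [eassumption|auto] ] : cont.

Lemma C1on_chain (U : C -> Prop) h hx hy (x y : R -> R) (x' y' s : R) :
  open U -> C1on U h hx hy -> U (x s, y s) ->
  is_derive x s x' -> is_derive y s y' ->
  CD (fun s => h (x s, y s)) s (RtoC x' * hx (x s, y s) + RtoC y' * hy (x s, y s))%C.
Proof.
  intros HU H Hs Dx Dy. apply CD_chain; auto.
  - apply (filter_imp U); [intros w Hw; now apply (C1_derx H)|now apply HU].
  - now apply (C1_contx H).
  - apply (C1_dery H _ Hs).
Qed.

Lemma locally_slice_x (z : C) (P : C -> Prop) :
  locally z P -> locally (Re z) (fun x => P (x, Im z)).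
Proof.
  intros [d Hd]. exists d. intros x Hx. apply Hd. split; [exact Hx|apply ball_center].
Qed.

Lemma locally_slice_y (z : C) (P : C -> Prop) :
  locally z P -> locally (Im z) (fun y => P (Re z, y)).
Proof.
  intros [d Hd]. exists d. intros x Hx. apply Hd. split; [apply ball_center|exact Hx].
Qed.

(** Differentiation under the integral sign along a curve [l]. *)
Lemma CInt_line_derive (U : C -> Prop) (F Fx : C -> R -> C) (l : R -> C) (x0 a b : R) :
  open U -> a <= b -> (forall x, continuous l x) -> U (l x0) ->
  (forall z s, U z -> a <= s <= b -> continuous (F z) s) ->
  (forall z s, U z -> a <= s <= b ->
     continuous (T := CR) (fun p => Fx (fst p) (snd p)) (z, s)) ->
  (forall x s, U (l x) -> a <= s <= b -> CD (fun t => F (l t) s) x (Fx (l x) s)) ->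
  CD (fun t => CInt (F (l t)) a b) x0 (CInt (Fx (l x0)) a b).
Proof.
  intros HU Hab Cl H0 CF CFx D.
  apply (CInt_param_derive (fun t => F (l t)) (fun t => Fx (l t)) x0 a b Hab).
  - assert (L : locally x0 (fun x => U (l x))) by exact (Cl x0 U (HU _ H0)).
    revert L. apply filter_imp. auto.
  - intros s Hs. apply (continuous_comp_2 (U := RR) (V := C_UniformSpace) (W := R_UniformSpace)
      (fun p => l (fst p)) (fun p => snd p) Fx); [cont|cont|now apply CFx].
Qed.

(** Differentiation under the integral sign, in the plane. *)
Lemma C1on_CInt (U : C -> Prop) (F Fx Fy : C -> R -> C) (a b : R) :
  open U -> a <= b ->
  (forall z s, U z -> a <= s <= b ->
     continuous (T := CR)
       (fun p => F (fst p) (snd p)) (z, s)) ->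
  (forall z s, U z -> a <= s <= b ->
     continuous (T := CR)
       (fun p => Fx (fst p) (snd p)) (z, s)) ->
  (forall z s, U z -> a <= s <= b ->
     continuous (T := CR)
       (fun p => Fy (fst p) (snd p)) (z, s)) ->
  (forall z s, U z -> a <= s <= b -> CD (fun t => F (t, Im z) s) (Re z) (Fx z s)) ->
  (forall z s, U z -> a <= s <= b -> CD (fun t => F (Re z, t) s) (Im z) (Fy z s)) ->
  C1on U (fun z => CInt (F z) a b) (fun z => CInt (Fx z) a b) (fun z => CInt (Fy z) a b).
Proof.
  intros HU Hab H0 H1 H2 D1 D2.
  assert (S : forall G : C -> R -> C, (forall z s, U z -> a <= s <= b ->
     continuous (T := CR)
       (fun p => G (fst p) (snd p)) (z, s)) ->
     forall z s, U z -> a <= s <= b -> continuous (G z) s).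
  { intros G HG z s Hz Hs. apply (continuous_comp_2 (fun _ => z) (fun s => s) G);
    [cont|cont|now apply HG]. }
  assert (K : forall G : C -> R -> C, (forall z s, U z -> a <= s <= b ->
     continuous (T := CR)
       (fun p => G (fst p) (snd p)) (z, s)) ->
     forall z, U z -> continuous (fun z => CInt (G z) a b) z).
  { intros G HG z Hz. apply CInt_param_continuous; auto.
    apply (filter_imp U); [|now apply HU]. intros w Hw s Hs. now apply (S G HG). }
  split; auto; intros z Hz; assert (Hz' : U (Re z, Im z)) by (destruct z; exact Hz).
  - replace (CInt (Fx z) a b) with (CInt (Fx (Re z, Im z)) a b) by (destruct z; reflexivity).
    apply (CInt_line_derive U F Fx (fun t => (t, Im z))); auto; [cont|].
    intros x s Hx Hs. exact (D1 _ s Hx Hs).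
  - replace (CInt (Fy z) a b) with (CInt (Fy (Re z, Im z)) a b) by (destruct z; reflexivity).
    apply (CInt_line_derive U F Fy (fun t => (Re z, t))); auto; [cont|].
    intros y s Hy Hs. exact (D2 _ s Hy Hs).
Qed.

(** * Boundedness and continuity up to the boundary *)

(** [1 / M] plays the role of the parameter in the compactness argument. *)
Lemma bounded_rect (F : C -> C) (a b c d : R) :
  (forall p, continuous F p) ->
  exists M, 0 < M /\ forall r t, a <= r <= b -> c <= t <= d -> Cmod (F (r, t)) <= M.
Proof.
  intros CF.
  assert (H : locally (T := R_UniformSpace) 0 (fun z => forall r, a <= r <= b -> forall t, c <= t <= d ->
                Cmod (F (r, t)) * Rabs z < 1)).
  { apply (tube 0 a b (fun z r => forall t, c <= t <= d -> Cmod (F (r, t)) * Rabs z < 1)).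
    intros r Hr.
    apply (tube (T := RR) (0, r) c d
             (fun p t => Cmod (F (snd p, t)) * Rabs (fst p) < 1)).
    intros t Ht.
    assert (Cn : continuous (T := prod_UniformSpace RR R_UniformSpace)
      (U := R_UniformSpace)
      (fun p => Cmod (F (snd (fst p), snd p)) * Rabs (fst (fst p))) ((0, r), t)) by cont.
    assert (N := proj1 (filterlim_locally _ _) Cn (mkposreal 1 Rlt_0_1)).
    revert N. apply filter_imp. intros [[z r'] t'] Hb. simpl in *.
    unfold ball in Hb; simpl in Hb; unfold AbsRing_ball, abs, minus, plus, opp in Hb; simpl in Hb.
    rewrite Rabs_R0, Rmult_0_r, Ropp_0, Rplus_0_r in Hb.
    apply Rabs_lt_between in Hb. lra. }
  apply locally_R in H. destruct H as [e [He H]].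
  exists (/ (e / 2)). split; [apply Rinv_0_lt_compat; lra|]. intros r t Hr Ht.
  assert (K : Cmod (F (r, t)) * Rabs (e / 2) < 1).
  { apply H; auto. rewrite Rminus_0_r, Rabs_pos_eq; lra. }
  rewrite Rabs_pos_eq in K by lra. apply Rmult_le_reg_r with (e / 2); [lra|].
  rewrite Rinv_l by lra. lra.
Qed.

Lemma rectangle_dense (rho r t d : R) : 0 < rho -> 0 <= r <= rho -> 0 <= t <= 1 -> 0 < d ->
  exists r' t', rectangle rho (r', t') /\ Cmod ((r', t') - (r, t))%C < d.
Proof.
  intros Hr0 Hr Ht Hd.
  set (e := Rmin (1/2) (d / (4 * (rho + 1)))).
  assert (He : 0 < e <= 1/2 /\ e * (4 * (rho + 1)) <= d).
  { unfold e. assert (0 < d / (4 * (rho + 1))) by (apply Rdiv_lt_0_compat; lra).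
    assert (d / (4 * (rho + 1)) * (4 * (rho + 1)) = d) by (field; lra).
    unfold Rmin; destruct Rle_dec; [|lra]. split; [lra|].
    apply Rle_trans with (d / (4 * (rho + 1)) * (4 * (rho + 1))); [|lra].
    apply Rmult_le_compat_r; lra. }
  exists (r + e * (rho / 2 - r)), (t + e * (1 / 2 - t)). split.
  - unfold rectangle; simpl. split; nra.
  - eapply Rle_lt_trans; [apply Cmod_le_sum|]. unfold Re, Im, Cminus; simpl.
    replace (r + e * (rho / 2 - r) + - r) with (e * (rho / 2 - r)) by ring.
    replace (t + e * (1 / 2 - t) + - t) with (e * (1 / 2 - t)) by ring.
    rewrite !Rabs_mult, (Rabs_pos_eq e) by lra.
    assert (Rabs (rho / 2 - r) <= rho) by (apply Rabs_le; lra).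
    assert (Rabs (1 / 2 - t) <= 1) by (apply Rabs_le; lra).
    nra.
Qed.

Lemma rectangle_closure (rho r t : R) : 0 < rho -> 0 <= r <= rho -> 0 <= t <= 1 ->
  closure (rectangle rho) (r, t).
Proof.
  intros H0 Hr Ht eps He.
  destruct (rectangle_dense rho r t eps H0 Hr Ht He) as [r' [t' [H1 H2]]].
  now exists (r', t').
Qed.

Lemma rectangle_open (rho : R) : open (rectangle rho).
Proof.
  intros [r t] [H1 H2]. simpl in *. apply locally_disc.
  exists (Rmin (Rmin r (rho - r)) (Rmin t (1 - t))). split.
  - repeat apply Rmin_glb_lt; lra.
  - intros [r' t'] Hw. assert (A1 := Re_le ((r', t') - (r, t))%C).
    assert (A2 := Im_le ((r', t') - (r, t))%C). unfold Re, Im in A1, A2; simpl in A1, A2.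
    assert (B1 := Rmin_l (Rmin r (rho - r)) (Rmin t (1 - t))).
    assert (B2 := Rmin_r (Rmin r (rho - r)) (Rmin t (1 - t))).
    assert (B3 := Rmin_l r (rho - r)). assert (B4 := Rmin_r r (rho - r)).
    assert (B5 := Rmin_l t (1 - t)). assert (B6 := Rmin_r t (1 - t)).
    apply Rabs_le_between in A1. apply Rabs_le_between in A2.
    unfold rectangle; simpl; lra.
Qed.

(** Inequalities between continuous functions extend to the closed rectangle. *)
Lemma rectangle_le (rho : R) (u v : C -> R) : 0 < rho ->
  (forall p, continuous u p) -> (forall p, continuous v p) ->
  (forall r t, rectangle rho (r, t) -> u (r, t) <= v (r, t)) ->
  forall r t, 0 <= r <= rho -> 0 <= t <= 1 -> u (r, t) <= v (r, t).
Proof.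
  intros H0 Cu Cv H r t Hr Ht. apply Rnot_lt_le. intros L.
  assert (Cw : continuous (fun p => u p - v p) ((r, t) : C))
    by cont.
  assert (Hp : 0 < u (r, t) - v (r, t)) by lra.
  assert (N := proj1 (filterlim_locally _ _) Cw (mkposreal _ Hp)).
  apply locally_disc in N. destruct N as [d [Hd N]].
  destruct (rectangle_dense rho r t d H0 Hr Ht Hd) as [r' [t' [H1 H2]]].
  assert (N1 := N _ H2). unfold ball in N1; simpl in N1;
  unfold AbsRing_ball, abs, minus, plus, opp in N1; simpl in N1.
  apply Rabs_lt_between in N1. generalize (H r' t' H1). lra.
Qed.

Lemma unit_interval_eq (u v : R -> C) :
  (forall t, continuous u t) -> (forall t, continuous v t) ->
  (forall t, 0 < t < 1 -> u t = v t) ->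
  forall t, 0 <= t <= 1 -> u t = v t.
Proof.
  intros Cu Cv H t Ht.
  assert (K : Cmod (u t - v t) <= 0).
  { apply (rectangle_le 1 (fun p => Cmod (u (Im p) - v (Im p))) (fun _ => 0) Rlt_0_1) with (r := 0);
      try lra.
    - cont.
    - cont.
    - intros r s [_ Hs]. simpl in *. rewrite H by exact Hs.
      replace (v s - v s)%C with (RtoC 0) by ring. rewrite Cmod_0. lra. }
  assert (Z : (u t - v t)%C = 0%C)
    by (apply Cmod_eq_0; generalize (Cmod_ge_0 (u t - v t)); lra).
  replace (u t) with (u t - v t + v t)%C by ring. rewrite Z. ring.
Qed.

(** The projection of the plane on the closed rectangle. *)
Definition clamp2 (rho : R) (p : C) : C := (clamp 0 rho (Re p), clamp 0 1 (Im p)).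

Lemma continuous_clamp2 rho p : continuous (clamp2 rho) p.
Proof.
  apply continuous_Cpair.
  - cont.
  - cont.
Qed.

#[local] Hint Resolve continuous_clamp2 : cont.

Lemma clamp2_closure rho p : 0 < rho -> closure (rectangle rho) (clamp2 rho p).
Proof. intros H. apply rectangle_closure; auto; apply clamp_in; lra. Qed.

Lemma clamp2_id rho r t : 0 <= r <= rho -> 0 <= t <= 1 -> clamp2 rho (r, t) = (r, t).
Proof. intros H K. unfold clamp2; simpl. now rewrite !clamp_id. Qed.

Lemma continuous_on_comp {T U V : UniformSpace} (D : U -> Prop) (c : T -> U) (F : U -> V) (x : T) :
  (forall y, D (c y)) -> continuous c x -> continuous_on D F ->
  continuous (fun y => F (c y)) x.
Proof.
  intros HD Hc HF. eapply filterlim_comp; [|exact (HF (c x) (HD x))].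
  intros P HP. apply Hc in HP. unfold filtermap in *. revert HP. apply filter_imp.
  intros y Hy. apply Hy, HD.
Qed.

Lemma extends_rectangle (rho : R) (F : C -> C) : 0 < rho ->
  extends_to_closure (rectangle rho) F ->
  exists E : C -> C, (forall p, continuous E p) /\ (forall p, rectangle rho p -> E p = F p).
Proof.
  intros H0 [Fe [H1 H2]]. exists (fun p => Fe (clamp2 rho p)). split.
  - intros p. apply (continuous_on_comp (closure (rectangle rho)) (clamp2 rho) Fe); auto.
    + intros y; now apply clamp2_closure.
    + cont.
  - intros [r t] Hp. rewrite clamp2_id by (destruct Hp; simpl in *; lra). now apply H2.
Qed.

Lemma extends_segment (a b : R) (f : R -> C) : a <= b ->
  extends_to_segment a b f ->
  exists E : R -> C, (forall x, continuous E x) /\ (forall x, a < x < b -> E x = f x).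
Proof.
  intros H0 [Fe [H1 H2]]. exists (fun p => Fe (clamp a b p)). split.
  - intros p. apply (continuous_on_comp (fun r => a <= r <= b) (clamp a b) Fe); auto.
    + intros y; now apply clamp_in.
    + cont.
  - intros r Hr. rewrite clamp_id by lra. now apply H2.
Qed.

(** * The kernels *)

(** A kernel for the potential [q], together with its first and second partial
    derivatives, all of them continuous on the whole plane. *)
Record kernel_data (rho : R) (q : R -> C) (g gr gt grr grt : C -> C) : Prop := {
  kd_c : forall p, continuous g p;
  kd_cr : forall p, continuous gr p;
  kd_ct : forall p, continuous gt p;
  kd_crr : forall p, continuous grr p;
  kd_crt : forall p, continuous grt p;
  kd_r : forall r t, rectangle rho (r, t) -> CD (fun s => g (s, t)) r (gr (r, t));
  kd_t : forall r t, rectangle rho (r, t) -> CD (fun s => g (r, s)) t (gt (r, t));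
  kd_rr : forall r t, rectangle rho (r, t) -> CD (fun s => gr (s, t)) r (grr (r, t));
  kd_rt : forall r t, rectangle rho (r, t) -> CD (fun s => gr (r, s)) t (grt (r, t));
  kd_tr : forall r t, rectangle rho (r, t) -> CD (fun s => gt (s, t)) r (grt (r, t));
  kd_pde : forall r t, rectangle rho (r, t) ->
    (RtoC r * (grr (r, t) - q r * g (r, t)) - gr (r, t)
      + RtoC (2 * (1 - t)) * grt (r, t) = RtoC 0)%C;
  kd_0 : forall t, 0 <= t <= 1 -> g (0, t) = RtoC 0;
  kd_b : forall r, 0 <= r <= rho -> g (r, 0) = CInt (fun tau => RtoC tau * q tau)%C 0 r
}.

Arguments kd_c {rho q g gr gt grr grt}.
Arguments kd_cr {rho q g gr gt grr grt}.
Arguments kd_ct {rho q g gr gt grr grt}.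
Arguments kd_crr {rho q g gr gt grr grt}.
Arguments kd_crt {rho q g gr gt grr grt}.
Arguments kd_r {rho q g gr gt grr grt}.
Arguments kd_t {rho q g gr gt grr grt}.
Arguments kd_rr {rho q g gr gt grr grt}.
Arguments kd_rt {rho q g gr gt grr grt}.
Arguments kd_tr {rho q g gr gt grr grt}.
Arguments kd_pde {rho q g gr gt grr grt}.
Arguments kd_0 {rho q g gr gt grr grt}.
Arguments kd_b {rho q g gr gt grr grt}.

#[local] Hint Extern 1 (continuous _ _) =>
  first [ eapply kd_c; eassumption | eapply kd_cr; eassumption | eapply kd_ct; eassumption
        | eapply kd_crr; eassumption | eapply kd_crt; eassumption ] : cont.

(** The mixed partial derivatives agree; [p] selects the real or the imaginary
    part. *)
Lemma Schwarz_component (rho : R) (G : C -> C) (Gxy Gyx : C -> C) (p : C -> R) (r t : R) :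
  (p = Re \/ p = Im) ->
  rectangle rho (r, t) ->
  (forall z, rectangle rho z -> ex_Dx G z /\ ex_Dy G z) ->
  (forall z, rectangle rho z -> ex_Dx (Dx G) z /\ ex_Dy (Dx G) z) ->
  (forall z, rectangle rho z -> ex_Dx (Dy G) z /\ ex_Dy (Dy G) z) ->
  (forall z, continuous Gxy z) -> (forall z, continuous Gyx z) ->
  (forall z, rectangle rho z -> Gyx z = Dy (Dx G) z) ->
  (forall z, rectangle rho z -> Gxy z = Dx (Dy G) z) ->
  p (Dx (Dy G) (r, t)) = p (Dy (Dx G) (r, t)).
Proof.
  intros Hp Hrt H1 H2 H3 C1 C2 E1 E2.
  assert (S := Schwarz (fun u v => p (G (u, v))) r t).
  assert (L : locally_2d (fun u v => rectangle rho (u, v)) r t).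
  { apply locally_2d_locally. apply (filter_imp (rectangle rho));
    [intros [u v]; auto|now apply rectangle_open]. }
  assert (Cont : forall F : C -> C, (forall z, continuous F z) ->
            continuity_2d_pt (fun u v => p (F (u, v))) r t).
  { intros F CF. apply continuity_2d_pt_filterlim.
    change (@continuous C_UniformSpace R_UniformSpace (fun z => p (F (fst z, snd z))) (r, t)).
    apply (continuous_ext (T:=C_UniformSpace) (U:=R_UniformSpace)
             (fun w => p (F w))).
    - intros [u v]; reflexivity.
    - destruct Hp; subst p; [cont|cont]; apply CF. }
  assert (Q : forall u v, rectangle rho (u, v) ->
     ex_derive (fun z => p (G (z, v))) u /\ ex_derive (fun z => p (G (u, z))) v /\
     ex_derive (fun z => Derive (fun t => p (G (z, t))) v) u /\
     ex_derive (fun z => Derive (fun t => p (G (t, z))) u) v).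
  { intros u v Huv. destruct (H1 _ Huv) as [[a1 a2] [a3 a4]].
    destruct (H2 _ Huv) as [_ [b3 b4]]. destruct (H3 _ Huv) as [[c1 c2] _].
    destruct Hp; subst p; auto. }
  assert (M1 : forall w, rectangle rho w -> p (Gxy w) =
     Derive (fun z => Derive (fun t => p (G (z, t))) (Im w)) (Re w)).
  { intros w Hw. rewrite E2 by exact Hw. destruct Hp; subst p; reflexivity. }
  assert (M2 : forall w, rectangle rho w -> p (Gyx w) =
     Derive (fun z => Derive (fun t => p (G (t, z))) (Re w)) (Im w)).
  { intros w Hw. rewrite E1 by exact Hw. destruct Hp; subst p; reflexivity. }
  rewrite <- E1, <- E2 by exact Hrt. rewrite M1, M2 by exact Hrt. simpl. apply S.
  - revert L. apply locally_2d_impl, locally_2d_forall. exact Q.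
  - apply (continuity_2d_pt_ext_loc (fun u v => p (Gxy (u, v)))); [|now apply Cont].
    revert L. apply locally_2d_impl, locally_2d_forall. intros u v Huv. now apply M1.
  - apply (continuity_2d_pt_ext_loc (fun u v => p (Gyx (u, v)))); [|now apply Cont].
    revert L. apply locally_2d_impl, locally_2d_forall. intros u v Huv. now apply M2.
Qed.

(** The derivatives of a kernel are replaced by their continuous extensions, and
    the potential [q] by any function [qc] with the same values on [(0, rho)]. *)
Lemma is_kernel_data (rho : R) (q qc : R -> C) (G : C -> C) :
  0 < rho -> (forall r, 0 < r < rho -> q r = qc r) -> is_kernel rho q G ->
  exists g gr gt grr grt,
    kernel_data rho qc g gr gt grr grt /\
    (forall r t, 0 <= r <= rho -> 0 <= t <= 1 -> G (r, t) = g (r, t)).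
Proof.
  intros H0 Hq [[HC [_ [E1 [[Xr [E2 [Xrr Xrt]]] [Xt [E3 [Xtr _]]]]]]] [Hpde [Hb Hz]]].
  destruct (extends_rectangle rho _ H0 Xr) as [gr [cr er]].
  destruct (extends_rectangle rho _ H0 Xt) as [gt [ct et]].
  destruct (extends_rectangle rho _ H0 (proj1 Xrr)) as [grr [crr err]].
  destruct (extends_rectangle rho _ H0 (proj1 Xrt)) as [grt [crt ert]].
  destruct (extends_rectangle rho _ H0 (proj1 Xtr)) as [gtr [ctr etr]].
  set (g := fun p => G (clamp2 rho p)).
  assert (eg : forall r t, 0 <= r <= rho -> 0 <= t <= 1 -> G (r, t) = g (r, t))
    by (intros r t Hr Ht; unfold g; now rewrite clamp2_id).
  assert (eg' : forall p, rectangle rho p -> G p = g p).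
  { intros [r t] [A1 A2]; simpl in *. apply eg; lra. }
  assert (cg : forall p, continuous g p).
  { intros p. apply (continuous_on_comp (closure (rectangle rho)) (clamp2 rho) G); auto.
    + intros y; now apply clamp2_closure.
    + cont. }
  assert (sx : forall (A A' : C -> C), (forall p, rectangle rho p -> A p = A' p) ->
     forall r t, rectangle rho (r, t) -> locally r (fun s => A (s, t) = A' (s, t))).
  { intros A A' HA r t Hrt.
    apply (locally_slice_x (r, t) (fun w => A w = A' w)).
    apply (filter_imp (rectangle rho)); [exact HA|now apply rectangle_open]. }
  assert (sy : forall (A A' : C -> C), (forall p, rectangle rho p -> A p = A' p) ->
     forall r t, rectangle rho (r, t) -> locally t (fun s => A (r, s) = A' (r, s))).
  { intros A A' HA r t Hrt.
    apply (locally_slice_y (r, t) (fun w => A w = A' w)).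
    apply (filter_imp (rectangle rho)); [exact HA|now apply rectangle_open]. }
  assert (sym : forall A A' : C -> C, (forall p, rectangle rho p -> A p = A' p) ->
                (forall p, rectangle rho p -> A' p = A p)) by (intros; symmetry; auto).
  exists g, gr, gt, grr, grt. split; [split; auto|exact eg].
  - intros r t Hrt. apply (CD_ext_loc (fun s => G (s, t))).
    + now apply sx.
    + rewrite er by exact Hrt. apply CDerive_CD, (E1 (r, t) Hrt).
  - intros r t Hrt. apply (CD_ext_loc (fun s => G (r, s))).
    + now apply sy.
    + rewrite et by exact Hrt. apply CDerive_CD, (E1 (r, t) Hrt).
  - intros r t Hrt. apply (CD_ext_loc (fun s => Dx G (s, t))).
    + apply sx; [now apply sym|exact Hrt].
    + rewrite err by exact Hrt. apply CDerive_CD, (E2 (r, t) Hrt).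
  - intros r t Hrt. apply (CD_ext_loc (fun s => Dx G (r, s))).
    + apply sy; [now apply sym|exact Hrt].
    + rewrite ert by exact Hrt. apply CDerive_CD, (E2 (r, t) Hrt).
  - intros r t Hrt. apply (CD_ext_loc (fun s => Dy G (s, t))).
    + apply sx; [now apply sym|exact Hrt].
    + replace (grt (r, t)) with (Dx (Dy G) (r, t)).
      * apply CDerive_CD, (E3 (r, t) Hrt).
      * rewrite ert by exact Hrt.
        apply Ceq; [apply (Schwarz_component rho G gtr grt Re)|apply (Schwarz_component rho G gtr grt Im)]; auto.
  - intros r t Hrt. rewrite err, er, ert, <- Hq, <- eg' by (auto; apply Hrt). now apply Hpde.
  - intros t Ht. rewrite <- eg by lra. now apply Hz.
  - intros r Hr. rewrite <- eg by lra. rewrite Hb by exact Hr.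
    apply CInt_ext; [lra|]. intros x Hx. now rewrite Hq by lra.
Qed.

(** Integration along the characteristics of the operator
    [r d/dr - 1 + 2 (1 - t) d/dt]. On the curve [t = 1 - c / s^2] the function
    [F / s] has the derivative [(s F_r - F + 2 (1 - t) F_t) / s^2]; the curve
    starts on the side [t = 0]. *)
Lemma char_bound (rho : R) (F Fr Ft : C -> C) (B C0 : R) (m : nat) :
  (forall p, continuous F p) ->
  (forall p, rectangle rho p -> continuous Fr p) ->
  (forall r t, rectangle rho (r, t) -> CD (fun s => F (s, t)) r (Fr (r, t))) ->
  (forall r t, rectangle rho (r, t) -> CD (fun s => F (r, s)) t (Ft (r, t))) ->
  (forall r t, rectangle rho (r, t) ->
     Cmod (RtoC r * Fr (r, t) - F (r, t) + RtoC (2 * (1 - t)) * Ft (r, t))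
       <= C0 * r ^ (m + 2)) ->
  (forall s, 0 < s < rho -> Cmod (F (s, 0)) <= B * s) -> 0 <= C0 ->
  forall r t, rectangle rho (r, t) ->
    Cmod (F (r, t)) <= r * (B + C0 * (r ^ S m / INR (S m))).
Proof.
  intros CF CFr Dr Dt HM HB HC0 r t [Hr Ht]. simpl in Hr, Ht.
  (* The characteristic through [(r, t)] is the curve [s^2 (1 - t) = c]. *)
  set (c := r * r * (1 - t)).
  assert (Hc : 0 < c) by (unfold c; apply Rmult_lt_0_compat; [nra|lra]).
  set (s0 := sqrt c).
  assert (Hs0 : 0 < s0) by now apply sqrt_lt_R0.
  assert (Hs0c : s0 * s0 = c) by (apply sqrt_sqrt; lra).
  assert (Hs0r : s0 < r) by (unfold c in *; nra).
  set (tau := fun s => 1 - c / (s * s)).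
  set (phi := fun s => (RtoC (/ s) * F (s, tau s))%C).
  assert (Htau : forall s, 0 < s -> (1 - tau s) * (s * s) = c)
    by (intros s Hs; unfold tau; field; lra).
  assert (Hin : forall s, s0 < s < r -> rectangle rho (s, tau s)).
  { intros s Hs. assert (K := Htau s ltac:(lra)).
    assert (s0 * s0 < s * s) by nra. split; simpl; [lra|].
    assert (0 < s * s) by nra. split; nra. }
  assert (Dtau : forall s, 0 < s -> is_derive tau s (2 * (1 - tau s) / s)).
  { intros s Hs. unfold tau. auto_derive; [nra|]. field; lra. }
  assert (Dphi : forall s, s0 < s < r -> CD phi s
     (RtoC (/ (s * s)) * (RtoC s * Fr (s, tau s) - F (s, tau s)
        + RtoC (2 * (1 - tau s)) * Ft (s, tau s)))%C).
  { intros s Hs. assert (Hs' := Hin s Hs).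
    assert (D1 : CD (fun s => F (s, tau s)) s
       (RtoC 1 * Fr (s, tau s) + RtoC (2 * (1 - tau s) / s) * Ft (s, tau s))%C).
    { apply (CD_chain F Fr Ft (fun s => s) tau 1 (2 * (1 - tau s) / s) s).
      - apply (filter_imp (rectangle rho)); [|now apply rectangle_open].
        intros [u v] Huv. now apply Dr.
      - now apply CFr.
      - now apply Dt.
      - apply (is_derive_id (K := R_AbsRing)).
      - apply Dtau; lra. }
    assert (D2 : is_derive (fun s => / s) s (- / (s * s)))
      by (auto_derive; [lra|field; lra]).
    assert (D3 := CD_mult _ _ s _ _ (CD_RtoC _ _ _ D2) D1).
    refine (CD_eq _ _ _ _ D3 _).
    apply Ceq; unfold Re, Im; simpl; field; lra. }
  assert (Cphi : forall s, s0 <= s <= r -> continuous phi s).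
  { intros s Hs. apply continuous_Cmult.
    - apply continuous_RtoC, (continuous_Rinv s); lra.
    - apply (continuous_comp (fun s => (s, tau s) : C) F); [|apply CF].
      apply continuous_Cpair; [cont|].
      apply (ex_derive_continuous tau). exists (2 * (1 - tau s) / s). apply Dtau; lra. }
  assert (Nm : 0 < INR (S m)) by apply lt_0_INR, Nat.lt_0_succ.
  assert (MV := CD_mean_value phi _ (fun s => C0 * (s ^ S m / INR (S m))) (fun s => C0 * s ^ m)
    s0 r ltac:(lra) Dphi Cphi).
  assert (D4 : forall s, is_derive (fun s => C0 * (s ^ S m / INR (S m))) s (C0 * s ^ m)).
  { intros s. auto_derive; [trivial|].
    change (match m with O => 1 | S _ => INR m + 1 end) with (INR (S m)).
    field; lra. }
  assert (MV' : Cmod (phi r - phi s0) <=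
     C0 * (r ^ S m / INR (S m)) - C0 * (s0 ^ S m / INR (S m))).
  { apply MV.
    - intros s _; apply D4.
    - cont.
    - intros s Hs. rewrite Cmod_mult, Cmod_R, Rabs_pos_eq
        by (left; apply Rinv_0_lt_compat; nra).
      apply Rle_trans with (/ (s * s) * (C0 * s ^ (m + 2))).
      + apply Rmult_le_compat_l; [left; apply Rinv_0_lt_compat; nra|]. now apply HM, Hin.
      + right. rewrite pow_add. simpl. field. lra. }
  assert (P0 : 0 <= C0 * (s0 ^ S m / INR (S m))).
  { apply Rmult_le_pos; [exact HC0|]. apply Rdiv_le_0_compat; [|exact Nm].
    apply pow_le; lra. }
  assert (B0 : Cmod (phi s0) <= B).
  { unfold phi. replace (tau s0) with 0 by (unfold tau; rewrite Hs0c; field; lra).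
    rewrite Cmod_mult, Cmod_R, Rabs_pos_eq by (left; now apply Rinv_0_lt_compat).
    apply Rmult_le_reg_l with s0; [exact Hs0|]. rewrite <- Rmult_assoc, Rinv_r, Rmult_1_l by lra.
    rewrite Rmult_comm. apply HB; lra. }
  assert (T : tau r = t) by (unfold tau, c; field; lra).
  assert (Br : Cmod (phi r) <= B + C0 * (r ^ S m / INR (S m))).
  { replace (phi r) with (phi s0 + (phi r - phi s0))%C by ring.
    eapply Rle_trans; [apply Cmod_triangle|]. lra. }
  unfold phi in Br. rewrite T, Cmod_mult, Cmod_R, Rabs_pos_eq in Br
    by (left; apply Rinv_0_lt_compat; lra).
  apply Rmult_le_reg_l with (/ r); [apply Rinv_0_lt_compat; lra|].
  rewrite <- Rmult_assoc, Rinv_l, Rmult_1_l by lra. exact Br.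
Qed.

Lemma continuous_row (F : C -> C) (t r : R) :
  (forall p, continuous F p) -> continuous (fun s => F (s, t)) r.
Proof.
  intros CF. apply (continuous_comp (fun s => (s, t) : C) F); [|apply CF].
  apply continuous_Cpair; [cont|cont].
Qed.

Lemma continuous_col (F : C -> C) (r t : R) :
  (forall p, continuous F p) -> continuous (fun s => F (r, s)) t.
Proof.
  intros CF. apply (continuous_comp (fun s => (r, s) : C) F); [|apply CF].
  apply continuous_Cpair; [cont|cont].
Qed.

Lemma CInt_row_continuous (F : C -> C) (s t : R) : 0 <= s ->
  (forall p, continuous F p) -> continuous (fun t => CInt (fun y => F (y, t)) 0 s) t.
Proof.
  intros Hs CF. apply (CInt_param_continuous (fun t y => F (y, t)) t 0 s Hs).
  - intros y _. apply (continuous_comp (U:=RR) (V:=C_UniformSpace)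
      (fun p => (snd p, fst p) : C) F); [|apply CF].
    apply (continuous_Cpair (T:=RR)); [apply continuous_snd'|apply continuous_fst'].
  - apply filter_forall. intros u y _. now apply continuous_row.
Qed.

Lemma CInt_col_continuous (F : C -> C) (t r : R) : 0 <= t ->
  (forall p, continuous F p) -> continuous (fun r => CInt (fun y => F (r, y)) 0 t) r.
Proof.
  intros Hs CF. apply (CInt_param_continuous (fun r y => F (r, y)) r 0 t Hs).
  - intros y _. apply (continuous_comp (U:=RR) (V:=C_UniformSpace)
      (fun p => (fst p, snd p) : C) F); [|apply CF].
    apply (continuous_Cpair (T:=RR)); [apply continuous_fst'|apply continuous_snd'].
  - apply filter_forall. intros u y _. now apply continuous_col.
Qed.

Lemma bounded_segment (f : R -> C) (a b : R) :
  (forall x, continuous f x) ->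
  exists M, 0 < M /\ forall r, a <= r <= b -> Cmod (f r) <= M.
Proof.
  intros Cf. destruct (bounded_rect (fun p => f (Re p)) a b 0 0) as [M [HM H]].
  - cont.
  - exists M. split; auto. intros r Hr. apply (H r 0); lra.
Qed.

(** * Behaviour of a kernel near the axis *)

(** The next lemmas extend to the closed rectangle what is known of the derivatives
    in its interior. *)
Lemma kd_int {rho q g gr gt grr grt} : kernel_data rho q g gr gt grr grt ->
  forall s t, 0 <= s <= rho -> 0 <= t <= 1 -> g (s, t) = CInt (fun y => gr (y, t)) 0 s.
Proof.
  intros K s t Hs Ht.
  apply (unit_interval_eq (fun t => g (s, t)) (fun t => CInt (fun y => gr (y, t)) 0 s)); auto.
  - cont.
  - intros u. apply CInt_row_continuous; [lra|apply K].
  - intros u Hu. rewrite (CInt_FTC (fun y => g (y, u))); [| lra | | |].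
    + rewrite (kd_0 K) by lra. ring.
    + intros x Hx. apply (kd_r K). split; simpl; lra.
    + cont.
    + cont.
Qed.

Lemma kd_r_closed {rho q g gr gt grr grt} : kernel_data rho q g gr gt grr grt ->
  forall r t, 0 < r < rho -> 0 <= t <= 1 -> CD (fun s => g (s, t)) r (gr (r, t)).
Proof.
  intros K r t Hr Ht. apply (CD_ext_loc (fun s => CInt (fun y => gr (y, t)) 0 s)).
  - apply locally_R. exists (Rmin r (rho - r)). split; [apply Rmin_glb_lt; lra|].
    intros y Hy. symmetry. apply (kd_int K); auto.
    assert (A1 := Rmin_l r (rho - r)). assert (A2 := Rmin_r r (rho - r)).
    apply Rabs_lt_between in Hy. lra.
  - apply (CInt_derive (fun y => gr (y, t))). intros y. apply continuous_row, K.
Qed.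

(** On [t = 0] the boundary values [G (r, 0)] can be differentiated. *)
Lemma kd_gr0 {rho q g gr gt grr grt} : (forall r, continuous q r) ->
  kernel_data rho q g gr gt grr grt ->
  forall r, 0 < r < rho -> gr (r, 0) = (RtoC r * q r)%C.
Proof.
  intros Cq K r Hr. apply (CD_unique (fun s => g (s, 0)) r).
  - apply (kd_r_closed K); lra.
  - apply (CD_ext_loc (fun s => CInt (fun y => RtoC y * q y)%C 0 s)).
    + apply locally_R. exists (Rmin r (rho - r)). split; [apply Rmin_glb_lt; lra|].
      intros y Hy. symmetry. apply (kd_b K); auto.
      assert (A1 := Rmin_l r (rho - r)). assert (A2 := Rmin_r r (rho - r)).
      apply Rabs_lt_between in Hy. lra.
    + apply (CInt_derive (fun y => RtoC y * q y)%C). intros y.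
      apply continuous_Cmult; [|apply Cq]. apply continuous_RtoC, continuous_Rid.
Qed.

Lemma kd_gt0 {rho q g gr gt grr grt} : 0 < rho -> kernel_data rho q g gr gt grr grt ->
  forall t, 0 <= t <= 1 -> gt (0, t) = RtoC 0.
Proof.
  intros H0 K.
  assert (I : forall r t, 0 <= r <= rho -> 0 <= t <= 1 ->
            (g (r, t) - g (r, 0) = CInt (fun y => gt (r, y)) 0 t)%C).
  { intros r t Hr Ht.
    assert (E := unit_interval_eq (fun u => (g ((rho * u)%R, t) - g ((rho * u)%R, 0%R))%C)
      (fun u => CInt (fun y => gt (rho * u, y)) 0 t)).
    assert (Cm : forall u, continuous (fun u => rho * u) u)
      by cont.
    assert (Er : rho * (r / rho) = r) by (field; lra).
    rewrite <- Er. apply E.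
    - cont.
    - intros u. apply (continuous_comp (fun u => rho * u)
         (fun s => CInt (fun y => gt (s, y)) 0 t)); auto.
      apply CInt_col_continuous; [lra|apply K].
    - intros u Hu. symmetry. apply (CInt_FTC (fun y => g (rho * u, y))); [lra| | |].
      + intros x Hx. apply (kd_t K). split; simpl; nra.
      + cont.
      + cont.
    - split; [apply Rdiv_le_0_compat; lra|].
      apply Rmult_le_reg_l with rho; [lra|]. rewrite Er; lra. }
  apply unit_interval_eq.
  - cont.
  - cont.
  - intros t Ht. apply (CD_unique (fun t => CInt (fun y => gt (0, y)) 0 t) t).
    + apply (CInt_derive (fun y => gt (0, y))). intros y. apply continuous_col, K.
    + apply (CD_ext_loc (fun _ => RtoC 0)); [|apply CD_const].
      apply locally_R. exists (Rmin t (1 - t)). split; [apply Rmin_glb_lt; lra|].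
      intros y Hy.
      assert (A1 := Rmin_l t (1 - t)). assert (A2 := Rmin_r t (1 - t)).
      apply Rabs_lt_between in Hy.
      rewrite <- I by lra. rewrite !(kd_0 K) by lra. ring.
Qed.

(** The kernel vanishes to second order on the axis [r = 0]. *)
Lemma kd_bound {rho q g gr gt grr grt} : 0 < rho -> (forall r, continuous q r) ->
  kernel_data rho q g gr gt grr grt ->
  exists A, 0 < A /\ forall r t, 0 <= r <= rho -> 0 <= t <= 1 ->
    Cmod (gr (r, t)) <= A * r /\ Cmod (g (r, t)) <= A * r /\ Cmod (g (r, t)) <= A * r ^ 2.
Proof.
  intros H0 Cq K.
  destruct (bounded_segment q 0 rho Cq) as [Q [HQ BQ]].
  destruct (bounded_rect gr 0 rho 0 1 (kd_cr K)) as [M [HM BM]].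
  assert (G1 : forall r t, 0 <= r <= rho -> 0 <= t <= 1 -> Cmod (g (r, t)) <= M * r).
  { intros r t Hr Ht. rewrite (kd_int K) by auto.
    replace (M * r) with (M * (r - 0)) by ring. apply CInt_bound_const; [lra| |].
    - cont.
    - intros x Hx. apply BM; lra. }
  assert (G2 : forall r t, rectangle rho (r, t) ->
     Cmod (gr (r, t)) <= r * (Q + Q * M * (r ^ 1 / INR 1))).
  { apply (char_bound rho gr grr grt Q (Q * M) 0).
    - exact (kd_cr K).
    - intros p _; exact (kd_crr K p).
    - exact (kd_rr K).
    - exact (kd_rt K).
    - intros r t Hrt. assert (P := kd_pde K r t Hrt).
      replace (RtoC r * grr (r, t) - gr (r, t) + RtoC (2 * (1 - t)) * grt (r, t))%C
        with (RtoC r * (q r * g (r, t)))%C.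
      + destruct Hrt as [Hr Ht]; simpl in Hr, Ht. rewrite !Cmod_mult, Cmod_R, Rabs_pos_eq by lra.
        replace (Q * M * r ^ (0 + 2)) with (r * (Q * (M * r))) by (simpl; ring).
        apply Rmult_le_compat_l; [lra|].
        apply Rmult_le_compat; try apply Cmod_ge_0; [apply BQ; lra|apply G1; lra].
      + replace (RtoC r * grr (r, t) - gr (r, t) + RtoC (2 * (1 - t)) * grt (r, t))%C
          with ((RtoC r * (grr (r, t) - q r * g (r, t)) - gr (r, t)
            + RtoC (2 * (1 - t)) * grt (r, t)) + RtoC r * (q r * g (r, t)))%C by ring.
        rewrite P. ring.
    - intros s Hs. rewrite (kd_gr0 Cq K) by exact Hs.
      rewrite Cmod_mult, Cmod_R, Rabs_pos_eq, Rmult_comm by lra.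
      apply Rmult_le_compat_r; [lra|apply BQ; lra].
    - nra. }
  set (A := Q + Q * M * rho + M).
  assert (HA : 0 < A) by (unfold A; assert (0 < Q * M * rho) by (repeat apply Rmult_lt_0_compat; lra); lra).
  assert (G3 : forall r t, 0 <= r <= rho -> 0 <= t <= 1 -> Cmod (gr (r, t)) <= A * r).
  { apply (rectangle_le rho (fun p => Cmod (gr p)) (fun p => A * Re p) H0).
    - cont.
    - cont.
    - intros r t Hrt. eapply Rle_trans; [now apply G2|]. destruct Hrt as [Hr Ht]; simpl in *.
      unfold A. assert (0 < Q * M) by nra.
      replace (r * (Q + Q * M * (r * 1 / 1))) with ((Q + Q * M * r) * r) by field.
      apply Rmult_le_compat_r; [lra|]. nra. }
  exists A. split; [exact HA|]. intros r t Hr Ht. split; [now apply G3|]. split.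
  - eapply Rle_trans; [now apply G1|]. apply Rmult_le_compat_r; [lra|].
    unfold A. assert (0 < Q * M * rho) by (repeat apply Rmult_lt_0_compat; lra). lra.
  - rewrite (kd_int K) by auto.
    replace (A * r ^ 2) with ((A * r) * (r - 0)) by ring.
    apply CInt_bound_const; [lra| |].
    + cont.
    + intros x Hx. eapply Rle_trans; [apply G3; lra|]. apply Rmult_le_compat_l; lra.
Qed.

(** Makes the points of the plane syntactically elements of [R * R], since [ring]
    and [field] compare atoms syntactically. *)
Ltac norm_pair := repeat match goal with
  | |- context [@pair ?A ?B ?x ?y] => progress change (@pair A B x y) with (@pair R R x y)
  end.

(** * The first-order system linking the two kernels *)

(** [g] and [h] are the kernels of [f] and of [1/f], and [a = f'/f], so that [a]
    satisfies the Riccati equation. *)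
Lemma first_order_system rho q qi a g gr gt grr grt h hr ht hrr hrt :
  0 < rho ->
  (forall r, continuous q r) -> (forall r, continuous qi r) -> (forall r, continuous a r) ->
  (forall r, 0 < r < rho -> CD a r (q r - a r * RtoC (/ r) - a r * a r)%C) ->
  (forall r, 0 < r < rho -> qi r = RtoC 2 * a r * a r - q r)%C ->
  kernel_data rho q g gr gt grr grt -> kernel_data rho qi h hr ht hrr hrt ->
  forall r t, 0 <= r <= rho -> 0 <= t <= 1 ->
    (RtoC r * gr (r, t) = RtoC r * a r * g (r, t) + (g (r, t) - h (r, t))
        - RtoC (1 - t) * (gt (r, t) - ht (r, t)))%C /\
    (RtoC r * hr (r, t) = - (RtoC r * a r * h (r, t)) + (h (r, t) - g (r, t))
        - RtoC (1 - t) * (ht (r, t) - gt (r, t)))%C /\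
    (g (r, 0) - h (r, 0) = RtoC 2 * RtoC r * a r)%C.
Proof.
  intros H0 Cq Cqi Ca Da Eqi K L.
  assert (Car : forall p : C, continuous (fun p => a (Re p)) p)
    by cont.
  destruct K as [kc kcr kct kcrr kcrt kr kt krr krt ktr kpde k0 kb] eqn:EK.
  destruct L as [lc lcr lct lcrr lcrt lr lt lrr lrt ltr lpde l0 lb] eqn:EL.
  clear EK EL.
  (* The two equations of the system have the sum [r X = 0] and the difference
     [Y = 0]. *)
  set (X := fun p : C => (gr p + hr p - a (Re p) * (g p - h p))%C).
  set (Y := fun p : C => (RtoC (Re p) * (gr p - hr p) + RtoC (2 * (1 - Im p)) * (gt p - ht p)
      - RtoC 2 * (g p - h p) - RtoC (Re p) * a (Re p) * (g p + h p))%C).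
  assert (CX : forall p, continuous X p).
  { intros p. apply continuous_Cminus; [cont|].
    apply continuous_Cmult; [apply Car|cont]. }
  assert (CY : forall p, continuous Y p).
  { intros p. apply continuous_Cminus; [apply continuous_Cminus; [apply continuous_Cplus|]|].
    - cont.
    - cont.
    - cont.
    - cont. }
  set (a' := fun r => (q r - a r * RtoC (/ r) - a r * a r)%C).
  set (Xr := fun p : C => (grr p + hrr p - (a' (Re p) * (g p - h p) + a (Re p) * (gr p - hr p)))%C).
  set (Xt := fun p : C => (grt p + hrt p - a (Re p) * (gt p - ht p))%C).
  assert (DXr : forall r t, rectangle rho (r, t) -> CD (fun s => X (s, t)) r (Xr (r, t))).
  { intros r t Hrt. apply CD_minus; [apply CD_plus; auto|].
    apply CD_mult; [apply Da, Hrt|]. apply CD_minus; auto. }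
  assert (DXt : forall r t, rectangle rho (r, t) -> CD (fun s => X (r, s)) t (Xt (r, t))).
  { intros r t Hrt. apply CD_minus; [apply CD_plus; auto|].
    refine (CD_eq _ _ _ _ (CD_mult (fun _ => a r) _ t _ _ (CD_const _ _)
       (CD_minus _ _ _ _ _ (kt r t Hrt) (lt r t Hrt))) _).
    unfold Xt, Re; cbn [fst]. ring. }
  assert (DYr : forall r t, rectangle rho (r, t) ->
      CD (fun s => Y (s, t)) r (- (RtoC r * a r * X (r, t)))%C).
  { intros r t Hrt.
    assert (Dr : CD (fun s => RtoC s) r (RtoC 1))
      by (apply CD_RtoC, (is_derive_id (K := R_AbsRing))).
    assert (D1 := CD_mult _ _ r _ _ Dr (CD_minus _ _ _ _ _ (krr r t Hrt) (lrr r t Hrt))).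
    assert (D2 := CD_mult (fun _ => RtoC (2 * (1 - t))) _ r _ _ (CD_const _ _)
       (CD_minus _ _ _ _ _ (ktr r t Hrt) (ltr r t Hrt))).
    assert (D3 := CD_mult (fun _ => RtoC 2) _ r _ _ (CD_const _ _)
       (CD_minus _ _ _ _ _ (kr r t Hrt) (lr r t Hrt))).
    assert (D4 := CD_mult _ _ r _ _ (CD_mult _ _ r _ _ Dr (Da r (proj1 Hrt)))
       (CD_plus _ _ _ _ _ (kr r t Hrt) (lr r t Hrt))).
    refine (CD_eq _ _ _ _ (CD_minus _ _ _ _ _ (CD_minus _ _ _ _ _ (CD_plus _ _ _ _ _ D1 D2) D3) D4) _).
    assert (P1 := kpde r t Hrt). assert (P2 := lpde r t Hrt).
    rewrite (Eqi r (proj1 Hrt)) in P2.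
    assert (Nr : RtoC r <> 0%C) by (intros E; apply RtoC_inj in E; destruct Hrt; simpl in *; lra).
    rewrite !RtoC_inv by (destruct Hrt; simpl in *; lra). unfold X, Re; cbn [fst].
    apply Ceq_sub. 
    match goal with |- ?A = _ => 
    transitivity (((RtoC r * (grr (r, t) - q r * g (r, t)) - gr (r, t) + RtoC (2 * (1 - t)) * grt (r, t))
      - (RtoC r * (hrr (r, t) - (RtoC 2 * a r * a r - q r) * h (r, t)) - hr (r, t) +
      RtoC (2 * (1 - t)) * hrt (r, t)))%C); [norm_pair; field; exact Nr|rewrite P1, P2; ring] end. }
  assert (HM : forall r t, rectangle rho (r, t) ->
      (RtoC r * Xr (r, t) - X (r, t) + RtoC (2 * (1 - t)) * Xt (r, t) = - (a r * Y (r, t)))%C).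
  { intros r t Hrt.
    assert (P1 := kpde r t Hrt). assert (P2 := lpde r t Hrt).
    rewrite (Eqi r (proj1 Hrt)) in P2.
    assert (Nr : RtoC r <> 0%C) by (intros E; apply RtoC_inj in E; destruct Hrt; simpl in *; lra).
    unfold X, Xr, Xt, Y, a', Re, Im; cbn [fst snd].
    rewrite !RtoC_inv by (destruct Hrt; simpl in *; lra).
    apply Ceq_sub. 
    transitivity (((RtoC r * (grr (r, t) - q r * g (r, t)) - gr (r, t) + RtoC (2 * (1 - t)) * grt (r, t))
      + (RtoC r * (hrr (r, t) - (RtoC 2 * a r * a r - q r) * h (r, t)) - hr (r, t) +
      RtoC (2 * (1 - t)) * hrt (r, t)))%C); [norm_pair; field; exact Nr|rewrite P1, P2; ring]. }
  (* By the Riccati equation [r (q - a^2)] is the derivative of [r a]. *)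
  assert (D0 : forall r, 0 <= r <= rho -> (g (r, 0) - h (r, 0) = RtoC 2 * RtoC r * a r)%C).
  { intros r Hr. rewrite kb, lb by exact Hr.
    rewrite <- CInt_minus; [|lra| |].
    - rewrite (CInt_ext _ (fun s => RtoC 2 * (RtoC s * (q s - a s * a s)))%C); [|lra|].
      + rewrite (CInt_FTC (fun s => RtoC 2 * (RtoC s * a s))%C); [|lra| | |].
        * ring.
        * intros x Hx.
          refine (CD_eq _ _ _ _ (CD_mult (fun _ => RtoC 2) _ x _ _ (CD_const _ _)
            (CD_mult _ _ x _ _ (CD_RtoC _ _ _ (is_derive_id (K := R_AbsRing) x)) (Da x ltac:(lra)))) _).
          rewrite !RtoC_inv by lra.
          assert (Nr : RtoC x <> 0%C) by (intros E; apply RtoC_inj in E; lra).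
          change (one : R) with 1. field; exact Nr.
        * cont.
        * cont.
      + intros x Hx. rewrite Eqi by lra. ring.
    - cont.
    - cont. }
  assert (X0 : forall s, 0 < s < rho -> X (s, 0) = RtoC 0).
  { intros s Hs. unfold X, Re; cbn [fst]. rewrite D0 by lra.
    rewrite (kd_gr0 Cq K), (kd_gr0 Cqi L) by exact Hs.
    rewrite Eqi by exact Hs. ring. }
  assert (Y0 : forall t, 0 <= t <= 1 -> Y (0, t) = RtoC 0).
  { intros t Ht. unfold Y, Re; cbn [fst].
    rewrite k0, l0, (kd_gt0 H0 K), (kd_gt0 H0 L) by exact Ht. ring. }
  destruct (bounded_segment a 0 rho Ca) as [A [HA BA]].
  destruct (bounded_rect X 0 rho 0 1 CX) as [M [HMp BM]].
  (* One round: a bound for [X] gives one for [Y] by integration in [r], and then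
     a better one for [X] along the characteristics. *)
  assert (step : forall c k, 0 <= c ->
     (forall r t, rectangle rho (r, t) -> Cmod (X (r, t)) <= c * r ^ k) ->
     forall r t, rectangle rho (r, t) ->
       Cmod (X (r, t)) <= (c * A ^ 2 / (INR (S k) * INR (S (S k)))) * r ^ S (S k)).
  { intros c k Hc HX.
    assert (N1 : 0 < INR (S k)) by apply lt_0_INR, Nat.lt_0_succ.
    assert (N2 : 0 < INR (S (S k))) by apply lt_0_INR, Nat.lt_0_succ.
    assert (BY : forall r t, rectangle rho (r, t) ->
       Cmod (Y (r, t)) <= A * c / INR (S (S k)) * r ^ S (S k)).
    { intros r t Hrt. assert (Hrt' := Hrt). destruct Hrt' as [Hr Ht]; simpl in Hr, Ht.
      replace (Y (r, t)) with (Y (r, t) - Y (0, t))%C by (rewrite Y0 by lra; ring).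
      replace (A * c / INR (S (S k)) * r ^ S (S k)) with
        (A * c / INR (S (S k)) * r ^ S (S k) - A * c / INR (S (S k)) * 0 ^ S (S k))
        by (simpl; ring).
      assert (Dp : forall s, is_derive (fun s => A * c / INR (S (S k)) * s ^ S (S k)) s (A * c * s ^ S k)).
      { intros s. auto_derive; [trivial|].
        change (match k with O => 1 | S _ => INR k + 1 end + 1) with (INR (S (S k))).
        simpl pow. field; lra. }
      apply (CD_mean_value (fun s => Y (s, t)) (fun s => - (RtoC s * a s * X (s, t)))%C
        (fun s => A * c / INR (S (S k)) * s ^ S (S k)) (fun s => A * c * s ^ S k)).
      - lra.
      - intros s Hs. apply DYr. split; simpl; lra.
      - cont.
      - intros s _. apply Dp.
      - cont.
      - intros s Hs. rewrite Cmod_opp, !Cmod_mult, Cmod_R, Rabs_pos_eq by lra.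
        replace (A * c * s ^ S k) with (s * A * (c * s ^ k)) by (simpl; ring).
        apply Rmult_le_compat; [| |apply Rmult_le_compat_l; [lra|apply BA; lra]|apply HX; split; simpl; lra].
        + apply Rmult_le_pos; [lra|apply Cmod_ge_0].
        + apply Cmod_ge_0. }
    intros r t Hrt.
    eapply Rle_trans.
    - apply (char_bound rho X Xr Xt 0 (A * (A * c / INR (S (S k)))) k CX); try assumption.
      + intros p Hp. destruct p as [u v].
        assert (Hu : 0 < u < rho) by apply Hp.
        assert (Ca' : continuous (fun p : C => a' (Re p)) ((u, v) : C)).
        { unfold a'. apply continuous_Cminus; [apply continuous_Cminus|].
          - cont.
          - apply continuous_Cmult; [apply Car|].
            apply continuous_RtoC, (continuous_Rinv_fun (fun p : C => Re p));
              [cont|simpl; lra].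
          - cont. }
        apply continuous_Cminus; [cont|].
        apply continuous_Cplus; apply continuous_Cmult; auto; now apply continuous_Cminus.
      + intros r' t' H'. rewrite HM by exact H'. rewrite Cmod_opp, Cmod_mult.
        rewrite Nat.add_comm. simpl plus. rewrite Rmult_assoc.
        apply Rmult_le_compat; try apply Cmod_ge_0; [apply BA; destruct H'; simpl in *; lra|now apply BY].
      + intros s Hs. rewrite X0 by exact Hs. rewrite Cmod_0. lra.
      + apply Rmult_le_pos; [lra|]. apply Rdiv_le_0_compat; [nra|exact N2].
    - right. rewrite <- !tech_pow_Rmult. field. lra. }
  assert (iter : forall j r t, rectangle rho (r, t) ->
      Cmod (X (r, t)) <= (M * A ^ (2 * j) / INR (fact (2 * j))) * r ^ (2 * j)).
  { induction j as [|j IH].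
    - intros r t [Hr Ht]. simpl in *. rewrite Rmult_1_r, Rdiv_1_r, Rmult_1_r. apply BM; lra.
    - intros r t Hrt.
      assert (Fp := INR_fact_lt_0 (2 * j)).
      assert (c0 : 0 <= M * A ^ (2 * j) / INR (fact (2 * j))).
      { apply Rdiv_le_0_compat; [|exact Fp]. apply Rmult_le_pos; [lra|apply pow_le; lra]. }
      assert (S1 := step _ (2 * j)%nat c0 IH r t Hrt).
      replace (2 * S j)%nat with (S (S (2 * j))) by lia.
      eapply Rle_trans; [exact S1|]. right.
      rewrite !fact_simpl, !mult_INR. change (A ^ S (S (2 * j))) with (A * (A * A ^ (2 * j))).
      clear S1 c0 step IH. generalize (A ^ (2 * j)). intros Aj.
      assert (N1 : 0 < INR (S (2 * j))) by apply lt_0_INR, Nat.lt_0_succ.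
      assert (N2 : 0 < INR (S (S (2 * j)))) by apply lt_0_INR, Nat.lt_0_succ.
      field. repeat split; lra. }
  assert (XZ : forall r t, rectangle rho (r, t) -> X (r, t) = RtoC 0).
  { intros r t Hrt. apply Cmod_eq_0.
    apply Rle_antisym; [|apply Cmod_ge_0]. apply Rnot_lt_le. intros Hp.
    destruct (cv_speed_pow_fact (A * r) (Cmod (X (r, t)) / M)) as [N HN].
    { apply Rdiv_lt_0_compat; lra. }
    assert (B1 := HN (2 * N)%nat ltac:(lia)).
    assert (B2 := iter N r t Hrt).
    unfold R_dist in B1. rewrite Rminus_0_r in B1.
    apply (Rle_lt_trans _ _ _ (Rle_abs _)) in B1.
    rewrite Rpow_mult_distr in B1.
    apply (Rmult_lt_compat_l M) in B1; [|lra].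
    replace (M * (Cmod (X (r, t)) / M)) with (Cmod (X (r, t))) in B1 by (field; lra).
    unfold Rdiv in *. nra. }
  assert (YZ : forall r t, rectangle rho (r, t) -> Y (r, t) = RtoC 0).
  { intros r t Hrt. destruct Hrt as [Hr Ht]; simpl in Hr, Ht.
    rewrite <- (Y0 t) by lra. apply (CD_zero_const (fun s => Y (s, t)) 0 r).
    - lra.
    - intros s Hs. refine (CD_eq _ _ _ _ (DYr s t _) _); [split; simpl; lra|].
      rewrite XZ by (split; simpl; lra). ring.
    - cont. }
  assert (closed : forall Z : C -> C, (forall p, continuous Z p) ->
     (forall r t, rectangle rho (r, t) -> Z (r, t) = RtoC 0) ->
     forall r t, 0 <= r <= rho -> 0 <= t <= 1 -> Z (r, t) = RtoC 0).
  { intros Z CZ HZ r t Hr Ht. apply Cmod_eq_0. apply Rle_antisym; [|apply Cmod_ge_0].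
    apply (rectangle_le rho (fun p => Cmod (Z p)) (fun _ => 0) H0); auto.
    - cont.
    - cont.
    - intros u v Huv. rewrite HZ by exact Huv. rewrite Cmod_0; lra. }
  intros r t Hr Ht.
  assert (EX := closed X CX XZ r t Hr Ht). assert (EY := closed Y CY YZ r t Hr Ht).
  unfold X, Re in EX. unfold Y, Re, Im in EY. cbn [fst snd] in EX, EY.
  split; [|split; [|now apply D0]]; rewrite RtoC_mult in EY; apply Ceq_sub.
  - transitivity (RtoC r / RtoC 2 * (gr (r, t) + hr (r, t) - a r * (g (r, t) - h (r, t)))
      + / RtoC 2 * (RtoC r * (gr (r, t) - hr (r, t)) +
      RtoC 2 * RtoC (1 - t) * (gt (r, t) - ht (r, t)) - RtoC 2 * (g (r, t) - h (r, t)) -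
      RtoC r * a r * (g (r, t) + h (r, t))))%C.
    + field.
    + rewrite EX, EY. ring.
  - transitivity (RtoC r / RtoC 2 * (gr (r, t) + hr (r, t) - a r * (g (r, t) - h (r, t)))
      - / RtoC 2 * (RtoC r * (gr (r, t) - hr (r, t)) +
      RtoC 2 * RtoC (1 - t) * (gt (r, t) - ht (r, t)) - RtoC 2 * (g (r, t) - h (r, t)) -
      RtoC r * a r * (g (r, t) + h (r, t))))%C.
    + field.
    + rewrite EX, EY. ring.
Qed.

(** * Series of complex numbers *)

(** The sum of the first [n] terms. *)
Fixpoint Csum (a : nat -> C) (n : nat) : C :=
  match n with O => RtoC 0 | S m => (Csum a m + a m)%C end.

(** The sum of a series, by real and imaginary parts. *)
Definition Cseries (a : nat -> C) : C :=
  (Series (fun k => Re (a k)), Series (fun k => Im (a k))).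

Lemma Csum_Re a n : Re (Csum a n) = match n with O => 0 | S m => sum_f_R0 (fun k => Re (a k)) m end.
Proof.
  induction n as [|n IH]; [reflexivity|]. 
  change (Re (Csum a (S n))) with (Re (Csum a n) + Re (a n)). rewrite IH.
  destruct n; [apply Rplus_0_l|reflexivity].
Qed.

Lemma Csum_Im a n : Im (Csum a n) = match n with O => 0 | S m => sum_f_R0 (fun k => Im (a k)) m end.
Proof.
  induction n as [|n IH]; [reflexivity|]. 
  change (Im (Csum a (S n))) with (Im (Csum a n) + Im (a n)). rewrite IH.
  destruct n; [apply Rplus_0_l|reflexivity].
Qed.

(** The [match] is the sum of the first [n] terms, which [sum_f_R0] only expresses
    for [n] positive. *)
Lemma Series_tail (a b : nat -> R) (n : nat) :
  ex_series b -> (forall k, Rabs (a k) <= b k) ->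
  Rabs (Series a - match n with O => 0 | S m => sum_f_R0 a m end)
    <= Series (fun k => b (n + k)%nat).
Proof.
  intros Hb Hab.
  assert (Ha : ex_series a) by (apply (ex_series_le (V:=R_CompleteNormedModule) a b); auto).
  assert (Hbn : ex_series (fun k => b (n + k)%nat)) by now apply -> (ex_series_incr_n (V:=R_NormedModule) b n).
  assert (E : Series a - match n with O => 0 | S m => sum_f_R0 a m end = Series (fun k => a (n + k)%nat)).
  { destruct n as [|n]; [simpl; rewrite Rminus_0_r; reflexivity|].
    rewrite (Series_incr_n a (S n)) by (auto; lia). simpl pred. ring. }
  rewrite E.
  eapply Rle_trans; [apply Series_Rabs|].
  - apply (ex_series_le (V:=R_CompleteNormedModule) _ (fun k => b (n + k)%nat)); [|exact Hbn].
    intros k. unfold norm; simpl. unfold abs; simpl. rewrite Rabs_Rabsolu. apply Hab.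
  - apply Series_le; [|exact Hbn]. intros k. split; [apply Rabs_pos|apply Hab].
Qed.

Lemma Series_tail_lim (b : nat -> R) : ex_series b ->
  is_lim_seq (fun n => Series (fun k => b (n + k)%nat)) 0.
Proof.
  intros Hb. apply is_lim_seq_incr_1.
  apply (is_lim_seq_ext (fun n => Series b - sum_n b n)).
  - intros n. rewrite (Series_incr_n b (S n)) by (auto; lia). simpl pred.
    rewrite sum_n_Reals. ring.
  - replace (Finite 0) with (Rbar_minus (Series b) (Series b)) by (simpl; f_equal; ring).
    apply (is_lim_seq_minus' (fun _ => Series b) (sum_n b)); [apply is_lim_seq_const|].
    apply (Series_correct b Hb).
Qed.

(** A bound for the remainders of all series dominated by [b]. *)
Lemma Cseries_tail (b : nat -> R) : ex_series b ->
  exists tau : nat -> R, is_lim_seq tau 0 /\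
    forall a, (forall k, Cmod (a k) <= b k) ->
    forall n, Cmod (Cseries a - Csum a n) <= tau n.
Proof.
  intros Hb. exists (fun n => 2 * Series (fun k => b (n + k)%nat)). split.
  - replace (Finite 0) with (Rbar_mult 2 0) by (simpl; f_equal; ring).
    apply is_lim_seq_scal_l. now apply Series_tail_lim.
  - intros a Ha n. eapply Rle_trans; [apply Cmod_le_sum|].
    assert (E1 : Re (Cseries a - Csum a n)%C = Series (fun k => Re (a k)) -
       match n with O => 0 | S m => sum_f_R0 (fun k => Re (a k)) m end)
      by (rewrite <- Csum_Re; reflexivity).
    assert (E2 : Im (Cseries a - Csum a n)%C = Series (fun k => Im (a k)) -
       match n with O => 0 | S m => sum_f_R0 (fun k => Im (a k)) m end)
      by (rewrite <- Csum_Im; reflexivity).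
    rewrite E1, E2.
    assert (A1 := Series_tail (fun k => Re (a k)) b n Hb
      ltac:(intros k; eapply Rle_trans; [apply Re_le|apply Ha])).
    assert (A2 := Series_tail (fun k => Im (a k)) b n Hb
      ltac:(intros k; eapply Rle_trans; [apply Im_le|apply Ha])).
    lra.
Qed.

Lemma Csum_continuous {T : UniformSpace} (F : nat -> T -> C) n x :
  (forall k, continuous (F k) x) -> continuous (fun y => Csum (fun k => F k y) n) x.
Proof.
  intros H. induction n; simpl; [cont|cont].
Qed.

Lemma Cseries_continuous {T : UniformSpace} (F : nat -> T -> C) (b : nat -> R) x :
  (forall k, continuous (F k) x) -> ex_series b ->
  locally x (fun y => forall k, Cmod (F k y) <= b k) ->
  continuous (fun y => Cseries (fun k => F k y)) x.
Proof.
  intros HF Hb Hl. destruct (Cseries_tail b Hb) as [tau [Ht Htau]].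
  apply continuous_C_eps. intros eps He.
  apply is_lim_seq_spec in Ht. destruct (Ht (mkposreal (eps/3) ltac:(lra))) as [N HN].
  specialize (HN N (Nat.le_refl N)). simpl in HN. rewrite Rminus_0_r in HN.
  assert (Hx := locally_singleton _ _ Hl). simpl in Hx.
  assert (HS := proj1 (continuous_C_eps _ _) (Csum_continuous F N x HF) (eps/3) ltac:(lra)).
  generalize (filter_and _ _ Hl HS). apply filter_imp. intros y [A1 A2].
  assert (B1' := Htau (fun k => F k y) A1 N).
  assert (B2 := Htau (fun k => F k x) Hx N).
  apply (Rle_lt_trans _ _ _ (Rle_abs _)) in HN.
  replace (Cseries (fun k => F k y) - Cseries (fun k => F k x))%C with
    ((Cseries (fun k => F k y) - Csum (fun k => F k y) N)
     + ((Csum (fun k => F k y) N - Csum (fun k => F k x) N)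
     + - (Cseries (fun k => F k x) - Csum (fun k => F k x) N)))%C by ring.
  eapply Rle_lt_trans; [apply Cmod_triangle|].
  eapply Rle_lt_trans; [apply Rplus_le_compat_l, Cmod_triangle|].
  rewrite Cmod_opp. lra.
Qed.

Lemma CD_Csum (f f' : nat -> R -> C) n x :
  (forall k, CD (f k) x (f' k x)) ->
  CD (fun y => Csum (fun k => f k y) n) x (Csum (fun k => f' k x) n).
Proof.
  intros H. induction n; simpl; [apply CD_const|now apply CD_plus].
Qed.

Lemma lim_zero_small (tau : nat -> R) (eps : R) : 0 < eps -> is_lim_seq tau 0 ->
  exists N, forall n, (N <= n)%nat -> Rabs (tau n) < eps.
Proof.
  intros He Ht. apply is_lim_seq_spec in Ht. destruct (Ht (mkposreal eps He)) as [N HN].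
  exists N. intros n Hn. specialize (HN n Hn). simpl in HN. now rewrite Rminus_0_r in HN.
Qed.

(** Termwise differentiation under a common bound for the terms and their
    derivatives. *)
Lemma CD_Cseries (f f' : nat -> R -> C) (b : nat -> R) x0 :
  ex_series b ->
  locally x0 (fun x => forall k, CD (f k) x (f' k x) /\
     Cmod (f k x) <= b k /\ Cmod (f' k x) <= b k) ->
  continuous (fun x => Cseries (fun k => f' k x)) x0 ->
  CD (fun x => Cseries (fun k => f k x)) x0 (Cseries (fun k => f' k x0)).
Proof.
  intros Hb Hl Hc. destruct (Cseries_tail b Hb) as [tau [Ht Htau]].
  apply CD_eps. intros eps He.
  assert (L := filter_and _ _ Hl (proj1 (continuous_C_eps _ _) Hc eps He)).
  apply locally_R in L. destruct L as [d [Hd L]]. apply locally_R. exists d. split; auto.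
  intros x Hx. apply le_epsilon. intros eta Heta.
  destruct (lim_zero_small tau (eta / (2 + d)) ltac:(apply Rdiv_lt_0_compat; lra) Ht) as [N HN].
  specialize (HN N (Nat.le_refl N)). apply (Rle_lt_trans _ _ _ (Rle_abs _)) in HN.
  assert (X0 : Rabs (x0 - x0) < d) by (rewrite Rminus_diag, Rabs_R0; exact Hd).
  assert (T0 : 0 <= tau N).
  { eapply Rle_trans; [apply Cmod_ge_0|]. apply (Htau (fun k => f k x0)). intros k.
    apply (L x0 X0). }
  set (l := Cseries (fun k => f' k x0)).
  assert (I : Cmod (Csum (fun k => f k x) N - Csum (fun k => f k x0) N - RtoC (x - x0) * l)
     <= (eps + tau N) * Rabs (x - x0)).
  { apply (CD_increment (fun y => Csum (fun k => f k y) N) (fun y => Csum (fun k => f' k y) N)).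
    - lra.
    - intros y Hy. assert (Ly := L y ltac:(lra)). split.
      + apply CD_Csum. intros k; apply Ly.
      + replace (Csum (fun k => f' k y) N - l)%C with
          ((Cseries (fun k => f' k y) - l) + - (Cseries (fun k => f' k y) - Csum (fun k => f' k y) N))%C by ring.
        eapply Rle_trans; [apply Cmod_triangle|]. rewrite Cmod_opp.
        apply Rplus_le_compat; [left; apply Ly|]. apply Htau. intros k; apply Ly. }
  assert (B1' := Htau (fun k => f k x) (fun k => proj1 (proj2 (proj1 (L x Hx) k))) N).
  assert (B2 := Htau (fun k => f k x0) (fun k => proj1 (proj2 (proj1 (L x0 X0) k))) N).
  replace (Cseries (fun k => f k x) - Cseries (fun k => f k x0) - RtoC (x - x0) * l)%C with
    ((Csum (fun k => f k x) N - Csum (fun k => f k x0) N - RtoC (x - x0) * l)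
     + ((Cseries (fun k => f k x) - Csum (fun k => f k x) N)
     + - (Cseries (fun k => f k x0) - Csum (fun k => f k x0) N)))%C by ring.
  eapply Rle_trans; [apply Cmod_triangle|].
  eapply Rle_trans; [apply Rplus_le_compat_l, Cmod_triangle|].
  rewrite Cmod_opp.
  assert (tau N * (2 + d) <= eta).
  { apply Rlt_le. replace eta with (eta / (2 + d) * (2 + d)) by (field; lra).
    apply Rmult_lt_compat_r; lra. }
  nra.
Qed.

Lemma C1on_Cseries (U : C -> Prop) (H Hx Hy : nat -> C -> C) :
  open U -> (forall k, C1on U (H k) (Hx k) (Hy k)) ->
  (forall z, U z -> exists b, ex_series b /\ locally z (fun w => forall k,
     Cmod (H k w) <= b k /\ Cmod (Hx k w) <= b k /\ Cmod (Hy k w) <= b k)) ->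
  C1on U (fun z => Cseries (fun k => H k z)) (fun z => Cseries (fun k => Hx k z))
    (fun z => Cseries (fun k => Hy k z)).
Proof.
  intros HU HC HB.
  assert (K : forall z, U z -> continuous (fun z => Cseries (fun k => Hx k z)) z).
  { intros z Hz. destruct (HB z Hz) as [b [Hb Hl]]. apply (Cseries_continuous Hx b); auto.
    - intros k; now apply (C1_contx (HC k)).
    - revert Hl; apply filter_imp; intros w Hw k; apply Hw. }
  assert (K2 : forall z, U z -> continuous (fun z => Cseries (fun k => Hy k z)) z).
  { intros z Hz. destruct (HB z Hz) as [b [Hb Hl]]. apply (Cseries_continuous Hy b); auto.
    - intros k; now apply (C1_conty (HC k)).
    - revert Hl; apply filter_imp; intros w Hw k; apply Hw. }
  split; auto.
  - intros z Hz. destruct (HB z Hz) as [b [Hb Hl]]. apply (Cseries_continuous H b); auto.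
    + intros k; now apply (C1_cont (HC k)).
    + revert Hl; apply filter_imp; intros w Hw k; apply Hw.
  - intros z Hz. destruct (HB z Hz) as [b [Hb Hl]].
    assert (E : Cseries (fun k => Hx k z) = Cseries (fun k => Hx k (Re z, Im z)))
      by (destruct z; reflexivity).
    rewrite E.
    apply (CD_Cseries (fun k t => H k (t, Im z)) (fun k t => Hx k (t, Im z)) b); auto.
    + assert (L := filter_and _ _ Hl (HU z Hz)). apply locally_slice_x in L.
      revert L. apply filter_imp. intros x [A1 A2] k.
      split; [apply (C1_derx (HC k) _ A2)|split; apply A1].
    + apply (continuous_comp (fun t => (t, Im z) : C) (fun z => Cseries (fun k => Hx k z))).
      * apply continuous_Cpair; [cont|cont].
      * destruct z; now apply K.
  - intros z Hz. destruct (HB z Hz) as [b [Hb Hl]].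
    assert (E : Cseries (fun k => Hy k z) = Cseries (fun k => Hy k (Re z, Im z)))
      by (destruct z; reflexivity).
    rewrite E.
    apply (CD_Cseries (fun k t => H k (Re z, t)) (fun k t => Hy k (Re z, t)) b); auto.
    + assert (L := filter_and _ _ Hl (HU z Hz)). apply locally_slice_y in L.
      revert L. apply filter_imp. intros x [A1 A2] k.
      split; [apply (C1_dery (HC k) _ A2)|split; apply A1].
    + apply (continuous_comp (fun t => (Re z, t) : C) (fun z => Cseries (fun k => Hy k z))).
      * apply continuous_Cpair; [cont|cont].
      * destruct z; now apply K2.
Qed.

(** * The integral operator *)

(** A kernel and its derivative in [r], extended continuously to the plane, with
    the bounds that hold on the half-plane [r >= 0]. *)
Record radial_kernel (rho A : R) (g gr : C -> C) : Prop := {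
  rk_pos : 0 < A;
  rk_c : forall p, continuous g p;
  rk_cr : forall p, continuous gr p;
  rk_d : forall r t, 0 < r < rho -> CD (fun s => g (s, t)) r (gr (r, t));
  rk_br : forall r t, 0 <= r -> Cmod (gr (r, t)) <= A * r;
  rk_b : forall r t, 0 <= r -> Cmod (g (r, t)) <= A * r;
  rk_b2 : forall r t, 0 <= r -> Cmod (g (r, t)) <= A * r ^ 2
}.

Arguments rk_pos {rho A g gr}.
Arguments rk_c {rho A g gr}.
Arguments rk_cr {rho A g gr}.
Arguments rk_d {rho A g gr}.
Arguments rk_br {rho A g gr}.
Arguments rk_b {rho A g gr}.
Arguments rk_b2 {rho A g gr}.

#[local] Hint Extern 1 (continuous _ _) =>
  first [ eapply rk_c; eassumption | eapply rk_cr; eassumption ] : cont.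

Lemma kernel_data_radial rho q g gr gt grr grt : 0 < rho -> (forall r, continuous q r) ->
  kernel_data rho q g gr gt grr grt ->
  exists A, radial_kernel rho A (fun p => g (clamp2 rho p)) (fun p => gr (clamp2 rho p)).
Proof.
  intros H0 Cq K. destruct (kd_bound H0 Cq K) as [A [HA HB]].
  assert (cl : forall r, 0 <= r -> 0 <= clamp 0 rho r <= r).
  { intros r Hr. unfold clamp, Rmax, Rmin. repeat destruct Rle_dec; lra. }
  assert (B1' : forall r t, 0 <= r -> Cmod (gr (clamp2 rho (r, t))) <= A * r /\
     Cmod (g (clamp2 rho (r, t))) <= A * r /\ Cmod (g (clamp2 rho (r, t))) <= A * r ^ 2).
  { intros r t Hr. assert (C1' := cl r Hr). assert (C2 := clamp_in 0 rho r ltac:(lra)).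
    assert (C3 := clamp_in 0 1 t ltac:(lra)).
    destruct (HB _ _ C2 C3) as [b1 [b2 b3]]. unfold clamp2; simpl.
    assert (clamp 0 rho r ^ 2 <= r ^ 2) by (apply pow_incr; lra).
    split; [|split]; [apply (Rle_trans _ _ _ b1)|apply (Rle_trans _ _ _ b2)|apply (Rle_trans _ _ _ b3)];
    apply Rmult_le_compat_l; lra. }
  exists A. split; auto.
  - cont.
  - cont.
  - intros r t Hr. assert (C3 := clamp_in 0 1 t ltac:(lra)).
    unfold clamp2; simpl. rewrite (clamp_id 0 rho r) by lra.
    apply (CD_ext_loc (fun s => g (s, clamp 0 1 t))).
    + apply locally_R. exists (Rmin r (rho - r)). split; [apply Rmin_glb_lt; lra|].
      intros y Hy. assert (A1 := Rmin_l r (rho - r)). assert (A2 := Rmin_r r (rho - r)).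
      apply Rabs_lt_between in Hy. rewrite (clamp_id 0 rho y) by lra. reflexivity.
    + now apply (kd_r_closed K).
  - intros; now apply B1'.
  - intros; now apply B1'.
  - intros; now apply B1'.
Qed.

(** The integral part of the transmutation operator. *)
Definition V (g : C -> C) (h : C -> C) (z : C) : C :=
  CInt (fun s : R => RtoC s * g (Cmod z, (1 - s ^ 2)%R) * h (RtoC (s ^ 2)%R * z))%C 0 1.

(** Its partial derivative in the direction of the coordinate [c], when [hc] is
    the partial derivative of [h]. *)
Definition Vd (g gr : C -> C) (c : C -> R) (h hc : C -> C) (z : C) : C :=
  CInt (fun s : R => RtoC s *
     (gr (Cmod z, (1 - s ^ 2)%R) * RtoC (c z / Cmod z) * h (RtoC (s ^ 2)%R * z)
      + g (Cmod z, (1 - s ^ 2)%R) * (RtoC (s ^ 2)%R * hc (RtoC (s ^ 2)%R * z))))%C 0 1.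

(** Star-shaped with respect to the origin. *)
Definition star_shaped (U : C -> Prop) : Prop :=
  forall (z : C) (s : R), U z -> 0 <= s <= 1 -> U (RtoC s * z)%C.

Lemma sq_unit s : 0 <= s <= 1 -> 0 <= s ^ 2 <= 1.
Proof. intros H. simpl. nra. Qed.

Lemma V_arg_continuous (U : C -> Prop) (h : C -> C) (z : C) (s : R) :
  star_shaped U -> (forall q, U q -> continuous h q) -> U z -> 0 <= s <= 1 ->
  continuous (T := CR) (fun p => h (RtoC ((snd p) ^ 2)%R * fst p)%C) (z, s).
Proof.
  intros HU Ch Hz Hs. apply (continuous_comp (U := CR) (V := C_UniformSpace)
    (fun p => (RtoC ((snd p) ^ 2)%R * fst p)%C) h).
  - cont.
  - apply Ch. simpl snd. apply HU; [exact Hz|now apply sq_unit].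
Qed.

Lemma coord_le (c : C -> R) (z : C) : c = Re \/ c = Im -> Rabs (c z / Cmod z) <= 1.
Proof.
  intros Hc. destruct (Req_dec (Cmod z) 0) as [E|E].
  - assert (Z : z = 0%C) by now apply Cmod_eq_0.
    assert (c z = 0) by (rewrite Z; destruct Hc; subst c; reflexivity).
    rewrite H. unfold Rdiv; rewrite Rmult_0_l, Rabs_R0. lra.
  - assert (P := Cmod_ge_0 z). unfold Rdiv. rewrite Rabs_mult, Rabs_inv, (Rabs_pos_eq (Cmod z)) by lra.
    apply Rmult_le_reg_r with (Cmod z); [lra|]. rewrite Rmult_assoc, Rinv_l, Rmult_1_r, Rmult_1_l by lra.
    destruct Hc; subst c; [apply Re_le|apply Im_le].
Qed.

(** At the origin the discontinuity of [c z / |z|] is compensated by [rk_br]. *)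
Lemma Vd_weight_continuous rho A (g gr : C -> C) (c : C -> R) (z : C) (s : R) :
  radial_kernel rho A g gr -> c = Re \/ c = Im ->
  continuous (T := CR)
    (fun p => gr (Cmod (fst p), (1 - (snd p) ^ 2)%R) * RtoC (c (fst p) / Cmod (fst p)))%C (z, s).
Proof.
  intros K Hc. destruct (Req_dec (Cmod z) 0) as [E|E].
  - assert (Z : z = 0%C) by now apply Cmod_eq_0. subst z. clear E.
    assert (HA := rk_pos K).
    apply continuous_C_eps. intros eps He. apply locally_CR.
    exists (eps / A). split; [apply Rdiv_lt_0_compat; lra|]. intros w u Hw _. simpl fst; simpl snd.
    replace (w - 0)%C with w in Hw by ring.
    assert (G0 : gr (Cmod 0, 1 - s ^ 2) = RtoC 0).
    { apply Cmod_eq_0. apply Rle_antisym; [|apply Cmod_ge_0].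
      eapply Rle_trans; [apply (rk_br K); rewrite Cmod_0; lra|]. rewrite Cmod_0; lra. }
    rewrite G0, Cmult_0_l. unfold Cminus. rewrite Copp_0, Cplus_0_r, Cmod_mult, Cmod_R.
    apply Rle_lt_trans with (A * Cmod w * 1).
    + apply Rmult_le_compat; [apply Cmod_ge_0|apply Rabs_pos| |now apply coord_le].
      apply (rk_br K), Cmod_ge_0.
    + rewrite Rmult_1_r. apply (Rmult_lt_compat_l A) in Hw; [|exact HA].
      replace (A * (eps / A)) with eps in Hw by (field; lra). exact Hw.
  - apply (continuous_Cmult (T := CR)).
    + cont.
    + apply (continuous_RtoC (T := CR)), (continuous_Rmult (T := CR) (fun p => c (fst p)) (fun p => / Cmod (fst p))).
      * destruct Hc; subst c; [cont|cont]; apply continuous_fst'.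
      * cont.
Qed.

Lemma Cmod_derive_x (z : C) : Cmod z <> 0 ->
  is_derive (fun x => Cmod (x, Im z)) (Re z) (Re z / Cmod z).
Proof.
  intros E. assert (P : 0 < Re z ^ 2 + Im z ^ 2).
  { assert (0 <= Re z ^ 2 + Im z ^ 2) by nra.
    destruct H; [exact H|]. exfalso; apply E. unfold Cmod.
    replace (fst z ^ 2 + snd z ^ 2) with 0 by exact H. apply sqrt_0. }
  unfold Cmod. simpl fst; simpl snd. auto_derive; [simpl in *; lra|].
  replace (Re z * (Re z * 1) + Im z * (Im z * 1)) with (fst z ^ 2 + snd z ^ 2)
    by (unfold Re, Im; ring).
  field. apply Rgt_not_eq, sqrt_lt_R0. exact P.
Qed.

Lemma Cmod_derive_y (z : C) : Cmod z <> 0 ->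
  is_derive (fun y => Cmod (Re z, y)) (Im z) (Im z / Cmod z).
Proof.
  intros E. assert (P : 0 < Re z ^ 2 + Im z ^ 2).
  { assert (0 <= Re z ^ 2 + Im z ^ 2) by nra.
    destruct H; [exact H|]. exfalso; apply E. unfold Cmod.
    replace (fst z ^ 2 + snd z ^ 2) with 0 by exact H. apply sqrt_0. }
  unfold Cmod. simpl fst; simpl snd. auto_derive; [simpl in *; lra|].
  replace (Re z * (Re z * 1) + Im z * (Im z * 1)) with (fst z ^ 2 + snd z ^ 2)
    by (unfold Re, Im; ring).
  field. apply Rgt_not_eq, sqrt_lt_R0. exact P.
Qed.

(** A line through [z] along which the coordinate [c] is the parameter. *)
Lemma rk_d_line rho A g gr (c : C -> R) (l : R -> C) (z : C) (t : R) :
  radial_kernel rho A g gr -> c = Re \/ c = Im -> Cmod z < rho ->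
  l (c z) = z ->
  (forall x, Cmod (l x) <= Cmod z + Rabs (x - c z)) ->
  (Cmod z <> 0 -> is_derive (fun x => Cmod (l x)) (c z) (c z / Cmod z)) ->
  CD (fun x => g (Cmod (l x), t)) (c z) (gr (Cmod z, t) * RtoC (c z / Cmod z))%C.
Proof.
  intros K Hc Hz Hl Hll Hd. destruct (Req_dec (Cmod z) 0) as [E|E].
  - assert (HA := rk_pos K).
    assert (G0 : forall f : C -> C, (forall r t, 0 <= r -> Cmod (f (r, t)) <= A * r) -> f (Cmod z, t) = RtoC 0).
    { intros f Hf. apply Cmod_eq_0. apply Rle_antisym; [|apply Cmod_ge_0].
      eapply Rle_trans; [apply Hf; rewrite E; lra|]. rewrite E; lra. }
    rewrite (G0 gr (rk_br K)), Cmult_0_l. apply CD_eps. intros eps He.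
    apply locally_R. exists (eps / A). split; [apply Rdiv_lt_0_compat; lra|].
    intros x Hx. rewrite Hl, (G0 g (rk_b K)).
    replace (g (Cmod (l x), t) - 0 - RtoC (x - c z) * 0)%C with (g (Cmod (l x), t)) by ring.
    eapply Rle_trans; [apply (rk_b2 K), Cmod_ge_0|].
    specialize (Hll x). rewrite E, Rplus_0_l in Hll.
    assert (P := Cmod_ge_0 (l x)).
    apply (Rmult_lt_compat_l A) in Hx; [|exact HA].
    replace (A * (eps / A)) with eps in Hx by (field; lra).
    replace (A * Cmod (l x) ^ 2) with ((A * Cmod (l x)) * Cmod (l x)) by ring.
    apply Rmult_le_compat; try nra.
  - assert (P := Cmod_ge_0 z).
    rewrite Cmult_comm. rewrite <- Hl at 2. 
    apply (CD_comp (fun s => g (s, t)) (fun x => Cmod (l x))).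
    + rewrite Hl. apply (rk_d K). lra.
    + rewrite Hl. now apply Hd.
Qed.

(** [V] preserves the class C^1, by differentiation under the integral sign. *)
Lemma V_C1 (U : C -> Prop) rho A g gr h hx hy :
  open U -> star_shaped U -> (forall z, U z -> Cmod z < rho) ->
  radial_kernel rho A g gr -> C1on U h hx hy ->
  C1on U (V g h) (Vd g gr Re h hx) (Vd g gr Im h hy).
Proof.
  intros HO HS Hrho K H. 
  assert (Cw : forall p : C * R, continuous (T := CR) (fun p => g (Cmod (fst p), (1 - (snd p) ^ 2)%R)) p)
    by cont.
  assert (Dc : forall (c : C -> R) (hc : C -> C), c = Re \/ c = Im -> (forall z, U z -> continuous hc z) ->
    forall z s, U z -> 0 <= s <= 1 -> continuous (T := CR) (fun p : C * R => (fun z s => RtoC s *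
     (gr (Cmod z, (1 - s ^ 2)%R) * RtoC (c z / Cmod z) * h (RtoC (s ^ 2)%R * z)
      + g (Cmod z, (1 - s ^ 2)%R) * (RtoC (s ^ 2)%R * hc (RtoC (s ^ 2)%R * z))))%C (fst p) (snd p)) (z, s)).
  { intros c hc Hc Chc z s Hz Hs. cbv beta.
    apply (continuous_Cmult (T := CR)); [cont|].
    apply (continuous_Cplus (T := CR)).
    - apply (continuous_Cmult (T := CR)).
      + now apply (Vd_weight_continuous rho A g gr c).
      + apply (V_arg_continuous U); auto; apply (C1_cont H).
    - apply (continuous_Cmult (T := CR)); [apply Cw|].
      apply (continuous_Cmult (T := CR)).
      + cont.
      + now apply (V_arg_continuous U). }
  apply (C1on_CInt U (fun z s => RtoC s * g (Cmod z, (1 - s ^ 2)%R) * h (RtoC (s ^ 2)%R * z))%C); auto.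
  - lra.
  - intros z s Hz Hs. apply (continuous_Cmult (T := CR)).
    + cont.
    + apply (V_arg_continuous U); auto; apply (C1_cont H).
  - apply Dc; [now left|apply (C1_contx H)].
  - apply Dc; [now right|apply (C1_conty H)].
  - intros z s Hz Hs.
    assert (Hsz : U (RtoC (s ^ 2)%R * z)%C) by (apply HS; [exact Hz|now apply sq_unit]).
    assert (D1 : CD (fun x => g (Cmod (x, Im z), 1 - s ^ 2)) (Re z)
       (gr (Cmod z, (1 - s ^ 2)%R) * RtoC (Re z / Cmod z))%C).
    { apply (rk_d_line rho A g gr Re (fun x => (x, Im z))); auto.
      - destruct z; reflexivity.
      - intros x. replace ((x, Im z) : C) with (z + RtoC (x - Re z))%C
          by (apply Ceq; unfold Re, Im; simpl; ring).
        eapply Rle_trans; [apply Cmod_triangle|]. rewrite Cmod_R. lra.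
      - apply Cmod_derive_x. }
    assert (D2 : CD (fun x => h (RtoC (s ^ 2)%R * (x, Im z))%C) (Re z)
       (RtoC (s ^ 2)%R * hx (RtoC (s ^ 2)%R * z))%C).
    { apply (CD_ext (fun x => h (s ^ 2 * x, Im (RtoC (s ^ 2)%R * z)%C))).
      - intros x. f_equal. apply Ceq; unfold Re, Im; simpl; ring.
      - apply (CD_comp (fun u => h (u, Im (RtoC (s ^ 2)%R * z)%C)) (fun x => s ^ 2 * x)).
        + replace (s ^ 2 * Re z) with (Re (RtoC (s ^ 2)%R * z)%C) by (unfold Re, Im; simpl; ring).
          apply (C1_derx H _ Hsz).
        + auto_derive; [trivial|ring]. }
    assert (D3 := CD_mult _ _ _ _ _ (CD_mult (fun _ => RtoC s) _ _ _ _ (CD_const _ _) D1) D2).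
    refine (CD_eq _ _ _ _ D3 _).
    cbv beta. norm_pair. replace ((Re z, Im z) : C) with z by (destruct z; reflexivity). ring.
  - intros z s Hz Hs.
    assert (Hsz : U (RtoC (s ^ 2)%R * z)%C) by (apply HS; [exact Hz|now apply sq_unit]).
    assert (D1 : CD (fun x => g (Cmod (Re z, x), 1 - s ^ 2)) (Im z)
       (gr (Cmod z, (1 - s ^ 2)%R) * RtoC (Im z / Cmod z))%C).
    { apply (rk_d_line rho A g gr Im (fun x => (Re z, x))); auto.
      - destruct z; reflexivity.
      - intros x. replace ((Re z, x) : C) with (z + Ci * RtoC (x - Im z))%C
          by (apply Ceq; unfold Re, Im; simpl; ring).
        eapply Rle_trans; [apply Cmod_triangle|]. rewrite Cmod_mult, Cmod_R.
        replace (Cmod Ci) with 1 by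
            (unfold Cmod, Ci; simpl; replace (0 * (0*1) + 1*(1*1)) with 1 by ring;
            now rewrite sqrt_1). lra.
      - apply Cmod_derive_y. }
    assert (D2 : CD (fun x => h (RtoC (s ^ 2)%R * (Re z, x))%C) (Im z)
       (RtoC (s ^ 2)%R * hy (RtoC (s ^ 2)%R * z))%C).
    { apply (CD_ext (fun x => h (Re (RtoC (s ^ 2)%R * z)%C, s ^ 2 * x))).
      - intros x. f_equal. apply Ceq; unfold Re, Im; simpl; ring.
      - apply (CD_comp (fun u => h (Re (RtoC (s ^ 2)%R * z)%C, u)) (fun x => s ^ 2 * x)).
        + replace (s ^ 2 * Im z) with (Im (RtoC (s ^ 2)%R * z)%C) by (unfold Re, Im; simpl; ring).
          apply (C1_dery H _ Hsz).
        + auto_derive; [trivial|ring]. }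
    assert (D3 := CD_mult _ _ _ _ _ (CD_mult (fun _ => RtoC s) _ _ _ _ (CD_const _ _) D1) D2).
    refine (CD_eq _ _ _ _ D3 _).
    cbv beta. norm_pair. replace ((Re z, Im z) : C) with z by (destruct z; reflexivity). ring.
Qed.

Lemma V_integrand_continuous (U : C -> Prop) (g h : C -> C) (z : C) (s : R) :
  (forall p, continuous g p) -> star_shaped U -> (forall w, U w -> continuous h w) ->
  U z -> 0 <= s <= 1 ->
  continuous (fun s : R => RtoC s * g (Cmod z, (1 - s ^ 2)%R) * h (RtoC (s ^ 2)%R * z))%C s.
Proof.
  intros Cg HS Ch Hz Hs. apply continuous_Cmult; [apply continuous_Cmult|].
  - apply continuous_RtoC, continuous_Rid.
  - cont.
  - apply (continuous_comp (fun s : R => (RtoC (s ^ 2)%R * z)%C) h).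
    + cont.
    + apply Ch, HS; [exact Hz|now apply sq_unit].
Qed.

Lemma Vd_integrand_continuous (U : C -> Prop) (g gr h hc : C -> C) (e z : C) (s : R) :
  (forall p, continuous g p) -> (forall p, continuous gr p) -> star_shaped U ->
  (forall w, U w -> continuous h w) -> (forall w, U w -> continuous hc w) ->
  U z -> 0 <= s <= 1 ->
  continuous (fun s : R => RtoC s *
     (gr (Cmod z, (1 - s ^ 2)%R) * e * h (RtoC (s ^ 2)%R * z)
      + g (Cmod z, (1 - s ^ 2)%R) * (RtoC (s ^ 2)%R * hc (RtoC (s ^ 2)%R * z))))%C s.
Proof.
  intros Cg Cgr HS Ch Chc Hz Hs.
  apply (continuous_Cext (fun s : R =>
    (e * (RtoC s * gr (Cmod z, (1 - s ^ 2)%R) * h (RtoC (s ^ 2)%R * z))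
     + RtoC (s ^ 2)%R * (RtoC s * g (Cmod z, (1 - s ^ 2)%R) * hc (RtoC (s ^ 2)%R * z)))%C)).
  - intros u. ring.
  - apply continuous_Cplus; apply continuous_Cmult.
    + cont.
    + now apply (V_integrand_continuous U).
    + cont.
    + now apply (V_integrand_continuous U).
Qed.

Lemma Cmod_scal (s : R) (w : C) : 0 <= s -> Cmod (RtoC s * w) = s * Cmod w.
Proof. intros H. now rewrite Cmod_mult, Cmod_R, Rabs_pos_eq. Qed.

Lemma V_primitive (a : R) (k : nat) (s : R) :
  is_derive (fun s => a / INR (S k) * (s ^ 2) ^ S k) s (a * (2 * s * (s ^ 2) ^ k)).
Proof.
  assert (Nm : 0 < INR (S k)) by apply lt_0_INR, Nat.lt_0_succ.
  evar_last.
  - apply (is_derive_scal (fun s => (s ^ 2) ^ S k)).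
    apply (is_derive_pow (fun s => s ^ 2)). apply (is_derive_pow (fun s => s)).
    apply (is_derive_id (K := R_AbsRing)).
  - change (@one R_AbsRing) with 1. simpl Nat.pred. rewrite pow_1. change (INR 2) with 2. field. lra.
Qed.

(** Each application of [V] gains a factor [A |w| / (k + 1)], because
    [int_0^1 2 s (s^2)^k ds = 1 / (k + 1)]. *)
Lemma V_bound rho A g gr N h c k :
  radial_kernel rho A g gr -> star_shaped N -> (forall w, N w -> continuous h w) ->
  0 <= c -> (forall w, N w -> Cmod (h w) <= c * Cmod w ^ k) ->
  forall w, N w -> Cmod (V g h w) <= A * c / INR (S k) * Cmod w ^ S k.
Proof.
  intros K HS Ch Hc Hh w Hw.
  assert (HA := rk_pos K). assert (Pw := Cmod_ge_0 w).
  set (a := A * c * Cmod w ^ S k).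
  assert (Ha : 0 <= a) by (unfold a; apply Rmult_le_pos; [nra|now apply pow_le]).
  replace (A * c / INR (S k) * Cmod w ^ S k) with
    (a / INR (S k) * (1 ^ 2) ^ S k - a / INR (S k) * (0 ^ 2) ^ S k).
  - apply (CInt_bound _ (fun s => a / INR (S k) * (s ^ 2) ^ S k) (fun s => a * (2 * s * (s ^ 2) ^ k))).
    + lra.
    + intros s Hs. apply (V_integrand_continuous N); auto. exact (rk_c K).
    + intros s _. apply V_primitive.
    + cont.
    + intros s Hs. rewrite !Cmod_mult, Cmod_R, Rabs_pos_eq by lra.
      assert (Hs2 := sq_unit s Hs).
      assert (B1 := rk_b K (Cmod w) (1 - s ^ 2) Pw).
      assert (B2 := Hh _ (HS w (s ^ 2) Hw Hs2)). rewrite Cmod_scal, Rpow_mult_distr in B2 by lra.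
      assert (P1 := pow_le _ k Pw). assert (P2 := pow_le _ k (proj1 Hs2)).
      apply Rle_trans with (s * (A * Cmod w) * (c * ((s ^ 2) ^ k * Cmod w ^ k))).
      * apply Rmult_le_compat; [apply Rmult_le_pos; [lra|apply Cmod_ge_0]|apply Cmod_ge_0| |exact B2].
        apply Rmult_le_compat_l; [lra|exact B1].
      * replace (s * (A * Cmod w) * (c * ((s ^ 2) ^ k * Cmod w ^ k)))
          with (a * (s * (s ^ 2) ^ k)) by (unfold a; simpl; ring).
        apply Rmult_le_compat_l; [exact Ha|]. nra.
  - rewrite pow1, pow1. replace ((0 ^ 2) ^ S k) with 0 by (simpl; ring). unfold a.
    field. apply not_0_INR; lia.
Qed.

(** The first-order terms obey the same bound, [|d|z|/dc| <= 1] and [s^2 <= 1]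
    being used for the two summands. *)
Lemma Vd_bound rho A g gr cc N h hc c k :
  radial_kernel rho A g gr -> cc = Re \/ cc = Im -> star_shaped N ->
  (forall w, N w -> Cmod w <= rho) ->
  (forall w, N w -> continuous h w) -> (forall w, N w -> continuous hc w) ->
  0 <= c -> (forall w, N w -> Cmod (h w) <= c * Cmod w ^ k) ->
  (forall w, N w -> Cmod (hc w) <= c * Cmod w ^ k) ->
  forall w, N w -> Cmod (Vd g gr cc h hc w) <= A * c / INR (S k) * Cmod w ^ S k.
Proof.
  intros K Hcc HS HN Ch Chc Hc Hh Hhc w Hw.
  assert (HA := rk_pos K). assert (Pw := Cmod_ge_0 w).
  set (a := A * c * Cmod w ^ S k).
  replace (A * c / INR (S k) * Cmod w ^ S k) with
    (a / INR (S k) * (1 ^ 2) ^ S k - a / INR (S k) * (0 ^ 2) ^ S k).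
  - apply (CInt_bound _ (fun s => a / INR (S k) * (s ^ 2) ^ S k) (fun s => a * (2 * s * (s ^ 2) ^ k))).
    + lra.
    + intros s Hs. apply (Vd_integrand_continuous N); auto;
      [exact (rk_c K)|exact (rk_cr K)].
    + intros s _. apply V_primitive.
    + cont.
    + intros s Hs. rewrite Cmod_mult, Cmod_R, Rabs_pos_eq by lra.
      assert (Hs2 := sq_unit s Hs).
      assert (B0 := rk_br K (Cmod w) (1 - s ^ 2) Pw).
      assert (B1 := rk_b K (Cmod w) (1 - s ^ 2) Pw).
      assert (B2 := Hh _ (HS w (s ^ 2) Hw Hs2)). rewrite Cmod_scal, Rpow_mult_distr in B2 by lra.
      assert (B3 := Hhc _ (HS w (s ^ 2) Hw Hs2)). rewrite Cmod_scal, Rpow_mult_distr in B3 by lra.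
      replace (a * (2 * s * (s ^ 2) ^ k)) with
        (s * ((A * Cmod w) * 1 * (c * ((s ^ 2) ^ k * Cmod w ^ k))
           + (A * Cmod w) * (1 * (c * ((s ^ 2) ^ k * Cmod w ^ k)))))
        by (unfold a; simpl; ring).
      apply Rmult_le_compat_l; [lra|]. eapply Rle_trans; [apply Cmod_triangle|].
      rewrite !Cmod_mult, !Cmod_R. apply Rplus_le_compat.
      * apply Rmult_le_compat; [|apply Cmod_ge_0| |exact B2].
        -- apply Rmult_le_pos; [apply Cmod_ge_0|apply Rabs_pos].
        -- apply Rmult_le_compat; [apply Cmod_ge_0|apply Rabs_pos|exact B0|now apply coord_le].
      * apply Rmult_le_compat; [apply Cmod_ge_0| |exact B1|].
        -- apply Rmult_le_pos; [apply Rabs_pos|apply Cmod_ge_0].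
        -- apply Rmult_le_compat; [apply Rabs_pos|apply Cmod_ge_0| |exact B3].
           rewrite Rabs_pos_eq; lra.
  - rewrite pow1, pow1. replace ((0 ^ 2) ^ S k) with 0 by (simpl; ring). unfold a.
    field. apply not_0_INR; lia.
Qed.

(** Bounds near a whole segment [[0, z0]]; [1 / M] is again the parameter of the
    compactness argument. *)
Lemma local_bound (U : C -> Prop) (u : C -> C) (z0 : C) :
  open U -> star_shaped U -> (forall z, U z -> continuous u z) -> U z0 ->
  exists d M, 0 < d /\ 0 < M /\ forall s w, 0 <= s <= 1 ->
    Cmod (w - RtoC s * z0) < d -> U w /\ Cmod (u w) <= M.
Proof.
  intros HO HS Cu Hz.
  assert (H : locally (T := CR) (RtoC 0, 0) (fun p => forall s, 0 <= s <= 1 ->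
     U (RtoC s * z0 + fst p)%C /\ Cmod (u (RtoC s * z0 + fst p)%C) * Rabs (snd p) < 1)).
  { apply (tube (T := CR) (RtoC 0, 0) 0 1 (fun p s => U (RtoC s * z0 + fst p)%C /\
      Cmod (u (RtoC s * z0 + fst p)%C) * Rabs (snd p) < 1)). intros s Hs.
    set (m := fun q : (C * R) * R => (RtoC (snd q) * z0 + fst (fst q))%C).
    set (q0 := ((RtoC 0, 0), s)).
    assert (Cm : continuous (T := prod_UniformSpace CR R_UniformSpace) (U := C_UniformSpace) m q0) by (unfold m; cont).
    assert (m0 : m q0 = (RtoC s * z0)%C) by (unfold m, q0; simpl; ring).
    assert (U0 : U (m q0)) by (rewrite m0; now apply HS).
    assert (L1 : locally (T := prod_UniformSpace CR R_UniformSpace) q0 (fun q => U (m q))) by exact (Cm U (HO _ U0)).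
    assert (Cn : continuous (T := prod_UniformSpace CR R_UniformSpace) (U := R_UniformSpace) (fun q => Cmod (u (m q)) * Rabs (snd (fst q))) q0).
    { apply (continuous_Rmult (T := prod_UniformSpace CR R_UniformSpace)); [cont|].
      apply (continuous_Rabs_fun (T := prod_UniformSpace CR R_UniformSpace) (fun q => snd (fst q))). cont. }
    assert (N := proj1 (filterlim_locally _ _) Cn (mkposreal 1 Rlt_0_1)).
    generalize (filter_and _ _ L1 N). apply filter_imp. intros q [A1 A2].
    split; [exact A1|]. change (Cmod (u (m q)) * Rabs (snd (fst q)) < 1).
    change (Rabs (Cmod (u (m q)) * Rabs (snd (fst q)) - Cmod (u (m q0)) * Rabs 0) < 1) in A2.
    rewrite Rabs_R0, Rmult_0_r, Rminus_0_r in A2.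
    apply Rabs_lt_between in A2. apply A2. }
  apply locally_CR in H. destruct H as [d [Hd H]].
  exists d, (/ (d / 2)). split; [exact Hd|]. split; [apply Rinv_0_lt_compat; lra|].
  intros s w Hs Hw.
  assert (K := H (w - RtoC s * z0)%C (d / 2)
     ltac:(replace (w - RtoC s * z0 - 0)%C with (w - RtoC s * z0)%C by ring; exact Hw)
     ltac:(rewrite Rminus_0_r, Rabs_pos_eq; lra) s Hs).
  simpl in K. replace (RtoC s * z0 + (w - RtoC s * z0))%C with w in K by ring.
  destruct K as [K1 K2]. split; [exact K1|].
  rewrite Rabs_pos_eq in K2 by lra. apply Rmult_le_reg_r with (d / 2); [lra|].
  rewrite Rinv_l by lra. lra.
Qed.

(** The [d]-neighbourhood of the segment [[0, z0]], a star-shaped set. *)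
Definition segment_nbhd (z0 : C) (d : R) (w : C) : Prop :=
  exists s, 0 <= s <= 1 /\ Cmod (w - RtoC s * z0) < d.

Lemma segment_nbhd_star z0 d : 0 < d -> star_shaped (segment_nbhd z0 d).
Proof.
  intros Hd w s [s' [Hs' Hw]] Hs. exists (s * s'). split; [nra|].
  replace (RtoC s * w - RtoC (s * s') * z0)%C with (RtoC s * (w - RtoC s' * z0))%C
    by (rewrite RtoC_mult; ring).
  rewrite Cmod_scal by lra. generalize (Cmod_ge_0 (w - RtoC s' * z0)). nra.
Qed.

Lemma segment_nbhd_locally z0 d : 0 < d -> locally z0 (segment_nbhd z0 d).
Proof.
  intros Hd. apply locally_disc. exists d. split; [exact Hd|]. intros w Hw.
  exists 1. split; [lra|]. rewrite Cmult_1_l. exact Hw.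
Qed.

Lemma segment_nbhd_center z0 d : 0 < d -> segment_nbhd z0 d z0.
Proof.
  intros Hd. exists 1. split; [lra|]. replace (z0 - RtoC 1 * z0)%C with (RtoC 0) by ring.
  now rewrite Cmod_0.
Qed.

Lemma V_plus g (U : C -> Prop) h1 h2 z : (forall p, continuous g p) -> star_shaped U ->
  (forall w, U w -> continuous h1 w) -> (forall w, U w -> continuous h2 w) -> U z ->
  V g (fun w => h1 w + h2 w)%C z = (V g h1 z + V g h2 z)%C.
Proof.
  intros Cg HS C1' C2 Hz. unfold V. rewrite <- CInt_plus.
  - apply CInt_ext; [lra|]. intros s _. ring.
  - lra.
  - intros s Hs. now apply (V_integrand_continuous U).
  - intros s Hs. now apply (V_integrand_continuous U).
Qed.

Lemma V_scal g (U : C -> Prop) c h z : (forall p, continuous g p) -> star_shaped U ->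
  (forall w, U w -> continuous h w) -> U z ->
  V g (fun w => c * h w)%C z = (c * V g h z)%C.
Proof.
  intros Cg HS Ch Hz. unfold V. rewrite <- CInt_scal.
  - apply CInt_ext; [lra|]. intros s _. ring.
  - lra.
  - intros s Hs. now apply (V_integrand_continuous U).
Qed.

Lemma V_ext g h1 h2 z : (forall s, 0 <= s <= 1 -> h1 (RtoC s * z)%C = h2 (RtoC s * z)%C) ->
  V g h1 z = V g h2 z.
Proof.
  intros H. apply CInt_ext; [lra|]. intros s Hs. rewrite H; [reflexivity|].
  apply sq_unit; lra.
Qed.

Lemma V_minus g (U : C -> Prop) h1 h2 z : (forall p, continuous g p) -> star_shaped U ->
  (forall w, U w -> continuous h1 w) -> (forall w, U w -> continuous h2 w) -> U z ->
  V g (fun w => h1 w - h2 w)%C z = (V g h1 z - V g h2 z)%C.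
Proof.
  intros Cg HS C1' C2 Hz.
  rewrite (V_ext g _ (fun w => h1 w + (RtoC (-1)) * h2 w)%C) by (intros; ring).
  rewrite (V_plus g U); auto.
  - rewrite (V_scal g U) by auto. ring.
  - cont.
Qed.

Lemma V_zero g z : V g (fun _ => RtoC 0) z = RtoC 0.
Proof.
  unfold V. rewrite (CInt_ext _ (fun _ => RtoC 0)); [|lra|intros; ring].
  rewrite CInt_const. ring.
Qed.

Lemma V_Csum g (U : C -> Prop) (h : nat -> C -> C) n z : (forall p, continuous g p) -> star_shaped U ->
  (forall k w, U w -> continuous (h k) w) -> U z ->
  V g (fun w => Csum (fun k => h k w) n) z = Csum (fun k => V g (h k) z) n.
Proof.
  intros Cg HS Ch Hz. induction n as [|n IH]; simpl.
  - apply V_zero.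
  - rewrite (V_plus g U); auto.
    + now rewrite IH.
    + intros w Hw. apply (Csum_continuous h). intros k; now apply Ch.
Qed.

Lemma exp_terms_summable (M x : R) :
  ex_series (fun k => M * (x ^ k / INR (fact k))).
Proof.
  apply (ex_series_scal (V:=R_NormedModule) M (fun k => x ^ k / INR (fact k))). apply (ex_series_ext (fun k => x ^ k * / INR (fact k))); [reflexivity|].
  exists (exp x). generalize (is_exp_Reals x). unfold is_pseries.
  apply is_series_ext. intros n. rewrite pow_n_pow. unfold scal; simpl; unfold mult; simpl. reflexivity.
Qed.

Lemma exp_terms_lim (M x : R) :
  is_lim_seq (fun k => M * (x ^ k / INR (fact k))) 0.
Proof. apply ex_series_lim_0, exp_terms_summable. Qed.

(** A function with [h = - V h] satisfies [|h| <= M (A |w|)^k / k!] for every [k]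
    near the segment from the origin to the given point. *)
Lemma V_injective rho A g gr (U : C -> Prop) h :
  radial_kernel rho A g gr -> open U -> star_shaped U ->
  (forall w, U w -> continuous h w) -> (forall z, U z -> h z + V g h z = RtoC 0)%C ->
  forall z, U z -> h z = RtoC 0.
Proof.
  intros K HO HS Ch H z Hz.
  destruct (local_bound U h z HO HS Ch Hz) as [d [M [Hd [HM HB]]]].
  set (N := segment_nbhd z d).
  assert (NU : forall w, N w -> U w) by (intros w [s [Hs Hw]]; now apply (HB s)).
  assert (HA := rk_pos K).
  assert (B : forall k w, N w -> Cmod (h w) <= M * A ^ k / INR (fact k) * Cmod w ^ k).
  { induction k as [|k IH]; intros w Hw.
    - simpl. rewrite !Rmult_1_r, Rdiv_1_r. destruct Hw as [s [Hs Hw]]. now apply (HB s).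
    - replace (h w) with (- V g h w)%C.
      + rewrite Cmod_opp.
        eapply Rle_trans.
        * apply (V_bound rho A g gr N h (M * A ^ k / INR (fact k)) k K); auto.
          -- now apply segment_nbhd_star.
          -- apply Rdiv_le_0_compat; [|apply INR_fact_lt_0].
             apply Rmult_le_pos; [lra|apply pow_le; lra].
        * right. rewrite fact_simpl, mult_INR. simpl pow. field. split; [|apply not_0_INR; lia].
          apply INR_fact_neq_0.
      + assert (E := H w (NU w Hw)). replace (h w) with (h w + V g h w - V g h w)%C by ring.
        rewrite E. ring. }
  apply Cmod_eq_0. apply Rle_antisym; [|apply Cmod_ge_0]. apply Rnot_lt_le. intros P.
  destruct (lim_zero_small _ _ P (exp_terms_lim M (A * Cmod z))) as [n Hn].
  specialize (Hn n (Nat.le_refl n)). apply (Rle_lt_trans _ _ _ (Rle_abs _)) in Hn.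
  assert (Bn := B n z (segment_nbhd_center z d Hd)). rewrite Rpow_mult_distr in Hn.
  unfold Rdiv in *. nra.
Qed.

(** * Inversion by Neumann series *)

(** The iterate [(- V)^k u] with its two partial derivatives, [ux] and [uy] being
    those of [u]. *)
Fixpoint neumann (g gr u ux uy : C -> C) (k : nat) : (C -> C) * ((C -> C) * (C -> C)) :=
  match k with
  | O => (u, (ux, uy))
  | S j => let p := neumann g gr u ux uy j in
      (fun z => - V g (fst p) z,
       (fun z => - Vd g gr Re (fst p) (fst (snd p)) z,
        fun z => - Vd g gr Im (fst p) (snd (snd p)) z))%C
  end.

Lemma C1on_opp {U h hx hy} : C1on U h hx hy ->
  C1on U (fun z => - h z)%C (fun z => - hx z)%C (fun z => - hy z)%C.
Proof.
  intros [a b c d e]. split; intros z Hz.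
  - cont.
  - cont.
  - cont.
  - now apply CD_opp, d.
  - now apply CD_opp, e.
Qed.

(** The Neumann series solves [h + V h = u] in the class C^1. *)
Lemma V_inverse (U : C -> Prop) rho A g gr u ux uy :
  open U -> star_shaped U -> (forall z, U z -> Cmod z < rho) ->
  radial_kernel rho A g gr -> C1on U u ux uy ->
  exists h hx hy, C1on U h hx hy /\ forall z, U z -> (h z + V g h z = u z)%C.
Proof.
  intros HO HS Hrho K Hu.
  set (H := fun k => fst (neumann g gr u ux uy k)).
  set (Hx := fun k => fst (snd (neumann g gr u ux uy k))).
  set (Hy := fun k => snd (snd (neumann g gr u ux uy k))).
  assert (HC : forall k, C1on U (H k) (Hx k) (Hy k)).
  { induction k as [|k IH]; [exact Hu|]. apply C1on_opp. now apply (V_C1 U rho A). }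
  assert (HA := rk_pos K).
  assert (HB : forall z, U z -> exists d M, 0 < d /\ 0 < M /\
     (forall w, segment_nbhd z d w -> U w) /\
     forall k w, segment_nbhd z d w ->
       Cmod (H k w) <= M * A ^ k / INR (fact k) * Cmod w ^ k /\
       Cmod (Hx k w) <= M * A ^ k / INR (fact k) * Cmod w ^ k /\
       Cmod (Hy k w) <= M * A ^ k / INR (fact k) * Cmod w ^ k).
  { intros z Hz.
    destruct (local_bound U u z HO HS (C1_cont Hu) Hz) as [d1 [M1 [Hd1 [HM1 B1']]]].
    destruct (local_bound U ux z HO HS (C1_contx Hu) Hz) as [d2 [M2 [Hd2 [HM2 B2]]]].
    destruct (local_bound U uy z HO HS (C1_conty Hu) Hz) as [d3 [M3 [Hd3 [HM3 B3]]]].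
    set (d := Rmin d1 (Rmin d2 d3)).
    assert (Hd : 0 < d) by (unfold d; repeat apply Rmin_glb_lt; assumption).
    assert (L1 : d <= d1) by apply Rmin_l.
    assert (L2 : d <= d2) by (eapply Rle_trans; [apply Rmin_r|apply Rmin_l]).
    assert (L3 : d <= d3) by (eapply Rle_trans; [apply Rmin_r|apply Rmin_r]).
    exists d, (M1 + M2 + M3). split; [exact Hd|]. split; [lra|].
    assert (NU : forall w, segment_nbhd z d w -> U w)
      by (intros w [s [Hs Hw]]; apply (B1' s); auto; lra).
    split; [exact NU|].
    assert (SN := segment_nbhd_star z d Hd).
    assert (NR : forall w, segment_nbhd z d w -> Cmod w <= rho) by (intros w Hw; left; now apply Hrho, NU).
    induction k as [|k IH]; intros w Hw.
    - simpl. rewrite !Rmult_1_r, Rdiv_1_r. destruct Hw as [s [Hs Hw]].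
      destruct (B1' s w Hs ltac:(lra)) as [_ b1]. destruct (B2 s w Hs ltac:(lra)) as [_ b2].
      destruct (B3 s w Hs ltac:(lra)) as [_ b3]. unfold H, Hx, Hy; simpl. lra.
    - set (c := (M1 + M2 + M3) * A ^ k / INR (fact k)) in *.
      assert (Hc : 0 <= c).
      { apply Rdiv_le_0_compat; [|apply INR_fact_lt_0].
        apply Rmult_le_pos; [lra|apply pow_le; lra]. }
      replace ((M1 + M2 + M3) * A ^ S k / INR (fact (S k))) with (A * c / INR (S k)).
      2:{ unfold c. rewrite fact_simpl, mult_INR. simpl pow. field. split; [|apply not_0_INR; lia].
          apply INR_fact_neq_0. }
      assert (c1 : forall v, segment_nbhd z d v -> continuous (H k) v)
        by (intros v Hv; apply (C1_cont (HC k)), NU, Hv).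
      assert (c2 : forall v, segment_nbhd z d v -> continuous (Hx k) v)
        by (intros v Hv; apply (C1_contx (HC k)), NU, Hv).
      assert (c3 : forall v, segment_nbhd z d v -> continuous (Hy k) v)
        by (intros v Hv; apply (C1_conty (HC k)), NU, Hv).
      unfold H, Hx, Hy; simpl neumann; cbn [fst snd]. rewrite !Cmod_opp.
      split; [|split].
      + apply (V_bound rho A g gr (segment_nbhd z d) (H k) c k K SN c1 Hc); auto. intros v Hv; now apply IH.
      + apply (Vd_bound rho A g gr Re (segment_nbhd z d) (H k) (Hx k) c k K); auto; intros v Hv; now apply IH.
      + apply (Vd_bound rho A g gr Im (segment_nbhd z d) (H k) (Hy k) c k K); auto; intros v Hv; now apply IH. }
  assert (HB' : forall z, U z -> exists d M, 0 < d /\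
     (forall w, segment_nbhd z d w -> U w) /\ forall k w, segment_nbhd z d w ->
     Cmod (H k w) <= M * ((A * rho) ^ k / INR (fact k)) /\
     Cmod (Hx k w) <= M * ((A * rho) ^ k / INR (fact k)) /\
     Cmod (Hy k w) <= M * ((A * rho) ^ k / INR (fact k))).
  { intros z Hz. destruct (HB z Hz) as [d [M [Hd [HM [NU B]]]]]. exists d, M.
    split; [exact Hd|]. split; [exact NU|]. intros k w Hw. destruct (B k w Hw) as [b1 [b2 b3]].
    assert (L : M * A ^ k / INR (fact k) * Cmod w ^ k <= M * ((A * rho) ^ k / INR (fact k))).
    { rewrite Rpow_mult_distr.
      replace (M * (A ^ k * rho ^ k / INR (fact k)))
        with (M * A ^ k / INR (fact k) * rho ^ k) by (field; apply INR_fact_neq_0).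
      apply Rmult_le_compat_l.
      - apply Rdiv_le_0_compat; [|apply INR_fact_lt_0].
        apply Rmult_le_pos; [lra|apply pow_le; lra].
      - apply pow_incr. split; [apply Cmod_ge_0|left; now apply Hrho, NU]. }
    lra. }
  exists (fun z => Cseries (fun k => H k z)), (fun z => Cseries (fun k => Hx k z)),
    (fun z => Cseries (fun k => Hy k z)).
  assert (CS : C1on U (fun z => Cseries (fun k => H k z)) (fun z => Cseries (fun k => Hx k z))
    (fun z => Cseries (fun k => Hy k z))).
  { apply C1on_Cseries; auto. intros z Hz.
    destruct (HB' z Hz) as [d [M [Hd [NU B]]]].
    exists (fun k => M * ((A * rho) ^ k / INR (fact k))). split; [apply exp_terms_summable|].
    generalize (segment_nbhd_locally z d Hd). apply filter_imp. intros w Hw k. now apply B. }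
  split; [exact CS|].
  intros z Hz. destruct (HB' z Hz) as [d [M [Hd [NU B]]]].
  assert (SN := segment_nbhd_star z d Hd).
  assert (Nz := segment_nbhd_center z d Hd).
  set (b := fun k => M * ((A * rho) ^ k / INR (fact k))) in *.
  destruct (Cseries_tail b (exp_terms_summable M (A * rho))) as [tau [Ht Htau]].
  set (Phi := fun z => Cseries (fun k => H k z)).
  assert (Cg := rk_c K).
  assert (CH : forall k w, segment_nbhd z d w -> continuous (H k) w)
    by (intros k w Hw; apply (C1_cont (HC k)), NU, Hw).
  assert (CPhi : forall w, segment_nbhd z d w -> continuous Phi w)
    by (intros w Hw; apply (C1_cont CS), NU, Hw).
  assert (E : forall n, Cmod (Phi z + V g Phi z - u z) <= tau n + A * tau n * Cmod z + b n).
  { intros n.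
    assert (T1 : forall w, segment_nbhd z d w -> Cmod (Phi w - Csum (fun k => H k w) n) <= tau n)
      by (intros w Hw; apply (Htau (fun k => H k w)); intros k; now apply B).
    assert (T0 : 0 <= tau n) by (eapply Rle_trans; [apply Cmod_ge_0|apply (T1 z Nz)]).
    assert (V1 : Cmod (V g (fun w => Phi w - Csum (fun k => H k w) n)%C z) <= A * tau n * Cmod z).
    { assert (VB := V_bound rho A g gr (segment_nbhd z d)
         (fun w => Phi w - Csum (fun k => H k w) n)%C (tau n) 0 K SN).
      replace (A * tau n * Cmod z) with (A * tau n / INR 1 * Cmod z ^ 1) by (simpl; field).
      apply VB; auto.
      - intros w Hw. apply continuous_Cminus; [now apply CPhi|]. apply (Csum_continuous H).
        intros k; now apply CH.
      - intros w Hw. simpl. rewrite Rmult_1_r. now apply T1. }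
    rewrite (V_minus g (segment_nbhd z d)) in V1; auto.
    2:{ intros w Hw. apply (Csum_continuous H); intros k; now apply CH. }
    rewrite (V_Csum g (segment_nbhd z d)) in V1 by auto.
    assert (T : (Csum (fun k => H k z) n + Csum (fun k => V g (H k) z) n = u z - H n z)%C).
    { clear. induction n as [|n IH]; [unfold H; simpl; ring|]. simpl Csum.
      replace (Csum (fun k => H k z) n + H n z + (Csum (fun k => V g (H k) z) n + V g (H n) z))%C
        with ((Csum (fun k => H k z) n + Csum (fun k => V g (H k) z) n) + (H n z + V g (H n) z))%C by ring.
      rewrite IH. unfold H at 4; simpl. fold (H n). ring. }
    assert (Bn := proj1 (B n z Nz)). assert (Tz := T1 z Nz).
    replace (Phi z + V g Phi z - u z)%C with
      ((Phi z - Csum (fun k => H k z) n) + ((V g Phi z - Csum (fun k => V g (H k) z) n)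
        + ((Csum (fun k => H k z) n + Csum (fun k => V g (H k) z) n) - u z)))%C by ring.
    rewrite T. replace (u z - H n z - u z)%C with (- H n z)%C by ring.
    eapply Rle_trans; [apply Cmod_triangle|].
    eapply Rle_trans; [apply Rplus_le_compat_l, Cmod_triangle|]. rewrite Cmod_opp. unfold b. lra. }
  assert (Z : Cmod (Phi z + V g Phi z - u z) <= 0).
  { apply (is_lim_seq_le (fun _ => Cmod (Phi z + V g Phi z - u z))
      (fun n => tau n + A * tau n * Cmod z + b n) (Cmod (Phi z + V g Phi z - u z)) 0 E).
    - apply is_lim_seq_const.
    - replace (Finite 0) with (Finite (0 + A * 0 * Cmod z + 0)) by (f_equal; ring).
      apply is_lim_seq_plus'; [apply is_lim_seq_plus'; [exact Ht|]|apply exp_terms_lim].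
      apply is_lim_seq_mult'; [apply is_lim_seq_mult'; [apply is_lim_seq_const|exact Ht]|apply is_lim_seq_const]. }
  apply Ceq_sub, Cmod_eq_0. generalize (Cmod_ge_0 (Phi z + V g Phi z - u z)).
  unfold Phi in *. lra.
Qed.

(** * Intertwining relations *)

(** The radial and the angular derivative, [r d/dr] and [d/dtheta], of a function
    with partial derivatives [hx], [hy]. *)
Definition euler (hx hy : C -> C) (w : C) : C := (RtoC (Re w) * hx w + RtoC (Im w) * hy w)%C.
Definition angular (hx hy : C -> C) (w : C) : C := (- RtoC (Im w) * hx w + RtoC (Re w) * hy w)%C.

Lemma euler_continuous {U h hx hy} : C1on U h hx hy -> forall z, U z -> continuous (euler hx hy) z.
Proof.
  intros H z Hz. apply continuous_Cplus; apply continuous_Cmult.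
  - cont.
  - now apply (C1_contx H).
  - cont.
  - now apply (C1_conty H).
Qed.

Lemma angular_continuous {U h hx hy} : C1on U h hx hy -> forall z, U z -> continuous (angular hx hy) z.
Proof.
  intros H z Hz. apply continuous_Cplus; apply continuous_Cmult.
  - cont.
  - now apply (C1_contx H).
  - cont.
  - now apply (C1_conty H).
Qed.

#[local] Hint Extern 2 (continuous (euler _ _) _) => eapply euler_continuous; [eassumption|auto] : cont.
#[local] Hint Extern 2 (continuous (angular _ _) _) => eapply angular_continuous; [eassumption|auto] : cont.

(** [|z|] being invariant under rotations, [V] commutes with the angular
    derivative. *)
Lemma V_angular U rho A g gr phi px py :
  star_shaped U -> radial_kernel rho A g gr -> C1on U phi px py ->
  forall z, U z ->
    angular (fun w => px w + Vd g gr Re phi px w)%C (fun w => py w + Vd g gr Im phi py w)%C z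
    = (angular px py z + V g (angular px py) z)%C.
Proof.
  intros HS K H z Hz. unfold angular at 1 2.
  assert (Cg := rk_c K). assert (Cgr := rk_cr K).
  assert (E : V g (angular px py) z =
    (- RtoC (Im z) * Vd g gr Re phi px z + RtoC (Re z) * Vd g gr Im phi py z)%C).
  { unfold V, Vd.
    assert (C1' : forall s, 0 <= s <= 1 -> continuous (fun s : R => RtoC s *
       (gr (Cmod z, (1 - s ^ 2)%R) * RtoC (Re z / Cmod z) * phi (RtoC (s ^ 2)%R * z)
      + g (Cmod z, (1 - s ^ 2)%R) * (RtoC (s ^ 2)%R * px (RtoC (s ^ 2)%R * z))))%C s).
    { intros s Hs. apply (Vd_integrand_continuous U); auto;
      [apply (C1_cont H)|apply (C1_contx H)]. }
    assert (C2 : forall s, 0 <= s <= 1 -> continuous (fun s : R => RtoC s *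
       (gr (Cmod z, (1 - s ^ 2)%R) * RtoC (Im z / Cmod z) * phi (RtoC (s ^ 2)%R * z)
      + g (Cmod z, (1 - s ^ 2)%R) * (RtoC (s ^ 2)%R * py (RtoC (s ^ 2)%R * z))))%C s).
    { intros s Hs. apply (Vd_integrand_continuous U); auto;
      [apply (C1_cont H)|apply (C1_conty H)]. }
    rewrite <- CInt_scal, <- CInt_scal, <- CInt_plus by
      (try lra; auto; intros s Hs; apply continuous_Cmult; auto; apply continuous_Cconst).
    apply CInt_ext; [lra|]. intros s Hs. unfold angular.
    replace (Re (RtoC (s ^ 2) * z)%C) with (s ^ 2 * Re z) by (unfold Re; simpl; ring).
    replace (Im (RtoC (s ^ 2) * z)%C) with (s ^ 2 * Im z) by (unfold Im; simpl; ring).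
    unfold Rdiv. rewrite !RtoC_mult. ring. }
  rewrite E. ring.
Qed.

Lemma CInt_combination (c1 c2 c3 : C) (f1 f2 f3 f4 : R -> C) (a b : R) : a <= b ->
  (forall x, a <= x <= b -> continuous f1 x) -> (forall x, a <= x <= b -> continuous f2 x) ->
  (forall x, a <= x <= b -> continuous f3 x) -> (forall x, a <= x <= b -> continuous f4 x) ->
  CInt (fun x => c1 * f1 x + c2 * f2 x - c3 * f3 x - f4 x)%C a b
  = (c1 * CInt f1 a b + c2 * CInt f2 a b - c3 * CInt f3 a b - CInt f4 a b)%C.
Proof.
  intros Hab H1 H2 H3 H4.
  assert (Cs : forall (c : C) (f : R -> C), (forall s, a <= s <= b -> continuous f s) ->
      forall s, a <= s <= b -> continuous (fun s => c * f s)%C s)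
      by cont.
  assert (K1 := Cs c1 f1 H1). assert (K2 := Cs c2 f2 H2). assert (K3 := Cs c3 f3 H3).
  assert (K12 : forall x, a <= x <= b -> continuous (fun x => c1 * f1 x + c2 * f2 x)%C x)
    by cont.
  assert (K123 : forall x, a <= x <= b -> continuous (fun x => c1 * f1 x + c2 * f2 x - c3 * f3 x)%C x)
    by cont.
  rewrite CInt_minus; [|exact Hab|exact K123|exact H4].
  rewrite CInt_minus; [|exact Hab|exact K12|exact K3].
  rewrite CInt_plus; [|exact Hab|exact K1|exact K2].
  now rewrite !CInt_scal by assumption.
Qed.

(** [E (phi + V_g phi) - r a (phi + V_g phi) = E phi + V_h (E phi)]. *)
Lemma V_euler U rho A1 A2 g gr gt h hr ht (a : R -> C) phi px py :
  open U -> star_shaped U -> (forall z, U z -> Cmod z < rho) ->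
  radial_kernel rho A1 g gr -> radial_kernel rho A2 h hr ->
  (forall p, continuous gt p) -> (forall p, continuous ht p) ->
  (forall r t, 0 < r < rho -> 0 < t < 1 -> CD (fun s => g (r, s)) t (gt (r, t))) ->
  (forall r t, 0 < r < rho -> 0 < t < 1 -> CD (fun s => h (r, s)) t (ht (r, t))) ->
  (forall r t, 0 < r < rho -> 0 <= t <= 1 ->
     RtoC r * gr (r, t) = RtoC r * a r * g (r, t) + (g (r, t) - h (r, t))
        - RtoC (1 - t) * (gt (r, t) - ht (r, t)))%C ->
  (forall r, 0 < r < rho -> (g (r, 0) - h (r, 0) = RtoC 2 * RtoC r * a r)%C) ->
  C1on U phi px py ->
  forall z, U z -> Cmod z <> 0 ->
    (euler (fun w => px w + Vd g gr Re phi px w) (fun w => py w + Vd g gr Im phi py w) z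
      - RtoC (Cmod z) * a (Cmod z) * (phi z + V g phi z)
    = euler px py z + V h (euler px py) z)%C.
Proof.
  intros HO HS Hrho K L Cgt Cht Dg Dh K1 K0 H z Hz Nz.
  assert (Cg := rk_c K).
  assert (Ch := rk_c L).
  assert (Pz := Cmod_ge_0 z). assert (Hr : 0 < Cmod z < rho) by (split; [lra|now apply Hrho]).
  set (r := Cmod z) in *.
  set (e := fun t => (g (r, t) - h (r, t))%C).
  set (et := fun t => (gt (r, t) - ht (r, t))%C).
  (* By the first-order system, the integral terms of the two sides differ by half
     the integral of [Q'], the derivative of [Q]. As [Q 0 = 0], this is half of
     [Q 1 = 2 r a phi (z)], which accounts for the term [r a phi]. *)
  set (Q := fun s : R => (RtoC (s ^ 2) * e (1 - s ^ 2)%R * phi (RtoC (s ^ 2)%R * z))%C).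
  set (Q' := fun s : R => (RtoC 2 * RtoC s * (e (1 - s ^ 2)%R * phi (RtoC (s ^ 2)%R * z)
      - RtoC (s ^ 2) * et (1 - s ^ 2)%R * phi (RtoC (s ^ 2)%R * z)
      + e (1 - s ^ 2)%R * euler px py (RtoC (s ^ 2)%R * z)))%C).
  assert (Cph : forall w, U w -> continuous phi w) by apply (C1_cont H).
  assert (Crow : forall (f : C -> C) s, (forall p, continuous f p) -> continuous (fun s : R => f (r, 1 - s ^ 2)) s).
  { cont. }
  assert (Carg : forall (f : C -> C) s, 0 <= s <= 1 -> (forall w, U w -> continuous f w) ->
     continuous (fun s : R => f (RtoC (s ^ 2)%R * z)%C) s).
  { intros f s Hs Cf. apply (continuous_comp (fun s : R => (RtoC (s ^ 2)%R * z)%C) f).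
    - cont.
    - apply Cf, HS; [exact Hz|now apply sq_unit]. }
  assert (Cee : forall s, continuous (fun s : R => e (1 - s ^ 2)) s)
    by (intros s; apply continuous_Cminus; apply Crow; auto).
  assert (Cet : forall s, continuous (fun s : R => et (1 - s ^ 2)) s)
    by (intros s; apply continuous_Cminus; apply Crow; auto).
  assert (CQ : forall s, 0 <= s <= 1 -> continuous Q s).
  { intros s Hs. apply continuous_Cmult; [cont|]; auto. }
  assert (CQ' : forall s, 0 <= s <= 1 -> continuous Q' s).
  { intros s Hs. apply continuous_Cmult.
    - cont.
    - cont. }
  assert (IQ : CInt Q' 0 1 = (RtoC 2 * RtoC r * a r * phi z)%C).
  { rewrite (CInt_FTC Q); [| lra | |auto|auto].
    - unfold Q. replace (1 ^ 2) with 1 by ring. replace (0 ^ 2) with 0 by ring.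
      replace (1 - 1) with 0 by ring. unfold e. rewrite K0 by exact Hr.
      rewrite !Cmult_1_l. eqC. ring.
    - intros s Hs.
      assert (Hs2 : 0 < 1 - s ^ 2 < 1) by (simpl; nra).
      assert (D1 : is_derive (fun s => s ^ 2) s (2 * s)) by (auto_derive; [trivial|ring]).
      assert (D2 : is_derive (fun s => 1 - s ^ 2) s (- (2 * s))) by (auto_derive; [trivial|ring]).
      assert (D3 : CD (fun s => e (1 - s ^ 2)) s (RtoC (- (2 * s)) * et (1 - s ^ 2)%R)%C).
      { apply (CD_comp e (fun s => 1 - s ^ 2)); [|exact D2]. apply CD_minus; auto. }
      assert (Hsz : U (RtoC (s ^ 2)%R * z)%C) by (apply HS; [exact Hz|apply sq_unit; lra]).
      assert (Esz : forall s : R, (RtoC (s ^ 2)%R * z)%C = (s ^ 2 * Re z, s ^ 2 * Im z))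
        by (intros u; apply Ceq; unfold Re, Im; simpl; ring).
      assert (D4 : CD (fun s => phi (RtoC (s ^ 2)%R * z)%C) s
         (RtoC (2 * s * Re z) * px (RtoC (s ^ 2)%R * z) + RtoC (2 * s * Im z) * py (RtoC (s ^ 2)%R * z))%C).
      { apply (CD_ext (fun s => phi (s ^ 2 * Re z, s ^ 2 * Im z))); [intros u; now rewrite Esz|].
        rewrite Esz. apply (C1on_chain U phi px py (fun s => s ^ 2 * Re z) (fun s => s ^ 2 * Im z)); auto.
        - now rewrite <- Esz.
        - auto_derive; [trivial|ring].
        - auto_derive; [trivial|ring]. }
      refine (CD_eq _ _ _ _ (CD_mult _ _ _ _ _ (CD_mult _ _ _ _ _ (CD_RtoC _ _ _ D1) D3) D4) _).
      unfold Q', euler.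
      replace (Re (RtoC (s ^ 2) * z)%C) with (s ^ 2 * Re z) by (unfold Re; simpl; ring).
      replace (Im (RtoC (s ^ 2) * z)%C) with (s ^ 2 * Im z) by (unfold Im; simpl; ring).
      rewrite RtoC_opp, !RtoC_mult. ring. }
  assert (E : (RtoC (Re z) * Vd g gr Re phi px z + RtoC (Im z) * Vd g gr Im phi py z
      - RtoC r * a r * V g phi z - V h (euler px py) z = / RtoC 2 * CInt Q' 0 1)%C).
  { unfold V, Vd. fold r.
    assert (C1' : forall s, 0 <= s <= 1 -> continuous (fun s : R => RtoC s *
       (gr (r, (1 - s ^ 2)%R) * RtoC (Re z / r) * phi (RtoC (s ^ 2)%R * z)
      + g (r, (1 - s ^ 2)%R) * (RtoC (s ^ 2)%R * px (RtoC (s ^ 2)%R * z))))%C s).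
    { cont. }
    assert (C2 : forall s, 0 <= s <= 1 -> continuous (fun s : R => RtoC s *
       (gr (r, (1 - s ^ 2)%R) * RtoC (Im z / r) * phi (RtoC (s ^ 2)%R * z)
      + g (r, (1 - s ^ 2)%R) * (RtoC (s ^ 2)%R * py (RtoC (s ^ 2)%R * z))))%C s).
    { cont. }
    assert (C3 : forall s, 0 <= s <= 1 -> continuous (fun s : R =>
       RtoC s * g (r, (1 - s ^ 2)%R) * phi (RtoC (s ^ 2)%R * z))%C s)
      by cont.
    assert (C4 : forall s, 0 <= s <= 1 -> continuous (fun s : R =>
       RtoC s * h (r, (1 - s ^ 2)%R) * euler px py (RtoC (s ^ 2)%R * z))%C s)
      by cont.
    rewrite <- (CInt_scal (/ RtoC 2)%C) by (auto; lra).
    etransitivity; [symmetry; apply CInt_combination; [lra|exact C1'|exact C2|exact C3|exact C4]|].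
    apply CInt_ext; [lra|]. intros s Hs. unfold Q'.
    assert (Hs2 : 0 <= 1 - s ^ 2 <= 1) by (simpl; nra).
    assert (E1 := K1 r (1 - s ^ 2) Hr Hs2).
    replace (1 - (1 - s ^ 2)) with (s ^ 2) in E1 by ring.
    unfold e, et, euler.
    replace (Re (RtoC (s ^ 2) * z)%C) with (s ^ 2 * Re z) by (unfold Re; simpl; ring).
    replace (Im (RtoC (s ^ 2) * z)%C) with (s ^ 2 * Im z) by (unfold Im; simpl; ring).
    assert (E2 : (RtoC (Re z) * RtoC (Re z / r) + RtoC (Im z) * RtoC (Im z / r) = RtoC r)%C).
    { rewrite <- !RtoC_mult, <- RtoC_plus. f_equal.
      assert (R2 : r * r = Re z * Re z + Im z * Im z).
      { unfold r, Cmod. rewrite sqrt_sqrt by nra. unfold Re, Im; ring. }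
      apply Rmult_eq_reg_r with r; [|lra]. rewrite R2. field. lra. }
    rewrite !RtoC_mult.
    transitivity (RtoC s * ((RtoC (Re z) * RtoC (Re z / r) + RtoC (Im z) * RtoC (Im z / r)) * gr (r, (1 - s ^ 2)%R) * phi (RtoC (s ^ 2)%R * z))
      + RtoC s * (g (r, (1 - s ^ 2)%R) - h (r, (1 - s ^ 2)%R)) *
        (RtoC (s ^ 2)%R * (RtoC (Re z) * px (RtoC (s ^ 2)%R * z) + RtoC (Im z) * py (RtoC (s ^ 2)%R * z)))
      - RtoC r * a r * (RtoC s * g (r, (1 - s ^ 2)%R) * phi (RtoC (s ^ 2)%R * z)))%C; [ring|].
    rewrite E2, E1. norm_pair.
    generalize (phi (RtoC (s ^ 2)%R * z)%C) (px (RtoC (s ^ 2)%R * z)%C) (py (RtoC (s ^ 2)%R * z)%C)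
      (g (r, (1 - s ^ 2)%R)) (h (r, (1 - s ^ 2)%R)) (gt (r, (1 - s ^ 2)%R)) (ht (r, (1 - s ^ 2)%R))
      (RtoC (s ^ 2)%R).
    intros. field. }
  rewrite IQ in E. unfold euler at 1 2. fold r.
  transitivity (RtoC (Re z) * px z + RtoC (Im z) * py z + V h (euler px py) z
    + (RtoC (Re z) * Vd g gr Re phi px z + RtoC (Im z) * Vd g gr Im phi py z
      - RtoC r * a r * V g phi z - V h (euler px py) z) - RtoC r * a r * phi z)%C; [ring|].
  rewrite E. field.
Qed.

(** * Holomorphic functions *)

(** Holomorphic: of class C^1, with [F_y = i F_x]. The complex derivative is then
    [Dx F]. *)
Definition holo (U : C -> Prop) (F : C -> C) : Prop :=
  C1on U F (Dx F) (fun z => Ci * Dx F z)%C.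

Lemma C1on_holo U F F' : C1on U F F' (fun z => Ci * F' z)%C -> open U ->
  holo U F /\ forall z, U z -> Dx F z = F' z.
Proof.
  intros H HO.
  assert (E : forall z, U z -> Dx F z = F' z).
  { intros z Hz. unfold Dx. apply CD_CDerive. apply (C1_derx H z Hz). }
  split; [|exact E]. split.
  - apply (C1_cont H).
  - intros z Hz. apply (continuous_ext_C F').
    + apply (filter_imp U); [intros; symmetry; now apply E|now apply HO].
    + now apply (C1_contx H).
  - intros z Hz. apply (continuous_ext_C (fun z => Ci * F' z)%C).
    + apply (filter_imp U); [intros; now rewrite E|now apply HO].
    + now apply (C1_conty H).
  - intros z Hz. rewrite E by exact Hz. now apply (C1_derx H).
  - intros z Hz. rewrite E by exact Hz. now apply (C1_dery H).
Qed.

Lemma holo_comp (U : C -> Prop) (F : C -> C) (gam : R -> C) (s : R) (c : C) : open U -> holo U F -> U (gam s) ->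
  CD gam s c -> CD (fun s => F (gam s)) s (c * Dx F (gam s))%C.
Proof.
  intros HO H Hs Hg. apply CD_iff in Hg. destruct Hg as [H1 H2].
  apply (CD_ext (fun s => F (Re (gam s), Im (gam s)))); [intros u; now destruct (gam u)|].
  assert (Hs' : U (Re (gam s), Im (gam s))) by (revert Hs; clear; now destruct (gam s)).
  assert (D := C1on_chain U F _ _ (fun s => Re (gam s)) (fun s => Im (gam s)) _ _ s HO H Hs' H1 H2).
  refine (CD_eq _ _ _ _ D _).
  replace ((Re (gam s), Im (gam s)) : C) with (gam s) by (now destruct (gam s)).
  replace c with (RtoC (Re c) + RtoC (Im c) * Ci)%C at 3
    by (apply Ceq; unfold Re, Im, Ci; simpl; ring).
  ring.
Qed.

(** The unit circle, run through once for [s] in [[0, 1]]. *)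
Definition cis (s : R) : C := (cos (2 * PI * s), sin (2 * PI * s)).

Lemma cis_CD s : CD cis s (RtoC (2 * PI) * Ci * cis s)%C.
Proof.
  apply CD_iff. unfold cis, Re, Im. simpl fst; simpl snd. split; auto_derive; trivial;
  simpl; ring.
Qed.

Lemma conj_cis_CD s : CD (fun s => Cconj (cis s)) s (- (RtoC (2 * PI) * Ci * Cconj (cis s)))%C.
Proof.
  apply CD_iff. unfold cis, Re, Im, Cconj. simpl fst; simpl snd. split; auto_derive; trivial;
  simpl; ring.
Qed.

Lemma cis_conj s : (cis s * Cconj (cis s) = 1)%C.
Proof.
  apply Ceq; unfold cis, Cconj, Re, Im; simpl; [|ring].
  generalize (sin2_cos2 (2 * PI * s)). unfold Rsqr. lra.
Qed.

Lemma cis_Cmod s : Cmod (cis s) = 1.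
Proof.
  unfold Cmod, cis; simpl. generalize (sin2_cos2 (2 * PI * s)). unfold Rsqr. intros H.
  replace (_ + _) with 1 by lra. apply sqrt_1.
Qed.

Lemma cis_0 : cis 0 = 1%C.
Proof. unfold cis. rewrite Rmult_0_r, cos_0, sin_0. reflexivity. Qed.

Lemma cis_1 : cis 1 = 1%C.
Proof. unfold cis. rewrite Rmult_1_r, cos_2PI, sin_2PI. reflexivity. Qed.

Lemma cis_continuous s : continuous cis s.
Proof. eapply CD_continuous, cis_CD. Qed.

#[local] Hint Resolve cis_continuous : cont.

(** The inverse of [d * cis s]. *)
Definition inv_circle (d s : R) : C := (RtoC (/ d) * Cconj (cis s))%C.

Lemma inv_circle_continuous d s : continuous (inv_circle d) s.
Proof.
  apply continuous_Cmult; [cont|]. eapply CD_continuous, conj_cis_CD.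
Qed.

#[local] Hint Resolve inv_circle_continuous : cont.

Lemma inv_circle_Cmod d s : 0 < d -> Cmod (inv_circle d s) = / d.
Proof.
  intros Hd. unfold inv_circle. rewrite Cmod_mult, Cmod_conj, cis_Cmod, Cmod_R, Rabs_pos_eq; [ring|].
  left; now apply Rinv_0_lt_compat.
Qed.

Lemma CD_pow (f : R -> C) (n : nat) (x : R) (l : C) : CD f x l ->
  CD (fun t => f t ^ S n)%C x (RtoC (INR (S n)) * f x ^ n * l)%C.
Proof.
  intros H. induction n as [|n IH].
  - apply (CD_ext f); [intros t; simpl; eqC; ring|]. apply (CD_eq _ _ _ _ H). simpl. ring.
  - apply (CD_ext (fun t => f t * f t ^ S n)%C); [intros t; simpl; eqC; ring|].
    refine (CD_eq _ _ _ _ (CD_mult _ _ _ _ _ H IH) _).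
    rewrite (S_INR (S n)), RtoC_plus. simpl Cpow. ring.
Qed.

(** The [k]-th Taylor coefficient at [w], as a Cauchy integral over the circle of
    radius [d]. *)
Definition coef (F : C -> C) (w : C) (d : R) (k : nat) : C :=
  CInt (fun s => F (w + RtoC d * cis s) * inv_circle d s ^ k)%C 0 1.

Lemma in_disc (U : C -> Prop) (w : C) (d s : R) : 0 < d ->
  (forall v, Cmod (v - w) <= d -> U v) -> U (w + RtoC d * cis s)%C.
Proof.
  intros Hd HU. apply HU. replace (w + RtoC d * cis s - w)%C with (RtoC d * cis s)%C by ring.
  rewrite Cmod_mult, Cmod_R, cis_Cmod, Rabs_pos_eq; lra.
Qed.

Lemma circle_continuous (U : C -> Prop) (F : C -> C) w d s : 0 < d ->
  (forall v, Cmod (v - w) <= d -> U v) -> (forall v, U v -> continuous F v) ->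
  continuous (fun s => F (w + RtoC d * cis s)%C) s.
Proof.
  intros Hd HU CF. apply (continuous_comp (fun s => w + RtoC d * cis s)%C F).
  - cont.
  - apply CF. now apply in_disc.
Qed.

(** Integration by parts on the circle. *)
Lemma coef_derive U F w d k : open U -> holo U F -> 0 < d ->
  (forall v, Cmod (v - w) <= d -> U v) ->
  coef (Dx F) w d k = (RtoC (INR (S k)) * coef F w d (S k))%C.
Proof.
  intros HO HF Hd HU.
  assert (CF : forall s, continuous (fun s => F (w + RtoC d * cis s)%C) s)
    by (intros s; apply (circle_continuous U); auto; apply (C1_cont HF)).
  assert (CF' : forall s, continuous (fun s => Dx F (w + RtoC d * cis s)%C) s)
    by (intros s; apply (circle_continuous U); auto; apply (C1_contx HF)).
  assert (Cp : forall n s, continuous (fun s => inv_circle d s ^ n)%C s)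
    by cont.
  set (c := (RtoC (2 * PI) * Ci)%C).
  assert (Nc : c <> 0%C).
  { apply Cmult_neq_0; [|apply Ci_nz]. intros H. apply RtoC_inj in H.
    generalize PI_RGT_0. lra. }
  unfold coef.
  rewrite <- CInt_scal by (try lra; intros; apply continuous_Cmult; auto).
  assert (I : CInt (fun s => c * (Dx F (w + RtoC d * cis s) * inv_circle d s ^ k
       - RtoC (INR (S k)) * (F (w + RtoC d * cis s) * inv_circle d s ^ S k)))%C 0 1 = RtoC 0).
  { rewrite (CInt_FTC (fun s => F (w + RtoC d * cis s) * inv_circle d s ^ S k)%C); [|lra| | |].
    - unfold inv_circle. rewrite cis_0, cis_1. eqC. ring.
    - intros s _.
      assert (D1 : CD (fun s => w + RtoC d * cis s)%C s (RtoC d * (c * cis s))%C).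
      { refine (CD_eq _ _ _ _ (CD_plus _ _ _ _ _ (CD_const w s)
          (CD_mult _ _ _ _ _ (CD_const (RtoC d) s) (cis_CD s))) _). unfold c. ring. }
      assert (D2 : CD (inv_circle d) s (- c * inv_circle d s)%C).
      { refine (CD_eq _ _ _ _ (CD_mult _ _ _ _ _ (CD_const (RtoC (/ d)) s) (conj_cis_CD s)) _).
        unfold c, inv_circle. ring. }
      assert (D3 := holo_comp U F _ s _ HO HF (in_disc U w d s Hd HU) D1).
      refine (CD_eq _ _ _ _ (CD_mult _ _ _ _ _ D3 (CD_pow _ k _ _ D2)) _).
      assert (Q : (RtoC d * cis s * inv_circle d s = 1)%C).
      { unfold inv_circle.
        replace (RtoC d * cis s * (RtoC (/ d) * Cconj (cis s)))%C
          with (RtoC d * RtoC (/ d) * (cis s * Cconj (cis s)))%C by ring.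
        rewrite cis_conj, <- RtoC_mult, Rinv_r by lra. ring. }
      simpl Cpow.
      transitivity (c * ((RtoC d * cis s * inv_circle d s) * (Dx F (w + RtoC d * cis s) * inv_circle d s ^ k)
       - RtoC (INR (S k)) * (F (w + RtoC d * cis s) * (inv_circle d s * inv_circle d s ^ k))))%C; [ring|].
      rewrite Q. ring.
    - cont.
    - cont. }
  rewrite CInt_scal in I.
  2: lra.
  2:{ intros s _. apply continuous_Cminus; [cont|].
      apply continuous_Cmult; [cont|].
      apply continuous_Cmult; [auto|exact (Cp (S k) s)]. }
  rewrite CInt_minus in I.
  2: lra.
  2:{ intros s _. apply continuous_Cmult; auto. }
  2:{ intros s _. apply continuous_Cmult; [cont|].
      apply continuous_Cmult; [auto|exact (Cp (S k) s)]. }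
  apply Ceq_sub. revert I. generalize (CInt (fun s => Dx F (w + RtoC d * cis s) * inv_circle d s ^ k)%C 0 1).
  generalize (CInt (fun x : R => RtoC (INR (S k)) * (F (w + RtoC d * cis x) * inv_circle d x ^ S k))%C 0 1).
  intros u v I. change (c * (v - u) = 0)%C in I. change (v - u = 0)%C.
  replace (v - u)%C with (/ c * (c * (v - u)))%C by (field; exact Nc). rewrite I. ring.
Qed.

Lemma inv_kernel_bound (d : R) (zeta : C) s : 0 < d -> Cmod zeta < d ->
  (1 - zeta * inv_circle d s)%C <> 0%C /\
  Cmod (/ (1 - zeta * inv_circle d s)) <= / (1 - Cmod zeta / d).
Proof.
  intros Hd Hz.
  assert (B : Cmod (zeta * inv_circle d s) = Cmod zeta / d)
    by (rewrite Cmod_mult, inv_circle_Cmod by exact Hd; reflexivity).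
  assert (Q : Cmod zeta / d < 1) by (apply Rmult_lt_reg_r with d; [lra|]; unfold Rdiv; rewrite Rmult_assoc, Rinv_l; lra).
  assert (L : 1 - Cmod zeta / d <= Cmod (1 - zeta * inv_circle d s)).
  { rewrite <- B. generalize (Cmod_triangle (1 - zeta * inv_circle d s) (zeta * inv_circle d s)).
    replace (1 - zeta * inv_circle d s + zeta * inv_circle d s)%C with (RtoC 1) by ring.
    rewrite Cmod_1. lra. }
  assert (N : (1 - zeta * inv_circle d s)%C <> 0%C) by (apply Cmod_gt_0; lra).
  split; [exact N|]. rewrite Cmod_inv by exact N. apply Rinv_le_contravar; lra.
Qed.

Lemma inv_kernel_continuous (d : R) (zeta : C) s : 0 < d -> Cmod zeta < d ->
  continuous (fun s => / (1 - zeta * inv_circle d s))%C s.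
Proof.
  intros Hd Hz. apply continuous_Cinv; [|now apply inv_kernel_bound].
  apply continuous_Cminus; [cont|].
  apply continuous_Cmult; [cont|cont].
Qed.

(** Geometric expansion of a Cauchy integral. *)
Lemma Cauchy_expansion (f : R -> C) (d M : R) (zeta : C) n :
  0 < d -> Cmod zeta < d -> (forall s, continuous f s) ->
  (forall s, 0 <= s <= 1 -> Cmod (f s) <= M) ->
  Cmod (CInt (fun s => f s * / (1 - zeta * inv_circle d s))%C 0 1
    - Csum (fun k => CInt (fun s => f s * inv_circle d s ^ k) 0 1 * zeta ^ k)%C n)
  <= M * (Cmod zeta / d) ^ n * / (1 - Cmod zeta / d).
Proof.
  intros Hd Hz Cf HM.
  assert (Ck := fun s => inv_kernel_continuous d zeta s Hd Hz).
  assert (I : (CInt (fun s => f s * / (1 - zeta * inv_circle d s))%C 0 1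
    - Csum (fun k => CInt (fun s => f s * inv_circle d s ^ k) 0 1 * zeta ^ k)%C n =
    CInt (fun s => zeta ^ n * (f s * inv_circle d s ^ n * / (1 - zeta * inv_circle d s)))%C 0 1)%C).
  { induction n as [|n IH].
    - simpl. transitivity (CInt (fun s => f s * / (1 - zeta * inv_circle d s))%C 0 1); [eqC; ring|].
      apply CInt_ext; [lra|]. intros s _. ring.
    - simpl Csum.
      transitivity ((CInt (fun s => f s * / (1 - zeta * inv_circle d s))%C 0 1
        - Csum (fun k => CInt (fun s => f s * inv_circle d s ^ k) 0 1 * zeta ^ k)%C n)
        - zeta ^ n * CInt (fun s => f s * inv_circle d s ^ n)%C 0 1)%C; [eqC; ring|].
      rewrite IH, <- CInt_scal, <- CInt_minus; try lra.
      + apply CInt_ext; [lra|]. intros s _.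
        destruct (inv_kernel_bound d zeta s Hd Hz) as [N _]. simpl Cpow. field. exact N.
      + cont.
      + cont.
      + cont. }
  rewrite I.
  replace (M * (Cmod zeta / d) ^ n * / (1 - Cmod zeta / d))
    with (M * (Cmod zeta / d) ^ n * / (1 - Cmod zeta / d) * (1 - 0)) by ring.
  apply CInt_bound_const; [lra| |].
  - cont.
  - intros s Hs. rewrite !Cmod_mult, !Cmod_pow, inv_circle_Cmod by exact Hd.
    destruct (inv_kernel_bound d zeta s Hd Hz) as [_ B].
    unfold Rdiv at 1. rewrite Rpow_mult_distr.
    replace (Cmod zeta ^ n * (Cmod (f s) * (/ d) ^ n * Cmod (/ (1 - zeta * inv_circle d s))))
      with (Cmod (f s) * (Cmod zeta ^ n * (/ d) ^ n) * Cmod (/ (1 - zeta * inv_circle d s))) by ring.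
    assert (P : 0 <= Cmod zeta ^ n * (/ d) ^ n).
    { apply Rmult_le_pos; apply pow_le; [apply Cmod_ge_0|left; now apply Rinv_0_lt_compat]. }
    apply Rmult_le_compat; [apply Rmult_le_pos; [apply Cmod_ge_0|exact P]|apply Cmod_ge_0| |exact B].
    apply Rmult_le_compat_r; [exact P|now apply HM].
Qed.

Lemma geometric_small (M q eps : R) : 0 <= q < 1 -> 0 < eps ->
  exists n, forall m, (n <= m)%nat -> M * q ^ m * / (1 - q) < eps.
Proof.
  intros Hq He.
  assert (L : is_lim_seq (fun m => M * / (1 - q) * q ^ m) 0).
  { replace (Finite 0) with (Rbar_mult (M * / (1 - q)) 0) by (simpl; f_equal; ring).
    apply is_lim_seq_scal_l, is_lim_seq_geom. rewrite Rabs_pos_eq; lra. }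
  destruct (lim_zero_small _ eps He L) as [n Hn]. exists n. intros m Hm.
  specialize (Hn m Hm). apply (Rle_lt_trans _ _ _ (Rle_abs _)) in Hn.
  replace (M * q ^ m * / (1 - q)) with (M * / (1 - q) * q ^ m) by ring. exact Hn.
Qed.

Lemma C1on_const (c : C) :
  C1on (fun _ => True) (fun _ : C => c) (fun _ => RtoC 0) (fun _ => Ci * RtoC 0)%C.
Proof.
  split.
  - cont.
  - cont.
  - cont.
  - intros z _. apply CD_const.
  - intros z _. apply (CD_eq _ _ _ _ (CD_const _ _)). ring.
Qed.

Lemma holo_const (c : C) : holo (fun _ => True) (fun _ => c).
Proof. apply (C1on_holo _ _ _ (C1on_const c)). exact open_true. Qed.

Lemma coef_const_S d k : 0 < d -> coef (fun _ => RtoC 1) 0 d (S k) = RtoC 0.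
Proof.
  intros Hd.
  assert (H := coef_derive (fun _ => True) (fun _ => RtoC 1) 0 d k open_true (holo_const 1) Hd
     (fun _ _ => I)).
  assert (Z : coef (Dx (fun _ => RtoC 1)) 0 d k = RtoC 0).
  { unfold coef. rewrite (CInt_ext _ (fun _ => RtoC 0)); [rewrite CInt_const; eqC; ring|lra|].
    intros s _. replace (Dx (fun _ => RtoC 1) (0 + RtoC d * cis s)%C) with (RtoC 0); [ring|].
    symmetry. apply CD_CDerive, CD_const. }
  rewrite Z in H.
  assert (N : RtoC (INR (S k)) <> 0%C).
  { intros E0. apply RtoC_inj in E0. revert E0. now apply not_0_INR. }
  replace (coef (fun _ => RtoC 1) 0 d (S k)) with
    (/ RtoC (INR (S k)) * (RtoC (INR (S k)) * coef (fun _ => RtoC 1) 0 d (S k)))%C by (field; exact N).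
  rewrite <- H. ring.
Qed.

(** By the geometric expansion, as the powers [inv_circle d s ^ k] have integral
    zero for [k > 0]. *)
Lemma Cauchy_kernel_integral (d : R) (zeta : C) : 0 < d -> Cmod zeta < d ->
  CInt (fun s => / (1 - zeta * inv_circle d s))%C 0 1 = RtoC 1.
Proof.
  intros Hd Hz.
  assert (Q : 0 <= Cmod zeta / d < 1).
  { split; [apply Rdiv_le_0_compat; [apply Cmod_ge_0|exact Hd]|].
    apply Rmult_lt_reg_r with d; [lra|]; unfold Rdiv; rewrite Rmult_assoc, Rinv_l; lra. }
  apply Ceq_sub, Cmod_eq_0. apply Rle_antisym; [|apply Cmod_ge_0].
  apply le_epsilon. intros eps He. rewrite Rplus_0_l.
  destruct (geometric_small 1 _ eps Q He) as [n Hn]. left.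
  eapply Rle_lt_trans; [|apply (Hn (S n)); lia].
  assert (X := Cauchy_expansion (fun _ => RtoC 1) d 1 zeta (S n) Hd Hz
    (fun s => continuous_Cconst _ s) (fun s _ => Req_le _ _ Cmod_1)).
  assert (S1 : Csum (fun k => CInt (fun s => RtoC 1 * inv_circle d s ^ k) 0 1 * zeta ^ k)%C (S n) = RtoC 1).
  { clear - Hd. induction n as [|n IH].
    - simpl. rewrite (CInt_ext _ (fun _ => RtoC 1)); [rewrite CInt_const, Rminus_0_r; eqC; ring|lra|].
      intros s _. ring.
    - etransitivity; [exact (f_equal (fun c => Cplus c (coef (fun _ => RtoC 1) 0 d (S n) * zeta ^ S n)%C) IH)|].
      rewrite coef_const_S by exact Hd. ring. }
  cbv beta in X. rewrite S1 in X.
  rewrite (CInt_ext _ (fun s => RtoC 1 * / (1 - zeta * inv_circle d s))%C); [exact X|lra|].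
  intros s _. ring.
Qed.

Lemma inv_circle_cis d s : 0 < d -> (RtoC d * cis s * inv_circle d s = 1)%C.
Proof.
  intros Hd. unfold inv_circle.
  replace (RtoC d * cis s * (RtoC (/ d) * Cconj (cis s)))%C
    with (RtoC d * RtoC (/ d) * (cis s * Cconj (cis s)))%C by ring.
  rewrite cis_conj, <- RtoC_mult, Rinv_r by lra. ring.
Qed.

(** The circle is contracted to the point [w + zeta] along segments; the integral
    stays constant, because its derivative is, up to a factor, the integral of a
    derivative over a closed curve. *)
Lemma Cauchy_formula (U : C -> Prop) (F : C -> C) (w zeta : C) (d : R) :
  open U -> holo U F -> 0 < d -> (forall v, Cmod (v - w) <= d -> U v) -> Cmod zeta < d ->
  F (w + zeta)%C = CInt (fun s => F (w + RtoC d * cis s) * / (1 - zeta * inv_circle d s))%C 0 1.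
Proof.
  intros HO HF Hd HU Hz.
  set (gam := fun u s => (w + zeta + RtoC u * (RtoC d * cis s - zeta))%C).
  set (ker := fun s => (/ (1 - zeta * inv_circle d s))%C).
  assert (Ck : forall s, continuous ker s) by (intros s; now apply inv_kernel_continuous).
  assert (Hin : forall u s, 0 <= u <= 1 -> U (gam u s)).
  { intros u s Hu. apply HU.
    replace (gam u s - w)%C with (RtoC (1 - u) * zeta + RtoC u * (RtoC d * cis s))%C
      by (unfold gam; rewrite RtoC_minus; ring).
    eapply Rle_trans; [apply Cmod_triangle|].
    rewrite !Cmod_scal, cis_Cmod by lra. nra. }
  assert (Cgam : forall p : R * R, continuous (T := RR) (U := C_UniformSpace) (fun p => gam (fst p) (snd p)) p).
  { intros p. apply (continuous_Cplus (T := RR)); [cont|].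
    apply (continuous_Cmult (T := RR)).
    - cont.
    - cont. }
  assert (Cgam2 : forall u s, continuous (fun s => gam u s) s).
  { intros u s. apply (continuous_comp_2 (fun _ => u) (fun s => s) gam);
    [cont|cont|apply Cgam]. }
  assert (CFg : forall G : C -> C, (forall v, U v -> continuous G v) -> forall u s, U (gam u s) ->
     continuous (T := RR) (fun p => G (gam (fst p) (snd p))) (u, s)).
  { cont. }
  assert (Near : forall u0, 0 <= u0 <= 1 -> locally u0 (fun u => forall s, 0 <= s <= 1 -> U (gam u s))).
  { intros u0 Hu0. apply (tube u0 0 1 (fun u s => U (gam u s))). intros s _.
    exact (Cgam (u0, s) U (HO _ (Hin u0 s Hu0))). }
  assert (CF := C1_cont HF). assert (CF' := C1_contx HF).
  set (Phi := fun u => CInt (fun s => F (gam u s) * ker s)%C 0 1).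
  assert (CPhi : forall u, 0 <= u <= 1 -> continuous Phi u).
  { intros u Hu. apply (CInt_param_continuous (fun u s => F (gam u s) * ker s)%C u 0 1); [lra| |].
    - intros s Hs. apply (continuous_Cmult (T := RR)); [now apply CFg, Hin|].
      apply (continuous_comp (U := RR) (V := R_UniformSpace) snd ker); [apply continuous_snd'|apply Ck].
    - generalize (Near u Hu). apply filter_imp. intros v Hv s Hs.
      apply continuous_Cmult; [|apply Ck].
      apply (continuous_comp (fun s => gam v s) F); [apply Cgam2|now apply CF, Hv]. }
  set (c := (RtoC (2 * PI) * Ci)%C).
  assert (Nc : c <> 0%C).
  { apply Cmult_neq_0; [|apply Ci_nz]. intros H. apply RtoC_inj in H.
    generalize PI_RGT_0. lra. }
  assert (DPhi : forall u, 0 < u < 1 -> CD Phi u (RtoC 0)).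
  { intros u Hu. 
    assert (D : CD Phi u (CInt (fun s => (RtoC d * cis s - zeta) * Dx F (gam u s) * ker s)%C 0 1)).
    { apply (CInt_param_derive (fun u s => F (gam u s) * ker s)%C
        (fun u s => (RtoC d * cis s - zeta) * Dx F (gam u s) * ker s)%C u 0 1); [lra| |].
      - generalize (Near u ltac:(lra)). apply filter_imp. intros v Hv s Hs. split.
        + assert (Dg : CD (fun u => gam u s) v (RtoC d * cis s - zeta)%C).
          { refine (CD_eq _ _ _ _ (CD_plus _ _ _ _ _ (CD_const (w + zeta)%C v)
              (CD_mult _ _ _ _ _ (CD_RtoC _ _ _ (is_derive_id (K := R_AbsRing) v)) (CD_const (RtoC d * cis s - zeta)%C v))) _).
            change (one : R) with 1. ring. }
          assert (D1 := holo_comp U F (fun u => gam u s) v _ HO HF (Hv s Hs) Dg).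
          refine (CD_eq _ _ _ _ (CD_mult _ _ _ _ _ D1 (CD_const (ker s) v)) _). ring.
        + cont.
      - intros s Hs. apply (continuous_Cmult (T := RR));
          [|apply (continuous_comp (U := RR) (V := R_UniformSpace) snd ker); [apply continuous_snd'|apply Ck]].
        apply (continuous_Cmult (T := RR) (fun p => RtoC d * cis (snd p) - zeta)%C
          (fun p => Dx F (gam (fst p) (snd p)))); [cont|].
        apply (CFg (Dx F) CF'), Hin; lra. }
    apply (CD_eq _ _ _ _ D).
    assert (Nu : RtoC u <> 0%C) by (intros H; apply RtoC_inj in H; lra).
    assert (CI : forall s, continuous (fun s => RtoC d * cis s * Dx F (gam u s))%C s).
    { intros s. apply continuous_Cmult.
      - cont.
      - apply (continuous_comp (fun s => gam u s) (Dx F)); [apply Cgam2|apply CF', Hin; lra]. }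
    rewrite (CInt_ext _ (fun s => RtoC d * cis s * Dx F (gam u s))%C); [|lra|].
    2:{ intros s _. destruct (inv_kernel_bound d zeta s Hd Hz) as [N _].
        assert (Q := inv_circle_cis d s Hd).
        replace (RtoC d * cis s - zeta)%C with (RtoC d * cis s * (1 - zeta * inv_circle d s))%C.
        - unfold ker. field. exact N.
        - transitivity (RtoC d * cis s - zeta * (RtoC d * cis s * inv_circle d s))%C; [ring|].
          rewrite Q. ring. }
    assert (I : CInt (fun s => c * RtoC u * (RtoC d * cis s * Dx F (gam u s)))%C 0 1 = RtoC 0).
    { rewrite (CInt_FTC (fun s => F (gam u s))); [|lra| | |].
      - unfold gam. rewrite cis_0, cis_1. eqC. ring.
      - intros s _.
        assert (Dg : CD (fun s => gam u s) s (RtoC u * (RtoC d * (c * cis s)))%C).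
        { refine (CD_eq _ _ _ _ (CD_plus _ _ _ _ _ (CD_const (w + zeta)%C s)
            (CD_mult _ _ _ _ _ (CD_const (RtoC u) s) (CD_minus _ _ _ _ _
              (CD_mult _ _ _ _ _ (CD_const (RtoC d) s) (cis_CD s)) (CD_const zeta s)))) _).
          unfold c. ring. }
        refine (CD_eq _ _ _ _ (holo_comp U F (fun s => gam u s) s _ HO HF (Hin u s ltac:(lra)) Dg) _).
        ring.
      - intros s _. apply (continuous_comp (fun s => gam u s) F); [apply Cgam2|apply CF, Hin; lra].
      - cont. }
    rewrite CInt_scal in I by (try lra; auto).
    assert (Hv : forall v : C, (c * RtoC u * v)%C = RtoC 0 -> v = RtoC 0).
    { intros v Hv. replace v with (/ (c * RtoC u) * (c * RtoC u * v))%C by (field; now split).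
      rewrite Hv. ring. }
    exact (Hv _ I). }
  assert (Z := CD_zero_const Phi 0 1 ltac:(lra) DPhi CPhi).
  assert (P0 : Phi 0 = F (w + zeta)%C).
  { unfold Phi. rewrite (CInt_ext _ (fun s => F (w + zeta) * ker s)%C); [|lra|].
    - rewrite CInt_scal by (try lra; auto). unfold ker. rewrite Cauchy_kernel_integral by assumption.
      eqC; ring.
    - intros s _. unfold gam. do 2 f_equal. ring. }
  rewrite <- P0, <- Z. unfold Phi. apply CInt_ext; [lra|]. intros s _. unfold gam, ker.
  do 2 f_equal. ring.
Qed.

Lemma Taylor_bound (U : C -> Prop) (F : C -> C) (w zeta : C) (d M : R) n :
  open U -> holo U F -> 0 < d -> (forall v, Cmod (v - w) <= d -> U v) ->
  (forall v, Cmod (v - w) <= d -> Cmod (F v) <= M) -> Cmod zeta < d ->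
  Cmod (F (w + zeta) - Csum (fun k => coef F w d k * zeta ^ k) n)%C
  <= M * (Cmod zeta / d) ^ n * / (1 - Cmod zeta / d).
Proof.
  intros HO HF Hd HU HM Hz.
  rewrite (Cauchy_formula U F w zeta d HO HF Hd HU Hz).
  apply (Cauchy_expansion (fun s => F (w + RtoC d * cis s)%C) d M zeta n Hd Hz).
  - intros s. apply (circle_continuous U); auto. apply (C1_cont HF).
  - intros s _. apply HM. replace (w + RtoC d * cis s - w)%C with (RtoC d * cis s)%C by ring.
    rewrite Cmod_scal, cis_Cmod; lra.
Qed.

Lemma coef_bound (U : C -> Prop) (F : C -> C) (w : C) (d M : R) k :
  0 < d -> (forall v, Cmod (v - w) <= d -> U v) -> (forall v, U v -> continuous F v) ->
  (forall v, Cmod (v - w) <= d -> Cmod (F v) <= M) ->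
  Cmod (coef F w d k) <= M * (/ d) ^ k.
Proof.
  intros Hd HU CF HM. unfold coef.
  replace (M * (/ d) ^ k) with (M * (/ d) ^ k * (1 - 0)) by ring.
  apply CInt_bound_const; [lra| |].
  - intros s _. apply continuous_Cmult; [now apply (circle_continuous U)|].
    apply continuous_Cpow, inv_circle_continuous.
  - intros s _. rewrite Cmod_mult, Cmod_pow, inv_circle_Cmod by exact Hd.
    apply Rmult_le_compat_r; [apply pow_le; left; now apply Rinv_0_lt_compat|].
    apply HM. replace (w + RtoC d * cis s - w)%C with (RtoC d * cis s)%C by ring.
    rewrite Cmod_scal, cis_Cmod; lra.
Qed.

Lemma coef_0 (U : C -> Prop) (F : C -> C) (w : C) (d : R) :
  open U -> holo U F -> 0 < d -> (forall v, Cmod (v - w) <= d -> U v) ->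
  coef F w d 0 = F w.
Proof.
  intros HO HF Hd HU. replace (F w) with (F (w + 0)%C) by (f_equal; ring).
  rewrite (Cauchy_formula U F w 0 d HO HF Hd HU) by (rewrite Cmod_0; exact Hd).
  unfold coef. apply CInt_ext; [lra|]. intros s _. simpl Cpow.
  replace (1 - 0 * inv_circle d s)%C with (RtoC 1) by ring. field.
Qed.

(** * Derivatives of holomorphic functions *)

Lemma C1on_ext (U : C -> Prop) h k hx hy : open U -> C1on U h hx hy ->
  (forall z, U z -> h z = k z) -> C1on U k hx hy.
Proof.
  intros HO H E. split.
  - intros z Hz. apply (continuous_ext_C h); [|now apply (C1_cont H)].
    apply (filter_imp U); [exact E|now apply HO].
  - apply (C1_contx H).
  - apply (C1_conty H).
  - intros z Hz. apply (CD_ext_loc (fun t => h (t, Im z))); [|now apply (C1_derx H)].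
    apply (locally_slice_x z (fun w => h w = k w)). apply (filter_imp U); [exact E|now apply HO].
  - intros z Hz. apply (CD_ext_loc (fun t => h (Re z, t))); [|now apply (C1_dery H)].
    apply (locally_slice_y z (fun w => h w = k w)). apply (filter_imp U); [exact E|now apply HO].
Qed.

Lemma CD_line_x (y x : R) : CD (fun t => (t, y) : C) x (RtoC 1).
Proof.
  apply CD_iff; split; [exact (is_derive_id (K := R_AbsRing) x)|].
  exact (is_derive_const (V := R_NormedModule) y x).
Qed.

Lemma CD_line_y (x y : R) : CD (fun t => (x, t) : C) y Ci.
Proof.
  apply CD_iff; split; [|exact (is_derive_id (K := R_AbsRing) y)].
  exact (is_derive_const (V := R_NormedModule) x y).
Qed.

(** The integral of [f s / (d cis s)^j] against the [n]-th power of the Cauchy kernel.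
    For [j = 0] and [n = 1] it is the Cauchy integral of [f]; for [n = j + 1] its
    [j]-th derivative, up to the factor [j!]. *)
Definition Cauchy_power (f : R -> C) (w : C) (d : R) (j n : nat) (z : C) : C :=
  CInt (fun s => f s * inv_circle d s ^ j * (/ (1 - (z - w) * inv_circle d s)) ^ n)%C 0 1.

Lemma open_disc (w : C) (d : R) : open (fun v => Cmod (v - w) < d).
Proof.
  intros v Hv. apply locally_disc. exists (d - Cmod (v - w)). split; [lra|].
  intros u Hu. replace (u - w)%C with ((u - v) + (v - w))%C by ring.
  eapply Rle_lt_trans; [apply Cmod_triangle|]. lra.
Qed.

Lemma Cauchy_power_C1 (f : R -> C) (w : C) (d : R) (j n : nat) : 0 < d ->
  (forall s, continuous f s) ->
  C1on (fun v => Cmod (v - w) < d) (Cauchy_power f w d j (S n))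
    (fun z => RtoC (INR (S n)) * Cauchy_power f w d (S j) (S (S n)) z)%C
    (fun z => Ci * (RtoC (INR (S n)) * Cauchy_power f w d (S j) (S (S n)) z))%C.
Proof.
  intros Hd Cf.
  set (D := fun v => Cmod (v - w) < d).
  set (I := fun z s => (/ (1 - (z - w) * inv_circle d s))%C).
  assert (N : forall z s, D z -> (1 - (z - w) * inv_circle d s)%C <> 0%C)
    by (intros z s Hz; now apply inv_kernel_bound).
  assert (CI : forall z s, D z -> continuous (T := CR) (U := C_UniformSpace) (fun p => I (fst p) (snd p)) (z, s)).
  { intros z s Hz. apply (continuous_Cinv (T := CR)); [|now apply N].
    apply (continuous_Cminus (T := CR)); [cont|].
    apply (continuous_Cmult (T := CR)).
    - cont.
    - cont. }
  assert (CC : forall j n z s, D z -> continuous (T := CR) (U := C_UniformSpace)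
     (fun p => f (snd p) * inv_circle d (snd p) ^ j * I (fst p) (snd p) ^ n)%C (z, s)).
  { cont. }
  assert (C2 : forall j n z s, D z -> continuous
     (fun s => f s * inv_circle d s ^ j * I z s ^ n)%C s).
  { intros j' n' z s Hz.
    apply (continuous_comp_2 (fun _ => z) (fun s => s) (fun z s => f s * inv_circle d s ^ j' * I z s ^ n')%C);
    [cont|cont|now apply CC]. }
  assert (X := C1on_CInt D (fun z s => f s * inv_circle d s ^ j * I z s ^ S n)%C
    (fun z s => RtoC (INR (S n)) * (f s * inv_circle d s ^ S j * I z s ^ S (S n)))%C
    (fun z s => Ci * (RtoC (INR (S n)) * (f s * inv_circle d s ^ S j * I z s ^ S (S n))))%C 0 1
    (open_disc w d) ltac:(lra)).
  assert (DL : forall (l : R -> C) (z : C) (x : R) (c : C) s, l x = z -> CD l x c -> D z ->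
     CD (fun t => f s * inv_circle d s ^ j * I (l t) s ^ S n)%C x
       (c * (RtoC (INR (S n)) * (f s * inv_circle d s ^ S j * I z s ^ S (S n))))%C).
  { intros l z x c s Hl Dl Hz. subst z.
    assert (D1 : CD (fun t => 1 - (l t - w) * inv_circle d s)%C x (- (c * inv_circle d s))%C).
    { refine (CD_eq _ _ _ _ (CD_minus _ _ _ _ _ (CD_const (RtoC 1) x) (CD_mult _ _ _ _ _
        (CD_minus _ _ _ _ _ Dl (CD_const w x)) (CD_const (inv_circle d s) x))) _). ring. }
    assert (D2 := CD_inv _ _ _ D1 (N _ s Hz)).
    refine (CD_eq _ _ _ _ (CD_mult _ _ _ _ _ (CD_const (f s * inv_circle d s ^ j)%C x) (CD_pow _ n _ _ D2)) _).
    unfold I. simpl Cpow. field. now apply N. }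
  assert (Y : C1on D (Cauchy_power f w d j (S n))
    (fun z => CInt (fun s => RtoC (INR (S n)) * (f s * inv_circle d s ^ S j * I z s ^ S (S n)))%C 0 1)
    (fun z => CInt (fun s => Ci * (RtoC (INR (S n)) * (f s * inv_circle d s ^ S j * I z s ^ S (S n))))%C 0 1)).
  { apply X.
    - intros z s Hz _. now apply (CC j (S n)).
    - cont.
    - cont.
    - intros z s Hz _.
      assert (Dl := DL (fun t => (t, Im z)) z (Re z) (RtoC 1) s (eq_sym (surjective_pairing z))
        (CD_line_x _ _) Hz).
      rewrite Cmult_1_l in Dl. exact Dl.
    - intros z s Hz _.
      exact (DL (fun t => (Re z, t)) z (Im z) Ci s (eq_sym (surjective_pairing z)) (CD_line_y _ _) Hz). }
  assert (E1 : forall z, D z ->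
     CInt (fun s => RtoC (INR (S n)) * (f s * inv_circle d s ^ S j * I z s ^ S (S n)))%C 0 1
     = (RtoC (INR (S n)) * Cauchy_power f w d (S j) (S (S n)) z)%C).
  { intros z Hz. rewrite CInt_scal; [reflexivity|lra|]. intros s _. now apply (C2 (S j) (S (S n))). }
  assert (E2 : forall z, D z ->
     CInt (fun s => Ci * (RtoC (INR (S n)) * (f s * inv_circle d s ^ S j * I z s ^ S (S n))))%C 0 1
     = (Ci * (RtoC (INR (S n)) * Cauchy_power f w d (S j) (S (S n)) z))%C).
  { intros z Hz. rewrite CInt_scal; [rewrite E1 by exact Hz; reflexivity|lra|].
    intros s _. apply continuous_Cmult; [cont|now apply (C2 (S j) (S (S n)))]. }
  destruct Y as [y1 y2 y3 y4 y5]. split; auto.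
  - intros z Hz. apply (continuous_ext_C _ _ _ (filter_imp _ _ E1 (open_disc w d z Hz)) (y2 z Hz)).
  - intros z Hz. apply (continuous_ext_C _ _ _ (filter_imp _ _ E2 (open_disc w d z Hz)) (y3 z Hz)).
  - intros z Hz. rewrite <- E1 by exact Hz. now apply y4.
  - intros z Hz. rewrite <- E2 by exact Hz. now apply y5.
Qed.

Lemma open_closed_disc (U : C -> Prop) w : open U -> U w ->
  exists d, 0 < d /\ forall v, Cmod (v - w) <= d -> U v.
Proof.
  intros HO Hw. destruct (proj1 (locally_disc w U) (HO w Hw)) as [d [Hd H]].
  exists (d / 2). split; [lra|]. intros v Hv. apply H. lra.
Qed.

(** Near each point [F] is a Cauchy integral, hence twice differentiable. *)
Lemma holo_derive (U : C -> Prop) F : open U -> holo U F -> holo U (Dx F).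
Proof.
  intros HO HF.
  assert (L : forall w, U w -> exists d, 0 < d /\ holo (fun v => Cmod (v - w) < d) (Dx F)).
  { intros w Hw. destruct (open_closed_disc U w HO Hw) as [d [Hd HU]]. exists d. split; [exact Hd|].
    set (f := fun s => F (w + RtoC d * cis s)%C).
    assert (Cf : forall s, continuous f s)
      by (intros s; apply (circle_continuous U); auto; apply (C1_cont HF)).
    assert (A1 := Cauchy_power_C1 f w d 0 0 Hd Cf).
    assert (A2 := Cauchy_power_C1 f w d 1 1 Hd Cf).
    set (D := fun v => Cmod (v - w) < d) in *.
    assert (OD : open D) by apply open_disc.
    assert (E1 : forall z, D z -> Cauchy_power f w d 0 1 z = F z).
    { intros z Hz. replace (F z) with (F (w + (z - w))%C) by (f_equal; ring).
      rewrite (Cauchy_formula U F w (z - w) d HO HF Hd HU Hz).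
      apply CInt_ext; [lra|]. intros s _. unfold f. simpl Cpow. ring. }
    assert (B1' := C1on_ext D _ F _ _ OD A1 E1).
    destruct (C1on_holo D F _ B1' OD) as [_ E2].
    assert (B2 := C1on_ext D _ (Dx F) _ _ OD A2
      ltac:(intros z Hz; rewrite E2 by exact Hz; simpl INR; rewrite Cmult_1_l; reflexivity)).
    exact (proj1 (C1on_holo D (Dx F) _ B2 OD)). }
  assert (L' : forall w, U w -> exists D : C -> Prop, D w /\ holo D (Dx F)).
  { intros w Hw. destruct (L w Hw) as [d [Hd H]]. exists (fun v => Cmod (v - w) < d). split; [|exact H].
    replace (w - w)%C with (RtoC 0) by ring. now rewrite Cmod_0. }
  split; intros w Hw; destruct (L' w Hw) as [D [Dw H]].
  - exact (C1_cont H w Dw).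
  - exact (C1_contx H w Dw).
  - exact (C1_conty H w Dw).
  - exact (C1_derx H w Dw).
  - exact (C1_dery H w Dw).
Qed.

(** The [k]-th complex derivative. *)
Definition Dk (F : C -> C) (k : nat) : C -> C := Nat.iter k Dx F.

Lemma Dk_S F k : Dk F (S k) = Dk (Dx F) k.
Proof. unfold Dk. induction k; [reflexivity|]. simpl in *. now rewrite IHk. Qed.

Lemma coef_Dk (U : C -> Prop) (F : C -> C) (w : C) (d : R) k :
  open U -> holo U F -> 0 < d -> (forall v, Cmod (v - w) <= d -> U v) ->
  (RtoC (INR (fact k)) * coef F w d k = Dk F k w)%C.
Proof.
  intros HO HF Hd HU. revert F HF. induction k as [|k IH]; intros F HF.
  - simpl. rewrite (coef_0 U) by assumption. unfold Dk; simpl. ring.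
  - rewrite Dk_S, <- IH by now apply holo_derive.
    rewrite (coef_derive U F w d k) by assumption.
    rewrite fact_simpl, mult_INR, RtoC_mult. ring.
Qed.

(** * Polynomial approximation *)

(** Horner evaluation of the polynomial with the coefficients [l]. *)
Fixpoint peval (l : list C) (z : C) : C :=
  match l with nil => RtoC 0 | a :: l' => (a + z * peval l' z)%C end.

(** Sum of two polynomials given by their coefficients. *)
Fixpoint padd (l1 l2 : list C) : list C :=
  match l1, l2 with
  | nil, _ => l2
  | _, nil => l1
  | a :: l1', b :: l2' => (a + b)%C :: padd l1' l2'
  end.

Lemma peval_padd l1 l2 z : peval (padd l1 l2) z = (peval l1 z + peval l2 z)%C.
Proof.
  revert l2. induction l1 as [|a l1 IH]; intros [|b l2]; simpl; try ring.
  rewrite IH. ring.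
Qed.

Lemma peval_scal c l z : peval (map (fun a => c * a)%C l) z = (c * peval l z)%C.
Proof. induction l as [|a l IH]; simpl; [ring|]. rewrite IH. ring. Qed.

Lemma peval_shift k l z : peval (repeat (RtoC 0) k ++ l) z = (z ^ k * peval l z)%C.
Proof. induction k as [|k IH]; simpl; [ring|]. rewrite IH. ring. Qed.

Lemma Csum_shift (a : nat -> C) n : Csum a (S n) = (a O + Csum (fun k => a (S k)) n)%C.
Proof.
  induction n as [|n IH]; [simpl; ring|].
  change (Csum a (S (S n))) with (Csum a (S n) + a (S n))%C. rewrite IH. simpl. ring.
Qed.

Lemma Csum_scal (c : C) (a : nat -> C) n : Csum (fun k => c * a k)%C n = (c * Csum a n)%C.
Proof. induction n as [|n IH]; simpl; [ring|]. rewrite IH. ring. Qed.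

Lemma Csum_ext (a b : nat -> C) n : (forall k, a k = b k) -> Csum a n = Csum b n.
Proof. intros H. induction n as [|n IH]; simpl; [reflexivity|]. now rewrite IH, H. Qed.

Lemma peval_Csum l z : peval l z = Csum (fun k => nth k l (RtoC 0) * z ^ k)%C (length l).
Proof.
  induction l as [|a l IH]; [reflexivity|].
  simpl length. rewrite Csum_shift. simpl peval. rewrite IH, <- Csum_scal.
  simpl nth. simpl Cpow. rewrite Cmult_1_r. f_equal. apply Csum_ext. intros k. ring.
Qed.

(** [F] is a uniform limit of polynomials on [K]. *)
Definition appr (K : C -> Prop) (F : C -> C) : Prop :=
  forall eps, 0 < eps -> exists l, forall z, K z -> Cmod (F z - peval l z) < eps.

Lemma appr_const K c : appr K (fun _ => c).
Proof.
  intros eps He. exists (c :: nil). intros z _. simpl.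
  replace (c - (c + z * 0))%C with (RtoC 0) by ring. now rewrite Cmod_0.
Qed.

Lemma appr_plus K F G : appr K F -> appr K G -> appr K (fun z => F z + G z)%C.
Proof.
  intros HF HG eps He. destruct (HF (eps / 2) ltac:(lra)) as [l1 H1].
  destruct (HG (eps / 2) ltac:(lra)) as [l2 H2]. exists (padd l1 l2). intros z Hz.
  rewrite peval_padd.
  replace (F z + G z - (peval l1 z + peval l2 z))%C
    with ((F z - peval l1 z) + (G z - peval l2 z))%C by ring.
  eapply Rle_lt_trans; [apply Cmod_triangle|]. generalize (H1 z Hz) (H2 z Hz). lra.
Qed.

Lemma appr_monomial (K : C -> Prop) Rm F c k : 0 <= Rm -> (forall z, K z -> Cmod z <= Rm) ->
  appr K F -> appr K (fun z => c * z ^ k * F z)%C.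
Proof.
  intros HR HK HF eps He.
  set (m := Cmod c * Rm ^ k + 1).
  assert (Hm : 0 < m).
  { unfold m. assert (0 <= Cmod c * Rm ^ k) by (apply Rmult_le_pos; [apply Cmod_ge_0|now apply pow_le]). lra. }
  destruct (HF (eps / m) ltac:(now apply Rdiv_lt_0_compat)) as [l H].
  exists (map (fun a => c * a)%C (repeat (RtoC 0) k ++ l)). intros z Hz.
  rewrite peval_scal, peval_shift.
  replace (c * z ^ k * F z - c * (z ^ k * peval l z))%C
    with (c * z ^ k * (F z - peval l z))%C by ring.
  rewrite !Cmod_mult, Cmod_pow.
  assert (B : Cmod c * Cmod z ^ k <= Cmod c * Rm ^ k).
  { apply Rmult_le_compat_l; [apply Cmod_ge_0|]. apply pow_incr.
    split; [apply Cmod_ge_0|now apply HK]. }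
  apply Rle_lt_trans with (Cmod c * Rm ^ k * (eps / m)).
  - apply Rmult_le_compat; [|apply Cmod_ge_0|exact B|left; now apply H].
    apply Rmult_le_pos; [apply Cmod_ge_0|apply pow_le, Cmod_ge_0].
  - assert (Q : 0 < eps / m) by now apply Rdiv_lt_0_compat.
    replace eps with (m * (eps / m)) at 2 by (field; lra).
    apply Rmult_lt_compat_r; [exact Q|unfold m; lra].
Qed.

Lemma appr_Csum K (F : nat -> C -> C) n : (forall k, appr K (F k)) ->
  appr K (fun z => Csum (fun k => F k z) n).
Proof.
  intros H. induction n as [|n IH]; simpl; [apply appr_const|now apply appr_plus].
Qed.

Lemma appr_limit K F : (forall eps, 0 < eps -> exists G, appr K G /\
  forall z, K z -> Cmod (F z - G z) < eps) -> appr K F.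
Proof.
  intros H eps He. destruct (H (eps / 2) ltac:(lra)) as [G [HG H1]].
  destruct (HG (eps / 2) ltac:(lra)) as [l H2]. exists l. intros z Hz.
  replace (F z - peval l z)%C with ((F z - G z) + (G z - peval l z))%C by ring.
  eapply Rle_lt_trans; [apply Cmod_triangle|]. generalize (H1 z Hz) (H2 z Hz). lra.
Qed.

Lemma appr_ext K F G : (forall z, K z -> F z = G z) -> appr K F -> appr K G.
Proof.
  intros E H eps He. destruct (H eps He) as [l Hl]. exists l. intros z Hz.
  rewrite <- E by exact Hz. now apply Hl.
Qed.

(** Holomorphic functions, bounded on each smaller neighbourhood of [K]; this
    class is stable under differentiation. *)
Definition holo_near (U K : C -> Prop) (d : R) (F : C -> C) : Prop :=
  holo U F /\ forall r, 0 < r < d -> exists M, forall z v, K z -> Cmod (v - z) <= r -> Cmod (F v) <= M.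

Lemma holo_near_derive (U K : C -> Prop) d F : open U ->
  (forall z v, K z -> Cmod (v - z) < d -> U v) ->
  holo_near U K d F -> holo_near U K d (Dx F).
Proof.
  intros HO HK [HF HB]. split; [now apply holo_derive|].
  intros r Hr. set (r' := (r + d) / 2). set (e := r' - r).
  assert (Hr' : r < r' < d) by (unfold r'; lra). assert (He : 0 < e) by (unfold e; lra).
  destruct (HB r' ltac:(lra)) as [M HM]. exists (M * (/ e) ^ 1).
  intros z v Hz Hv.
  assert (Tri : forall u, Cmod (u - v) <= e -> Cmod (u - z) <= r').
  { intros u Hu. replace (u - z)%C with ((u - v) + (v - z))%C by ring.
    eapply Rle_trans; [apply Cmod_triangle|]. unfold e in Hu. lra. }
  assert (HUv : forall u, Cmod (u - v) <= e -> U u).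
  { intros u Hu. apply (HK z); [exact Hz|]. generalize (Tri u Hu). lra. }
  rewrite <- (coef_0 U (Dx F) v e) by (auto; now apply holo_derive).
  rewrite (coef_derive U) by auto. simpl INR. rewrite Cmult_1_l.
  apply (coef_bound U); auto.
  - apply (C1_cont HF).
  - intros u Hu. apply (HM z); auto.
Qed.

Lemma holo_near_Dk (U K : C -> Prop) d F k : open U ->
  (forall z v, K z -> Cmod (v - z) < d -> U v) ->
  holo_near U K d F -> holo_near U K d (Dk F k).
Proof.
  intros HO HK HF. induction k as [|k IH]; [exact HF|]. now apply (holo_near_derive U K d (Dk F k)).
Qed.

(** Taylor expansions with centre [m h z], of step [h z], continue polynomial
    approximation along the rays issued from the origin. *)
Lemma appr_dilation (U K : C -> Prop) d Rm h : open U -> star_shaped K -> 0 < d -> 0 <= Rm ->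
  (forall z, K z -> Cmod z <= Rm) ->
  (forall z v, K z -> Cmod (v - z) < d -> U v) ->
  0 <= h -> h * Rm <= d / 4 ->
  forall m, INR m * h <= 1 -> forall F, holo_near U K d F ->
    appr K (fun z => F (RtoC (INR m * h) * z)%C).
Proof.
  intros HO HS Hd HR HKR HK Hh HhR. induction m as [|m IH]; intros Hm F HF.
  - apply (appr_ext K (fun _ => F 0%C)); [|apply appr_const].
    intros z _. f_equal. simpl. rewrite Rmult_0_l. ring.
  - assert (Hm' : INR m * h <= 1) by (rewrite S_INR in Hm; lra).
    assert (Pm : 0 <= INR m * h) by (apply Rmult_le_pos; [apply pos_INR|exact Hh]).
    apply appr_limit. intros eps He.
    destruct (proj2 HF (d / 2) ltac:(lra)) as [M HM].
    destruct (geometric_small (Rmax M 0) (1 / 2) eps ltac:(lra) He) as [n Hn].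
    specialize (Hn n (Nat.le_refl n)).
    exists (fun z => Csum (fun k => RtoC (/ INR (fact k)) * RtoC (h ^ k) * z ^ k *
                Dk F k (RtoC (INR m * h) * z))%C n). split.
    + apply appr_Csum. intros k.
      apply (appr_monomial K Rm (fun z => Dk F k (RtoC (INR m * h) * z)%C)); auto.
      apply IH; [exact Hm'|now apply holo_near_Dk].
    + intros z Hz.
      set (w := (RtoC (INR m * h) * z)%C). set (zeta := (RtoC h * z)%C).
      assert (Kw : K w) by (apply HS; [exact Hz|lra]).
      assert (Hzeta : Cmod zeta <= d / 4).
      { unfold zeta. rewrite Cmod_scal by exact Hh. generalize (HKR z Hz). nra. }
      assert (HUw : forall v, Cmod (v - w) <= d / 2 -> U v)
        by (intros v Hv; apply (HK w); [exact Kw|lra]).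
      assert (T := Taylor_bound U F w zeta (d / 2) (Rmax M 0) n HO (proj1 HF) ltac:(lra) HUw
        ltac:(intros v Hv; eapply Rle_trans; [now apply (HM w)|apply Rmax_l]) ltac:(lra)).
      replace (RtoC (INR (S m) * h) * z)%C with (w + zeta)%C
        by (unfold w, zeta; rewrite S_INR, Rmult_plus_distr_r, RtoC_plus, Rmult_1_l; ring).
      rewrite (Csum_ext _ (fun k => coef F w (d / 2) k * zeta ^ k)%C).
      * eapply Rle_lt_trans; [exact T|]. eapply Rle_lt_trans; [|exact Hn].
        assert (P : 0 <= Cmod zeta / (d / 2) <= 1 / 2).
        { split; [apply Rdiv_le_0_compat; [apply Cmod_ge_0|lra]|].
          apply Rmult_le_reg_r with (d / 2); [lra|]. unfold Rdiv at 1. rewrite Rmult_assoc, Rinv_l; lra. }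
        assert (P0 : 0 <= Rmax M 0) by apply Rmax_r.
        apply Rmult_le_compat.
        -- apply Rmult_le_pos; [exact P0|now apply pow_le].
        -- left; apply Rinv_0_lt_compat; lra.
        -- apply Rmult_le_compat_l; [exact P0|]. now apply pow_incr.
        -- apply Rinv_le_contravar; lra.
      * intros k. rewrite <- (coef_Dk U F w (d / 2) k) by (auto; try lra; apply HF).
        unfold zeta. rewrite Cpow_mult_l, RtoC_pow, RtoC_inv by apply INR_fact_neq_0.
        field. intros E0. apply RtoC_inj in E0. revert E0. apply INR_fact_neq_0.
Qed.

(** The union of the segments from the origin to the points of [K]. *)
Definition star_hull (K : C -> Prop) (w : C) : Prop :=
  exists z s, K z /\ 0 <= s <= 1 /\ w = (RtoC s * z)%C.

Lemma star_hull_star K : star_shaped (star_hull K).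
Proof.
  intros w s [z [s' [Hz [Hs' Hw]]]] Hs. exists z, (s * s'). split; [exact Hz|]. split; [nra|].
  subst w. rewrite RtoC_mult. ring.
Qed.

Lemma star_hull_sub (K U : C -> Prop) : star_shaped U -> (forall z, K z -> U z) ->
  forall w, star_hull K w -> U w.
Proof. intros HS HK w [z [s [Hz [Hs Hw]]]]. subst w. apply HS; auto. Qed.

Lemma star_hull_incl (K : C -> Prop) z : K z -> star_hull K z.
Proof. intros Hz. exists z, 1. split; [exact Hz|]. split; [lra|]. ring. Qed.

(** A neighbourhood of the star hull of a compact set on which [u] is bounded. *)
Lemma hull_bound (U K : C -> Prop) (u : C -> C) : open U -> star_shaped U ->
  (forall z, U z -> continuous u z) -> compactC K -> (forall z, K z -> U z) ->
  exists d M, 0 < d /\ forall z v, star_hull K z -> Cmod (v - z) < d -> U v /\ Cmod (u v) <= M.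
Proof.
  intros HO HS Cu HK HKU.
  (* An index [(z, (d, M))] stands for the bound [M] in the [d]-neighbourhood of
     the segment from the origin to [z]. *)
  set (good := fun i : C * (R * R) => 0 < fst (snd i) /\ forall s w, 0 <= s <= 1 ->
    Cmod (w - RtoC s * fst i) < fst (snd i) -> U w /\ Cmod (u w) <= snd (snd i)).
  destruct (HK (C * (R * R))%type (fun i w => good i /\ Cmod (w - fst i) < fst (snd i) / 2)) as [l Hl].
  - intros i w [Hg Hw]. assert (L := open_disc (fst i) (fst (snd i) / 2) w Hw).
    revert L. apply filter_imp. intros v Hv. now split.
  - intros z Hz. destruct (local_bound U u z HO HS Cu (HKU z Hz)) as [d [M [Hd [HM HB]]]].
    exists (z, (d, M)). split; [now split|]. simpl.
    replace (z - z)%C with (RtoC 0) by ring. rewrite Cmod_0. lra.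
  - assert (L : exists d M, 0 < d /\ forall i, In i l -> good i ->
        d <= fst (snd i) / 2 /\ snd (snd i) <= M).
    { clear Hl. induction l as [|i l IH]; [exists 1, 0; split; [lra|intros i []]|].
      destruct IH as [d [M [Hd H]]].
      exists (if Rlt_dec 0 (fst (snd i)) then Rmin d (fst (snd i) / 2) else d), (Rmax M (snd (snd i))).
      split.
      - destruct Rlt_dec; [apply Rmin_glb_lt; lra|exact Hd].
      - intros j [Hj|Hj] Hg.
        + subst j. destruct Rlt_dec as [H0|H0]; [|exfalso; apply H0, Hg].
          split; [apply Rmin_r|apply Rmax_r].
        + destruct (H j Hj Hg) as [H1 H2]. split.
          * destruct Rlt_dec; [|exact H1]. eapply Rle_trans; [apply Rmin_l|exact H1].
          * eapply Rle_trans; [exact H2|apply Rmax_l]. }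
    destruct L as [d [M [Hd L]]]. exists d, M. split; [exact Hd|].
    intros w v [z [s [Hz [Hs Hw]]]] Hv. subst w.
    destruct (Hl z Hz) as [i [Hi [Hg Hzi]]]. destruct (L i Hi Hg) as [L1 L2].
    assert (X : Cmod (v - RtoC s * fst i) < fst (snd i)).
    { replace (v - RtoC s * fst i)%C with ((v - RtoC s * z) + RtoC s * (z - fst i))%C by ring.
      eapply Rle_lt_trans; [apply Cmod_triangle|]. rewrite Cmod_scal by lra.
      generalize (Cmod_ge_0 (z - fst i)). nra. }
    destruct (proj2 Hg s v Hs X) as [X1 X2]. split; [exact X1|lra].
Qed.

(** Runge's theorem in a star-shaped domain. *)
Lemma Runge_star (U K : C -> Prop) (F : C -> C) (Rm : R) : open U -> star_shaped U ->
  (forall z, U z -> Cmod z <= Rm) -> 0 < Rm -> holo U F -> compactC K -> (forall z, K z -> U z) ->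
  appr (star_hull K) F.
Proof.
  intros HO HS HR HRp HF HK HKU.
  destruct (hull_bound U K F HO HS (C1_cont HF) HK HKU) as [d [M [Hd HB]]].
  destruct (archimed_cor1 (d / (4 * Rm)) ltac:(apply Rdiv_lt_0_compat; lra)) as [m [Hm1 Hm2]].
  assert (Pm : 0 < INR m) by now apply lt_0_INR.
  assert (A := appr_dilation U (star_hull K) d Rm (/ INR m) HO (star_hull_star K) Hd ltac:(lra)
    ltac:(intros z Hz; apply HR; now apply (star_hull_sub K U))
    ltac:(intros z v Hz Hv; now apply (HB z)) ltac:(left; now apply Rinv_0_lt_compat)
    ltac:(replace (d / 4) with (d / (4 * Rm) * Rm) by (field; lra);
          apply Rmult_le_compat_r; lra) m ltac:(rewrite Rinv_r; lra) F).
  apply (appr_ext _ (fun z => F (RtoC (INR m * / INR m) * z)%C)).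
  - intros z _. f_equal. rewrite Rinv_r by lra. ring.
  - apply A. split; [exact HF|]. intros r Hr. exists M. intros z v Hz Hv. apply (HB z); auto. lra.
Qed.

(** * Functions of class C^1 on an open set *)

Lemma within_continuous (D U : C -> Prop) (F : C -> C) z : open U -> (forall w, U w -> D w) ->
  continuous_on D F -> U z -> continuous F z.
Proof.
  intros HO HD HF Hz. apply (continuous_continuous_on D); [|exact HF].
  apply (filter_imp U); [exact HD|now apply HO].
Qed.

Lemma closure_incl (U : C -> Prop) z : U z -> closure U z.
Proof.
  intros Hz eps He. exists z. split; [exact Hz|].
  replace (z - z)%C with (RtoC 0) by ring. now rewrite Cmod_0.
Qed.

Lemma extends_continuous (U : C -> Prop) F z : open U -> extends_to_closure U F -> U z -> continuous F z.
Proof.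
  intros HO [Fe [H1 H2]] Hz. apply (continuous_ext_C Fe).
  - apply (filter_imp U); [exact H2|now apply HO].
  - apply (within_continuous (closure U) U); auto. apply closure_incl.
Qed.

Lemma Ck1_C1on (U : C -> Prop) F : open U -> Ck 1 U F -> C1on U F (Dx F) (Dy F).
Proof.
  intros HO [H0 [H1 [[H2 _] [H3 _]]]]. split.
  - intros z Hz. now apply (within_continuous U U).
  - intros z Hz. now apply (within_continuous U U).
  - intros z Hz. now apply (within_continuous U U).
  - intros z Hz. apply CDerive_CD, (H1 z Hz).
  - intros z Hz. apply CDerive_CD, (H1 z Hz).
Qed.

Lemma C1on_Dx (U : C -> Prop) F Fx Fy z : C1on U F Fx Fy -> U z -> Dx F z = Fx z.
Proof. intros H Hz. apply CD_CDerive, (C1_derx H z Hz). Qed.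

Lemma C1on_Dy (U : C -> Prop) F Fx Fy z : C1on U F Fx Fy -> U z -> Dy F z = Fy z.
Proof. intros H Hz. apply CD_CDerive, (C1_dery H z Hz). Qed.

Lemma C1on_Ck1 (U : C -> Prop) F Fx Fy : open U -> C1on U F Fx Fy -> Ck 1 U F.
Proof.
  intros HO H.
  assert (L : forall G : C -> C, (forall z, U z -> continuous G z) -> continuous_on U G).
  { intros G HG. now apply continuous_on_forall. }
  split; [apply L, H|]. split; [|split; (split; [apply L|exact I])].
  - intros z Hz. split; [apply (CD_CDerive _ _ _ (C1_derx H z Hz))|
                         apply (CD_CDerive _ _ _ (C1_dery H z Hz))].
  - intros z Hz. apply (continuous_ext_C Fx); [|now apply (C1_contx H)].
    apply (filter_imp U); [|now apply HO]. intros w Hw. symmetry. now apply (C1on_Dx U F Fx Fy).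
  - intros z Hz. apply (continuous_ext_C Fy); [|now apply (C1_conty H)].
    apply (filter_imp U); [|now apply HO]. intros w Hw. symmetry. now apply (C1on_Dy U F Fx Fy).
Qed.

Lemma C1on_plus U h hx hy k kx ky : C1on U h hx hy -> C1on U k kx ky ->
  C1on U (fun z => h z + k z)%C (fun z => hx z + kx z)%C (fun z => hy z + ky z)%C.
Proof.
  intros [a b c d e] [a' b' c' d' e']. split; intros z Hz.
  - apply continuous_Cplus; auto.
  - apply continuous_Cplus; auto.
  - apply continuous_Cplus; auto.
  - apply CD_plus; auto.
  - apply CD_plus; auto.
Qed.

(** * Transmutation operators *)

(** [G] is represented on the closed rectangle by the extended kernel [g]. *)
Definition agrees (rho : R) (G g : C -> C) : Prop :=
  forall r t, 0 <= r <= rho -> 0 <= t <= 1 -> G (r, t) = g (r, t).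

(** Only the values of the kernel on the closed rectangle matter. *)
Lemma transmute_V rho G g h z : agrees rho G g -> Cmod z <= rho ->
  transmute G h z = (h z + V g h z)%C.
Proof.
  intros H Hz. unfold transmute, V. f_equal. apply CInt_ext; [lra|]. intros s Hs.
  assert (P := sq_unit s ltac:(lra)).
  rewrite H; [reflexivity|split; [apply Cmod_ge_0|exact Hz]|lra].
Qed.

Lemma transmute_ext G h1 h2 z :
  (forall s, 0 <= s <= 1 -> h1 (RtoC s * z)%C = h2 (RtoC s * z)%C) ->
  transmute G h1 z = transmute G h2 z.
Proof.
  intros H. unfold transmute. f_equal.
  - assert (H1 := H 1 ltac:(lra)). now rewrite Cmult_1_l in H1.
  - exact (V_ext G h1 h2 z H).
Qed.

Lemma transmute_comb rho A G g gr (N : C -> Prop) (c d : C) h1 h2 z :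
  radial_kernel rho A g gr -> agrees rho G g -> star_shaped N ->
  (forall w, N w -> Cmod w <= rho) ->
  (forall w, N w -> continuous h1 w) -> (forall w, N w -> continuous h2 w) -> N z ->
  transmute G (fun w => c * h1 w + d * h2 w)%C z
  = (c * transmute G h1 z + d * transmute G h2 z)%C.
Proof.
  intros K HG HS HN C1' C2 Hz. assert (Cg := rk_c K).
  rewrite !(transmute_V rho G g) by auto. rewrite (V_plus g N) by (auto; cont).
  rewrite !(V_scal g N) by auto. ring.
Qed.

Lemma transmute_bound rho A G g gr (N : C -> Prop) h c z :
  radial_kernel rho A g gr -> agrees rho G g -> star_shaped N ->
  (forall w, N w -> Cmod w <= rho) -> (forall w, N w -> continuous h w) ->
  0 <= c -> (forall w, N w -> Cmod (h w) <= c) -> N z ->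
  Cmod (transmute G h z) <= c * (1 + A * rho).
Proof.
  intros K HG HS HN Ch Hc Hh Hz. assert (HA := rk_pos K).
  rewrite (transmute_V rho G g) by auto.
  assert (B1' := V_bound rho A g gr N h c 0 K HS Ch Hc
    ltac:(intros w Hw; simpl; rewrite Rmult_1_r; auto) z Hz).
  replace (A * c / INR 1 * Cmod z ^ 1) with (c * (A * Cmod z)) in B1' by (simpl; field).
  eapply Rle_trans; [apply Cmod_triangle|]. assert (B2 := Hh z Hz). assert (B3 := HN z Hz).
  assert (c * (A * Cmod z) <= c * (A * rho)) by (apply Rmult_le_compat_l; nra). lra.
Qed.

Lemma transmute_C1 U rho A G g gr h hx hy :
  open U -> star_shaped U -> (forall z, U z -> Cmod z < rho) ->
  radial_kernel rho A g gr -> agrees rho G g -> C1on U h hx hy ->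
  C1on U (transmute G h) (fun z => hx z + Vd g gr Re h hx z)%C
    (fun z => hy z + Vd g gr Im h hy z)%C.
Proof.
  intros HO HS Hr K HG H.
  apply (C1on_ext U (fun z => h z + V g h z)%C); [exact HO| |].
  - apply C1on_plus; [exact H|now apply (V_C1 U rho A)].
  - intros z Hz. symmetry. apply (transmute_V rho); [exact HG|left; auto].
Qed.

Lemma transmute_angular U rho A G g gr h hx hy :
  star_shaped U -> (forall z, U z -> Cmod z < rho) ->
  radial_kernel rho A g gr -> agrees rho G g -> C1on U h hx hy ->
  forall z, U z ->
    angular (fun w => hx w + Vd g gr Re h hx w)%C (fun w => hy w + Vd g gr Im h hy w)%C z
    = transmute G (angular hx hy) z.
Proof.
  intros HS Hr K HG H z Hz. rewrite (transmute_V rho G g) by (auto; left; auto).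
  now apply (V_angular U rho A).
Qed.

Lemma transmute_injective U rho A G g gr h :
  open U -> star_shaped U -> (forall z, U z -> Cmod z < rho) ->
  radial_kernel rho A g gr -> agrees rho G g -> (forall w, U w -> continuous h w) ->
  (forall z, U z -> transmute G h z = RtoC 0) -> forall z, U z -> h z = RtoC 0.
Proof.
  intros HO HS Hr K HG Ch H. apply (V_injective rho A g gr); auto.
  intros z Hz. rewrite <- (transmute_V rho G) by (auto; left; auto). auto.
Qed.

(** [T_G] maps the functions of class C^1 onto the functions of class C^1. *)
Lemma transmute_inverse U rho A G g gr u ux uy :
  open U -> star_shaped U -> (forall z, U z -> Cmod z < rho) ->
  radial_kernel rho A g gr -> agrees rho G g -> C1on U u ux uy ->
  exists h hx hy, C1on U h hx hy /\ forall z, U z -> transmute G h z = u z.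
Proof.
  intros HO HS Hr K HG Hu.
  destruct (V_inverse U rho A g gr u ux uy HO HS Hr K Hu) as [h [hx [hy [H E1]]]].
  exists h, hx, hy. split; [exact H|]. intros z Hz.
  rewrite (transmute_V rho G g) by (auto; left; auto). auto.
Qed.

Lemma transmute_at_0 rho A G g gr h : 0 <= rho -> radial_kernel rho A g gr -> agrees rho G g ->
  transmute G h (RtoC 0) = h (RtoC 0).
Proof.
  intros H0 K HG. rewrite (transmute_V rho G g) by (auto; now rewrite Cmod_0).
  replace (V g h (RtoC 0)) with (RtoC 0); [ring|].
  unfold V. rewrite (CInt_ext _ (fun _ => RtoC 0)); [rewrite CInt_const; eqC; ring|lra|].
  intros s Hs. rewrite Cmod_0.
  replace (g (0, (1 - s ^ 2)%R)) with (RtoC 0); [ring|].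
  symmetry. apply Cmod_eq_0. apply Rle_antisym; [|apply Cmod_ge_0].
  eapply Rle_trans; [apply (rk_b K); lra|]. lra.
Qed.

(** * The setting *)

(** What is used below about the domain, about [f] (with [s_a = f' / f]), and about
    the two kernels: the extended kernels [s_gf], [s_gi] with their derivatives in
    [r], constants bounding them, and the intertwining relations. *)
Record setting (Omega : C -> Prop) (rho : R) (f : R -> C) (Gf Gi : C -> C) : Type := {
  s_a : R -> C;
  s_gf : C -> C; s_gfr : C -> C; s_gi : C -> C; s_gir : C -> C;
  s_Af : R; s_Ai : R;
  s_open : open Omega;
  s_star : star_shaped Omega;
  s_0 : Omega (RtoC 0);
  s_rho : forall z, Omega z -> Cmod z < rho;
  s_Gf : agrees rho Gf s_gf;
  s_Gi : agrees rho Gi s_gi;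
  s_kf : radial_kernel rho s_Af s_gf s_gfr;
  s_ki : radial_kernel rho s_Ai s_gi s_gir;
  s_euler_f : forall phi px py, C1on Omega phi px py -> forall z, Omega z -> Cmod z <> 0 ->
    (euler (fun w => px w + Vd s_gf s_gfr Re phi px w)
           (fun w => py w + Vd s_gf s_gfr Im phi py w) z
     = RtoC (Cmod z) * s_a (Cmod z) * transmute Gf phi z + transmute Gi (euler px py) z)%C;
  s_euler_i : forall phi px py, C1on Omega phi px py -> forall z, Omega z -> Cmod z <> 0 ->
    (euler (fun w => px w + Vd s_gi s_gir Re phi px w)
           (fun w => py w + Vd s_gi s_gir Im phi py w) z
     = - (RtoC (Cmod z) * s_a (Cmod z)) * transmute Gi phi z + transmute Gf (euler px py) z)%C;
  s_f0 : forall z, Omega z -> radial f z <> RtoC 0;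
  s_fc : forall z, Omega z -> continuous (radial f) z;
  s_fxc : forall z, Omega z -> continuous (Dx (radial f)) z;
  s_fyc : forall z, Omega z -> continuous (Dy (radial f)) z;
  s_fx : forall z, Omega z -> Cmod z <> 0 ->
    Dx (radial f) z = (RtoC (Re z / Cmod z) * (s_a (Cmod z) * radial f z))%C;
  s_fy : forall z, Omega z -> Cmod z <> 0 ->
    Dy (radial f) z = (RtoC (Im z / Cmod z) * (s_a (Cmod z) * radial f z))%C
}.

Arguments s_a {Omega rho f Gf Gi}.
Arguments s_gf {Omega rho f Gf Gi}.
Arguments s_gfr {Omega rho f Gf Gi}.
Arguments s_gi {Omega rho f Gf Gi}.
Arguments s_gir {Omega rho f Gf Gi}.
Arguments s_Af {Omega rho f Gf Gi}.
Arguments s_Ai {Omega rho f Gf Gi}.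
Arguments s_open {Omega rho f Gf Gi}.
Arguments s_star {Omega rho f Gf Gi}.
Arguments s_0 {Omega rho f Gf Gi}.
Arguments s_rho {Omega rho f Gf Gi}.
Arguments s_Gf {Omega rho f Gf Gi}.
Arguments s_Gi {Omega rho f Gf Gi}.
Arguments s_kf {Omega rho f Gf Gi}.
Arguments s_ki {Omega rho f Gf Gi}.
Arguments s_euler_f {Omega rho f Gf Gi}.
Arguments s_euler_i {Omega rho f Gf Gi}.
Arguments s_f0 {Omega rho f Gf Gi}.
Arguments s_fc {Omega rho f Gf Gi}.
Arguments s_fxc {Omega rho f Gf Gi}.
Arguments s_fyc {Omega rho f Gf Gi}.
Arguments s_fx {Omega rho f Gf Gi}.
Arguments s_fy {Omega rho f Gf Gi}.

(** A point of modulus [rho] could be pushed outwards within an open set. *)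
Lemma sup_modulus_strict (Omega : C -> Prop) rho : open Omega -> Omega (RtoC 0) ->
  is_sup_modulus Omega rho -> 0 < rho /\ forall z, Omega z -> Cmod z < rho.
Proof.
  intros HO H0 [Hub _].
  assert (U : forall z, Omega z -> Cmod z <= rho) by (intros z Hz; apply Hub; now exists z).
  assert (Hp : 0 < rho).
  { destruct (proj1 (locally_disc _ _) (HO _ H0)) as [d [Hd H]].
    assert (K : Omega (RtoC (d / 2))).
    { apply H. rewrite <- RtoC_minus, Cmod_R, Rminus_0_r, Rabs_pos_eq; lra. }
    apply U in K. rewrite Cmod_R, Rabs_pos_eq in K; lra. }
  split; [exact Hp|]. intros z Hz. destruct (Rle_lt_or_eq_dec _ _ (U z Hz)) as [L|L]; [exact L|].
  exfalso. destruct (proj1 (locally_disc _ _) (HO _ Hz)) as [d [Hd H]].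
  set (e := d / (2 * rho)).
  assert (He : 0 < e) by (unfold e; apply Rdiv_lt_0_compat; lra).
  assert (K : Omega (RtoC (1 + e) * z)%C).
  { apply H. replace (RtoC (1 + e) * z - z)%C with (RtoC e * z)%C by (rewrite RtoC_plus; ring).
    rewrite Cmod_scal, L by lra. unfold e. replace (d / (2 * rho) * rho) with (d / 2) by (field; lra). lra. }
  apply U in K. rewrite Cmod_scal in K by lra. nra.
Qed.

(** The functions [f'], [f], [qf] are first extended continuously to the line. *)
Lemma setting_exists (Omega : C -> Prop) (rho : R) (qf f : R -> C) (Gf Gi : R * R -> C) :
  star_shaped_bounded_domain Omega -> is_sup_modulus Omega rho ->
  generating_function Omega rho qf f -> is_kernel rho qf Gf -> is_kernel rho (q_inv qf f) Gi ->
  inhabited (setting Omega rho f Gf Gi).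
Proof.
  intros [HO [_ [H0 HS]]] Hrho [Hq [Hf [Nf [ODE [_ [_ HfC]]]]]] HGf HGi.
  destruct (sup_modulus_strict Omega rho HO H0 Hrho) as [Pr Hlt].
  destruct Hf as [Cf [_ [Df1 [Xf1 [Df2 _]]]]].
  destruct (extends_segment 0 rho (CDerive f) ltac:(lra) Xf1) as [f1 [Cf1 Ef1]].
  set (fc := fun r => f (clamp 0 rho r)).
  assert (Cfc : forall r, continuous fc r).
  { intros r. apply (continuous_on_comp (fun r => 0 <= r <= rho) (clamp 0 rho) f); auto.
    - intros y; apply clamp_in; lra.
    - cont. }
  assert (Nfc : forall r, fc r <> 0%C) by (intros r; apply Nf, clamp_in; lra).
  set (q := fun r => qf (clamp 0 rho r)).
  assert (Cq : forall r, continuous q r).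
  { intros r. apply (continuous_on_comp (fun r => 0 <= r <= rho) (clamp 0 rho) qf).
    - intros y; apply clamp_in; lra.
    - apply continuous_clamp.
    - apply Hq. }
  set (a := fun r => (f1 r / fc r)%C).
  assert (Ca : forall r, continuous a r).
  { intros r. apply continuous_Cmult; [apply Cf1|]. now apply continuous_Cinv. }
  set (qi := fun r => (RtoC 2 * a r * a r - q r)%C).
  assert (Cqi : forall r, continuous qi r).
  { intros r. apply continuous_Cminus; [|apply Cq].
    apply continuous_Cmult; [|apply Ca]. apply continuous_Cmult; [cont|apply Ca]. }
  assert (Ea : forall r, 0 < r < rho -> a r = (CDerive f r / f r)%C).
  { intros r Hr. unfold a, fc. rewrite Ef1, clamp_id by lra. reflexivity. }
  assert (Nr : forall r, 0 < r < rho -> f r <> 0%C) by (intros r Hr; apply Nf; lra).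
  assert (Da : forall r, 0 < r < rho -> CD a r (q r - a r * RtoC (/ r) - a r * a r)%C).
  { intros r Hr.
    assert (D1 := CD_mult _ _ _ _ _ (CDerive_CD _ _ (Df2 r Hr))
      (CD_inv f r _ (CDerive_CD _ _ (Df1 r Hr)) (Nr r Hr))).
    apply (CD_ext_loc (fun t => CDerive f t * / f t)%C).
    - apply locally_R. exists (Rmin r (rho - r)). split; [apply Rmin_glb_lt; lra|].
      intros y Hy. assert (A1 := Rmin_l r (rho - r)). assert (A2 := Rmin_r r (rho - r)).
      apply Rabs_lt_between in Hy. rewrite Ea by lra. reflexivity.
    - refine (CD_eq _ _ _ _ D1 _).
      assert (O := ODE r Hr). rewrite Ea by exact Hr. unfold q. rewrite clamp_id by lra.
      replace (1 / r) with (/ r) in O by (field; lra).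
      set (f2 := CDerive (CDerive f) r) in *.
      assert (F2 : f2 = (qf r * f r - RtoC (/ r) * CDerive f r)%C).
      { apply Ceq_sub. rewrite <- O. ring. }
      rewrite F2. field. now apply Nr. }
  assert (Eqi : forall r, 0 < r < rho -> qi r = (RtoC 2 * a r * a r - q r)%C) by reflexivity.
  destruct (is_kernel_data rho qf q Gf Pr ltac:(intros r Hr; unfold q; rewrite clamp_id by lra; reflexivity) HGf)
    as [g [gr [gt [grr [grt [K EK]]]]]].
  destruct (is_kernel_data rho (q_inv qf f) qi Gi Pr
     ltac:(intros r Hr; unfold qi, q, q_inv; rewrite Ea, clamp_id by lra; reflexivity) HGi)
    as [h [hr [ht [hrr [hrt [L EL]]]]]].
  destruct (kernel_data_radial rho q g gr gt grr grt Pr Cq K) as [A1 RK].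
  destruct (kernel_data_radial rho qi h hr ht hrr hrt Pr Cqi L) as [A2 RL].
  assert (FO := first_order_system rho q qi a g gr gt grr grt h hr ht hrr hrt Pr Cq Cqi Ca Da Eqi K L).
  set (gf := fun p => g (clamp2 rho p)) in *. set (gfr := fun p => gr (clamp2 rho p)) in *.
  set (gi := fun p => h (clamp2 rho p)) in *. set (gir := fun p => hr (clamp2 rho p)) in *.
  assert (Af : agrees rho Gf gf)
    by (intros r t Hr Ht; unfold gf; rewrite clamp2_id by lra; now apply EK).
  assert (Ai : agrees rho Gi gi)
    by (intros r t Hr Ht; unfold gi; rewrite clamp2_id by lra; now apply EL).
  assert (CT : forall k kr kt krr krt Q, kernel_data rho Q k kr kt krr krt ->
     forall r t, 0 < r < rho -> 0 < t < 1 -> CD (fun s => k (clamp2 rho (r, s))) t (kt (r, t))).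
  { intros k kr kt krr krt Q KK r t Hr Ht. apply (CD_ext_loc (fun s => k (r, s))).
    - apply locally_R. exists (Rmin t (1 - t)). split; [apply Rmin_glb_lt; lra|].
      intros y Hy. assert (B1' := Rmin_l t (1 - t)). assert (B2 := Rmin_r t (1 - t)).
      apply Rabs_lt_between in Hy. rewrite clamp2_id by lra. reflexivity.
    - apply (kd_t KK). now split. }
  destruct HfC as [HfC [_ [Ex [Px Py]]]].
  assert (FD : forall r, 0 < r < rho -> CD f r (a r * f r)%C).
  { intros r Hr. refine (CD_eq _ _ _ _ (CDerive_CD _ _ (Df1 r Hr)) _). rewrite Ea by exact Hr.
    field. now apply Nr. }
  assert (TVf : forall u z, Omega z -> transmute Gf u z = (u z + V gf u z)%C)
    by (intros u z Hz; apply (transmute_V rho); [exact Af|left; now apply Hlt]).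
  assert (TVi : forall u z, Omega z -> transmute Gi u z = (u z + V gi u z)%C)
    by (intros u z Hz; apply (transmute_V rho); [exact Ai|left; now apply Hlt]).
  constructor. apply (Build_setting Omega rho f Gf Gi a gf gfr gi gir A1 A2); auto.
  - intros phi px py H z Hz Nz. rewrite TVf, TVi by exact Hz.
    rewrite <- (V_euler Omega rho A1 A2 gf gfr gt gi gir ht a phi px py); auto.
    + ring.
    + exact (kd_ct K).
    + exact (kd_ct L).
    + exact (CT _ _ _ _ _ _ K).
    + exact (CT _ _ _ _ _ _ L).
    + intros r t Hr Ht. unfold gf, gfr, gi. rewrite !clamp2_id by lra. apply (FO r t ltac:(lra) Ht).
    + intros r Hr. unfold gf, gi. rewrite !clamp2_id by lra. apply (FO r 0 ltac:(lra) ltac:(lra)).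
  - intros phi px py H z Hz Nz. rewrite TVf, TVi by exact Hz.
    rewrite <- (V_euler Omega rho A2 A1 gi gir ht gf gfr gt (fun r => - a r)%C phi px py); auto.
    + ring.
    + exact (kd_ct L).
    + exact (kd_ct K).
    + exact (CT _ _ _ _ _ _ L).
    + exact (CT _ _ _ _ _ _ K).
    + intros r t Hr Ht. unfold gf, gi, gir. rewrite !clamp2_id by lra.
      destruct (FO r t ltac:(lra) Ht) as [_ [F2 _]]. rewrite F2. ring.
    + intros r Hr. unfold gf, gi. rewrite !clamp2_id by lra.
      destruct (FO r 0 ltac:(lra) ltac:(lra)) as [_ [_ F3]].
      replace (h (r, 0) - g (r, 0))%C with (- (g (r, 0) - h (r, 0)))%C by ring. rewrite F3. ring.
  - intros z Hz. apply Nf. split; [apply Cmod_ge_0|left; now apply Hlt].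
  - intros z Hz. apply (within_continuous (closure Omega) Omega); auto. apply closure_incl.
  - intros z Hz. apply (extends_continuous Omega); auto. apply Px.
  - intros z Hz. apply (extends_continuous Omega); auto. apply Py.
  - intros z Hz Nz. apply CD_CDerive. unfold radial. assert (P := Cmod_ge_0 z).
    apply (CD_comp f (fun x => Cmod (x, Im z))).
    + replace ((Re z, Im z) : C) with z by (now destruct z). apply FD. split; [lra|now apply Hlt].
    + now apply Cmod_derive_x.
  - intros z Hz Nz. apply CD_CDerive. unfold radial. assert (P := Cmod_ge_0 z).
    apply (CD_comp f (fun y => Cmod (Re z, y))).
    + replace ((Re z, Im z) : C) with z by (now destruct z). apply FD. split; [lra|now apply Hlt].
    + now apply Cmod_derive_y.
Qed.

(** * The Vekua equation in Cartesian and in polar form *)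

(** The Vekua equation for [u + j v] at [z], separated into its components; [ux],
    [uy], [vx], [vy] are the partial derivatives. *)
Definition Vekua_at (f : R -> C) (u v ux uy vx vy : C -> C) (z : C) : Prop :=
  (ux z - vy z = (Dx (radial f) z * u z + Dy (radial f) z * v z) / radial f z)%C /\
  (uy z + vx z = (Dy (radial f) z * u z - Dx (radial f) z * v z) / radial f z)%C.

Lemma Vekua_iff (Omega : C -> Prop) (f : R -> C) (W : C -> B) ux uy vx vy : open Omega ->
  (forall z, Omega z -> radial f z <> RtoC 0) ->
  C1on Omega (fun z => Sc (W z)) ux uy -> C1on Omega (fun z => Vec (W z)) vx vy ->
  (Vekua Omega f W <->
   forall z, Omega z -> Vekua_at f (fun z => Sc (W z)) (fun z => Vec (W z)) ux uy vx vy z).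
Proof.
  intros HO Nf Hu Hv.
  assert (Z : forall z, Dx (fun _ : C => RtoC 0) z = RtoC 0 /\ Dy (fun _ : C => RtoC 0) z = RtoC 0)
    by (intros z; split; apply CD_CDerive, CD_const).
  assert (Q : forall z, Omega z ->
    (dbar W z = Bmult (Bscal (/ radial f z)%C (dbar_complex (radial f) z)) (Bconj (W z)) <->
     Vekua_at f (fun z => Sc (W z)) (fun z => Vec (W z)) ux uy vx vy z)).
  { intros z Hz. specialize (Nf z Hz). destruct (Z z) as [Z1 Z2].
    assert (L : dbar W z = (RtoC (1 / 2) * (ux z - vy z), RtoC (1 / 2) * (uy z + vx z))%C).
    { unfold dbar. rewrite (C1on_Dx _ _ _ _ z Hu Hz), (C1on_Dx _ _ _ _ z Hv Hz),
        (C1on_Dy _ _ _ _ z Hu Hz), (C1on_Dy _ _ _ _ z Hv Hz).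
      unfold Bscal, Bplus, Bmult, Bj, Sc, Vec. cbn [fst snd]. f_equal; ring. }
    assert (Rr : Bmult (Bscal (/ radial f z)%C (dbar_complex (radial f) z)) (Bconj (W z)) =
      (RtoC (1 / 2) * ((Dx (radial f) z * Sc (W z) + Dy (radial f) z * Vec (W z)) / radial f z),
       RtoC (1 / 2) * ((Dy (radial f) z * Sc (W z) - Dx (radial f) z * Vec (W z)) / radial f z))%C).
    { unfold dbar_complex, dbar. unfold Bscal, Bplus, Bmult, Bconj, Bj, Sc, Vec. cbn [fst snd].
      change (Dx (fun w : C => radial f w) z) with (Dx (radial f) z).
      change (Dy (fun w : C => radial f w) z) with (Dy (radial f) z).
      rewrite Z1, Z2. f_equal; field; exact Nf. }
    assert (N2 : RtoC (1 / 2) <> 0%C) by (intros H; apply RtoC_inj in H; lra).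
    assert (Can : forall x y : C, (RtoC (1 / 2) * x)%C = (RtoC (1 / 2) * y)%C -> x = y).
    { intros x y H. replace x with (/ RtoC (1 / 2) * (RtoC (1 / 2) * x))%C by (field; exact N2).
      rewrite H. field; exact N2. }
    rewrite L, Rr. split.
    - intros H. injection H. intros H1 H2 H3 H4. split; apply Can; apply Ceq; assumption.
    - intros [H1 H2]. now rewrite H1, H2. }
  split.
  - intros [_ [_ H]] z Hz. apply Q; auto.
  - intros H. split; [|split].
    + now apply (C1on_Ck1 Omega _ ux uy).
    + now apply (C1on_Ck1 Omega _ vx vy).
    + intros z Hz. apply Q; auto.
Qed.

(** Rotation by the argument of [x + i y], a real orthogonal matrix up to the
    factor [r]. *)
Lemma polar_iff (x y r a u v ux uy vx vy : C) : (x * x + y * y = r * r)%C -> r <> RtoC 0 ->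
  ((ux - vy = a * (x / r) * u + a * (y / r) * v)%C /\ (uy + vx = a * (y / r) * u - a * (x / r) * v)%C) <->
  ((x * ux + y * uy - (- y * vx + x * vy) = r * a * u)%C /\
   ((- y * ux + x * uy) + (x * vx + y * vy) = - (r * a * v))%C).
Proof.
  intros Hr Nr. split.
  - intros [H1 H2]. split.
    + transitivity (x * (ux - vy) + y * (uy + vx))%C; [ring|]. rewrite H1, H2.
      transitivity ((x * x + y * y) * a * u / r)%C; [field; exact Nr|]. rewrite Hr. field; exact Nr.
    + transitivity (- y * (ux - vy) + x * (uy + vx))%C; [ring|]. rewrite H1, H2.
      transitivity (- (x * x + y * y) * a * v / r)%C; [field; exact Nr|]. rewrite Hr. field; exact Nr.
  - intros [H1 H2]. split.
    + transitivity ((x * x + y * y) * (ux - vy) / (r * r))%C; [rewrite Hr; field; exact Nr|].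
      transitivity ((x * (x * ux + y * uy - (- y * vx + x * vy)) - y * ((- y * ux + x * uy) + (x * vx + y * vy))) / (r * r))%C;
        [field; exact Nr|]. rewrite H1, H2. field. exact Nr.
    + transitivity ((x * x + y * y) * (uy + vx) / (r * r))%C; [rewrite Hr; field; exact Nr|].
      transitivity ((y * (x * ux + y * uy - (- y * vx + x * vy)) + x * ((- y * ux + x * uy) + (x * vx + y * vy))) / (r * r))%C;
        [field; exact Nr|]. rewrite H1, H2. field. exact Nr.
Qed.

Lemma Cmod_sq (z : C) : (RtoC (Re z) * RtoC (Re z) + RtoC (Im z) * RtoC (Im z) = RtoC (Cmod z) * RtoC (Cmod z))%C.
Proof.
  rewrite <- !RtoC_mult, <- RtoC_plus. f_equal. unfold Cmod. rewrite sqrt_sqrt by nra.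
  unfold Re, Im; ring.
Qed.

Lemma Vekua_at_polar {Omega rho f Gf Gi} (st : setting Omega rho f Gf Gi) u v ux uy vx vy z :
  Omega z -> Cmod z <> 0 ->
  (Vekua_at f u v ux uy vx vy z <->
   (euler ux uy z - angular vx vy z = RtoC (Cmod z) * s_a st (Cmod z) * u z)%C /\
   (angular ux uy z + euler vx vy z = - (RtoC (Cmod z) * s_a st (Cmod z) * v z))%C).
Proof.
  intros Hz Nz.
  assert (Nf := s_f0 st z Hz).
  assert (Nr : RtoC (Cmod z) <> RtoC 0) by (intros H; now apply RtoC_inj in H).
  unfold Vekua_at. rewrite (s_fx st z Hz Nz), (s_fy st z Hz Nz). unfold euler, angular.
  rewrite <- (polar_iff (RtoC (Re z)) (RtoC (Im z)) (RtoC (Cmod z)) (s_a st (Cmod z)) (u z) (v z)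
    (ux z) (uy z) (vx z) (vy z) (Cmod_sq z) Nr).
  rewrite !RtoC_div by exact Nz.
  assert (Q : forall x y p q : C, (x = p -> y = q -> forall X Y : C, (X = x /\ Y = y <-> X = p /\ Y = q))%C)
    by (intros x y p q -> ->; tauto).
  apply Q; field; now split.
Qed.

(** Identities between continuous functions extend from the punctured domain. *)
Lemma punctured_eq (Omega : C -> Prop) (F G : C -> C) : open Omega -> Omega (RtoC 0) ->
  (forall z, Omega z -> continuous F z) -> (forall z, Omega z -> continuous G z) ->
  (forall z, Omega z -> Cmod z <> 0 -> F z = G z) ->
  forall z, Omega z -> F z = G z.
Proof.
  intros HO H0 CF CG H z Hz. destruct (Req_dec (Cmod z) 0) as [E0|E0]; [|now apply H].
  apply Cmod_eq_0 in E0. subst z.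
  apply Ceq_sub, Cmod_eq_0. apply Rle_antisym; [|apply Cmod_ge_0]. apply Rnot_lt_le. intros P.
  assert (L := proj1 (continuous_C_eps _ _) (continuous_Cminus F G (RtoC 0) (CF _ H0) (CG _ H0)) _ P).
  assert (L2 := filter_and _ _ L (HO _ H0)). apply locally_disc in L2.
  destruct L2 as [d [Hd L2]].
  destruct (L2 (RtoC (d / 2))) as [M1 M2].
  { rewrite <- RtoC_minus, Cmod_R, Rminus_0_r, Rabs_pos_eq; lra. }
  rewrite (H (RtoC (d / 2))) in M1; [|exact M2|rewrite Cmod_R, Rabs_pos_eq; lra].
  replace (G (RtoC (d / 2)) - G (RtoC (d / 2)) - (F 0 - G 0))%C with (- (F 0 - G 0))%C in M1 by ring.
  rewrite Cmod_opp in M1. lra.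
Qed.

(** * Solutions of the Vekua equation as transmutations *)

(** Pairs satisfying the Cauchy-Riemann equations are transmuted into solutions of
    the Vekua equation. *)
Lemma transmutation_Vekua {Omega rho f Gf Gi} (st : setting Omega rho f Gf Gi) phi px py psi qx qy :
  C1on Omega phi px py -> C1on Omega psi qx qy ->
  (forall z, Omega z -> px z = qy z) -> (forall z, Omega z -> py z = (- qx z)%C) ->
  Vekua Omega f (TB Gf Gi (fun w => (phi w, psi w))).
Proof.
  intros Hp Hq CR1 CR2.
  assert (HO := s_open st). assert (HS := s_star st). assert (Hr := s_rho st).
  assert (Tu := transmute_C1 _ _ _ _ _ _ _ _ _ HO HS Hr (s_kf st) (s_Gf st) Hp).
  assert (Tv := transmute_C1 _ _ _ _ _ _ _ _ _ HO HS Hr (s_ki st) (s_Gi st) Hq).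
  assert (X1 : forall z, Omega z -> transmute Gi (euler px py) z = transmute Gi (angular qx qy) z).
  { intros z Hz. apply transmute_ext. intros s Hs. unfold euler, angular.
    rewrite CR1, CR2 by (now apply HS). ring. }
  assert (X2 : forall z, Omega z -> transmute Gf (euler qx qy) z = (- transmute Gf (angular px py) z)%C).
  { intros z Hz.
    rewrite (transmute_ext Gf _ (fun w => RtoC (-1) * angular px py w + RtoC 0 * angular px py w)%C).
    - rewrite (transmute_comb rho _ Gf _ _ Omega _ _ _ _ z (s_kf st) (s_Gf st) HS);
        [ring|intros w Hw; left; auto|cont|cont|exact Hz].
    - intros s Hs. unfold euler, angular. rewrite CR1, CR2 by (now apply HS). ring. }
  set (u := transmute Gf phi) in *. set (v := transmute Gi psi) in *.
  set (ux := fun z => (px z + _)%C) in Tu. set (uy := fun z => (py z + _)%C) in Tu.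
  set (vx := fun z => (qx z + _)%C) in Tv. set (vy := fun z => (qy z + _)%C) in Tv.
  apply (Vekua_iff Omega f (fun z => (u z, v z)) ux uy vx vy HO (s_f0 st) Tu Tv).
  cbn [Sc Vec fst snd].
  assert (P : forall z, Omega z -> Cmod z <> 0 -> Vekua_at f u v ux uy vx vy z).
  { intros z Hz Nz. apply (Vekua_at_polar st); [exact Hz|exact Nz|].
    unfold ux, uy, vx, vy. rewrite (s_euler_f st _ _ _ Hp z Hz Nz), (s_euler_i st _ _ _ Hq z Hz Nz).
    rewrite (transmute_angular Omega rho _ Gf _ _ _ _ _ HS Hr (s_kf st) (s_Gf st) Hp z Hz).
    rewrite (transmute_angular Omega rho _ Gi _ _ _ _ _ HS Hr (s_ki st) (s_Gi st) Hq z Hz).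
    rewrite X1, X2 by exact Hz. fold u v. split; ring. }
  assert (Cf := s_fc st). assert (Cfx := s_fxc st). assert (Cfy := s_fyc st). assert (Nf := s_f0 st).
  destruct Tu as [Cu Cux Cuy _ _], Tv as [Cv Cvx Cvy _ _]. clearbody u v ux uy vx vy.
  intros z Hz. unfold Vekua_at. split.
  - apply (punctured_eq Omega (fun z => ux z - vy z)%C
      (fun z => (Dx (radial f) z * u z + Dy (radial f) z * v z) / radial f z)%C HO (s_0 st)); auto.
    + cont.
    + cont.
    + intros w Hw Nw. now apply P.
  - apply (punctured_eq Omega (fun z => uy z + vx z)%C
      (fun z => (Dy (radial f) z * u z - Dx (radial f) z * v z) / radial f z)%C HO (s_0 st)); auto.
    + cont.
    + cont.
    + intros w Hw Nw. now apply P.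
Qed.

(** Conversely, every solution of the Vekua equation is the transmutation of a pair
    satisfying the Cauchy-Riemann equations. *)
Lemma Vekua_preimage {Omega rho f Gf Gi} (st : setting Omega rho f Gf Gi) (W : C -> B) :
  Vekua Omega f W ->
  exists phi px py psi qx qy, C1on Omega phi px py /\ C1on Omega psi qx qy /\
    (forall z, Omega z -> px z = qy z) /\ (forall z, Omega z -> py z = (- qx z)%C) /\
    (forall z, Omega z -> W z = TB Gf Gi (fun w => (phi w, psi w)) z).
Proof.
  intros HW.
  assert (HO := s_open st). assert (HS := s_star st). assert (H0 := s_0 st). assert (Hr := s_rho st).
  assert (Hr' : forall z, Omega z -> Cmod z <= rho) by (intros z Hz; left; auto).
  assert (Pr : 0 <= rho) by (generalize (Hr' _ H0); rewrite Cmod_0; lra).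
  assert (Hu := Ck1_C1on _ _ HO (proj1 HW)). assert (Hv := Ck1_C1on _ _ HO (proj1 (proj2 HW))).
  destruct (transmute_inverse _ _ _ _ _ _ _ _ _ HO HS Hr (s_kf st) (s_Gf st) Hu) as [phi [px [py [Hp EU]]]].
  destruct (transmute_inverse _ _ _ _ _ _ _ _ _ HO HS Hr (s_ki st) (s_Gi st) Hv) as [psi [qx [qy [Hq EV]]]].
  assert (Tu := C1on_ext _ _ (fun z => Sc (W z)) _ _ HO
    (transmute_C1 _ _ _ _ _ _ _ _ _ HO HS Hr (s_kf st) (s_Gf st) Hp) EU).
  assert (Tv := C1on_ext _ _ (fun z => Vec (W z)) _ _ HO
    (transmute_C1 _ _ _ _ _ _ _ _ _ HO HS Hr (s_ki st) (s_Gi st) Hq) EV).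
  assert (VA := proj1 (Vekua_iff Omega f W _ _ _ _ HO (s_f0 st) Tu Tv) HW).
  assert (P : forall z, Omega z -> Cmod z <> 0 ->
    (transmute Gi (euler px py) z - transmute Gi (angular qx qy) z = RtoC 0)%C /\
    (transmute Gf (angular px py) z + transmute Gf (euler qx qy) z = RtoC 0)%C).
  { intros z Hz Nz.
    destruct (proj1 (Vekua_at_polar st _ _ _ _ _ _ z Hz Nz) (VA z Hz)) as [P1 P2].
    rewrite (transmute_angular Omega rho _ Gi _ _ _ _ _ HS Hr (s_ki st) (s_Gi st) Hq z Hz),
      (s_euler_f st _ _ _ Hp z Hz Nz), EU in P1 by exact Hz.
    rewrite (transmute_angular Omega rho _ Gf _ _ _ _ _ HS Hr (s_kf st) (s_Gf st) Hp z Hz),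
      (s_euler_i st _ _ _ Hq z Hz Nz), EV in P2 by exact Hz.
    split; apply Ceq_sub.
    - match type of P1 with ?x = ?y => transitivity (x - y)%C; [ring|rewrite P1; ring] end.
    - match type of P2 with ?x = ?y => transitivity (x - y)%C; [ring|rewrite P2; ring] end. }
  clear VA Tu Tv Hu Hv.
  assert (E0 : euler px py 0 = RtoC 0 /\ angular px py 0 = RtoC 0 /\
               euler qx qy 0 = RtoC 0 /\ angular qx qy 0 = RtoC 0)
    by (unfold euler, angular; change (Re 0) with 0; change (Im 0) with 0; repeat split; ring).
  destruct E0 as [E1 [E2 [E3 E4]]].
  assert (Z1 : forall z, Omega z -> (RtoC 1 * euler px py z + RtoC (-1) * angular qx qy z)%C = RtoC 0).
  { apply (transmute_injective Omega rho _ Gi _ _ _ HO HS Hr (s_ki st) (s_Gi st)); [cont|].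
    intros z Hz. destruct (Req_dec (Cmod z) 0) as [Ez|Nz].
    - apply Cmod_eq_0 in Ez. subst z.
      rewrite (transmute_at_0 rho _ Gi _ _ _ Pr (s_ki st) (s_Gi st)), E1, E4. ring.
    - rewrite (transmute_comb rho _ Gi _ _ Omega _ _ _ _ z (s_ki st) (s_Gi st) HS Hr'); [|cont|cont|exact Hz].
      rewrite <- (proj1 (P z Hz Nz)). ring. }
  assert (Z2 : forall z, Omega z -> (RtoC 1 * angular px py z + RtoC 1 * euler qx qy z)%C = RtoC 0).
  { apply (transmute_injective Omega rho _ Gf _ _ _ HO HS Hr (s_kf st) (s_Gf st)); [cont|].
    intros z Hz. destruct (Req_dec (Cmod z) 0) as [Ez|Nz].
    - apply Cmod_eq_0 in Ez. subst z.
      rewrite (transmute_at_0 rho _ Gf _ _ _ Pr (s_kf st) (s_Gf st)), E2, E3. ring.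
    - rewrite (transmute_comb rho _ Gf _ _ Omega _ _ _ _ z (s_kf st) (s_Gf st) HS Hr'); [|cont|cont|exact Hz].
      rewrite <- (proj2 (P z Hz Nz)). ring. }
  assert (CRz : forall z, Omega z -> Cmod z <> 0 -> px z = qy z /\ py z = (- qx z)%C).
  { intros z Hz Nz.
    assert (Nr : RtoC (Cmod z) <> RtoC 0) by (intros H; now apply RtoC_inj in H).
    destruct (proj2 (polar_iff (RtoC (Re z)) (RtoC (Im z)) (RtoC (Cmod z)) 0 0 0
      (px z) (py z) (qx z) (qy z) (Cmod_sq z) Nr)) as [Q1 Q2].
    - split.
      + etransitivity; [|etransitivity; [exact (Z1 z Hz)|]]; unfold euler, angular; ring.
      + etransitivity; [|etransitivity; [exact (Z2 z Hz)|]]; unfold euler, angular; ring.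
    - split; apply Ceq_sub.
      + rewrite Q1. ring.
      + transitivity (py z + qx z)%C; [ring|]. rewrite Q2. ring. }
  exists phi, px, py, psi, qx, qy. split; [exact Hp|]. split; [exact Hq|].
  split; [|split].
  - apply (punctured_eq Omega px qy HO H0); [exact (C1_contx Hp)|exact (C1_conty Hq)|]. intros z Hz Nz. now apply CRz.
  - apply (punctured_eq Omega py (fun z => - qx z)%C HO H0); [cont|cont|].
    intros z Hz Nz. now apply CRz.
  - intros z Hz. unfold TB. cbn [Sc Vec fst snd]. rewrite (surjective_pairing (W z)).
    f_equal; symmetry; [now apply EU|now apply EV].
Qed.

(** * Bicomplex functions built from two complex ones *)

(** [F1 + i F2], when the complex values of [F1] and [F2] are read as elements
    [x + j y] of [B]. *)
Definition bic (F1 F2 : C -> C) (w : C) : B :=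
  ((Re (F1 w), Re (F2 w)), (Im (F1 w), Im (F2 w))).

(** The coefficient [a + i b], with the same reading of [a] and [b]. *)
Definition coef_B (a b : C) : B := ((Re a, Re b), (Im a, Im b)).

(** In this lemma and the next one [p] selects the real or the imaginary part. *)
Lemma CD_part (p : C -> R) (f g : R -> C) (x : R) (l m : C) : p = Re \/ p = Im ->
  CD f x l -> CD g x m -> CD (fun t => (p (f t), p (g t)) : C) x (p l, p m).
Proof.
  intros Hp H K. apply CD_iff in H; apply CD_iff in K. apply CD_iff.
  destruct Hp; subst p; split; solve [apply H|apply K].
Qed.

Lemma C1on_part (p : C -> R) U F Fx Fy G Gx Gy : p = Re \/ p = Im ->
  C1on U F Fx Fy -> C1on U G Gx Gy ->
  C1on U (fun z => (p (F z), p (G z)) : C) (fun z => (p (Fx z), p (Gx z)) : C)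
    (fun z => (p (Fy z), p (Gy z)) : C).
Proof.
  intros Hp [a b c d e] [a' b' c' d' e'].
  split; intros z Hz; try (apply CD_part; auto); destruct Hp; subst p; cont.
Qed.

Lemma C1on_eq_y U h hx hy hy' : open U -> (forall z, U z -> hy z = hy' z) ->
  C1on U h hx hy -> C1on U h hx hy'.
Proof.
  intros HO E [c1 c2 c3 c4 c5]. split; auto.
  - intros z Hz. apply (continuous_ext_C hy); [|now apply c3].
    apply (filter_imp U); [exact E|now apply HO].
  - intros z Hz. rewrite <- E by exact Hz. now apply c5.
Qed.

Lemma bic_Vekua {Omega rho f Gf Gi} (st : setting Omega rho f Gf Gi) F1 F2 :
  holo Omega F1 -> holo Omega F2 -> Vekua Omega f (TB Gf Gi (bic F1 F2)).
Proof.
  intros H1 H2.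
  apply (transmutation_Vekua st _ _ _ _ _ _
    (C1on_part Re _ _ _ _ _ _ _ (or_introl eq_refl) H1 H2)
    (C1on_part Im _ _ _ _ _ _ _ (or_intror eq_refl) H1 H2));
  intros z Hz; apply Ceq; unfold Re, Im, Ci; simpl; ring.
Qed.

(** The two holomorphic functions behind a solution of the Vekua equation. *)
Lemma Vekua_holomorphic_pair {Omega rho f Gf Gi} (st : setting Omega rho f Gf Gi) (W : C -> B) :
  Vekua Omega f W ->
  exists F1 F2, holo Omega F1 /\ holo Omega F2 /\
    forall z, Omega z -> W z = TB Gf Gi (bic F1 F2) z.
Proof.
  intros HW.
  destruct (Vekua_preimage st W HW) as [phi [px [py [psi [qx [qy [Hp [Hq [CR1 [CR2 E]]]]]]]]]].
  assert (HO := s_open st).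
  exists (fun z => (Re (phi z), Re (psi z))), (fun z => (Im (phi z), Im (psi z))).
  split; [|split].
  - apply (C1on_holo Omega _ (fun z => (Re (px z), Re (qx z)) : C)); [|exact HO].
    refine (C1on_eq_y _ _ _ _ _ HO _ (C1on_part Re _ _ _ _ _ _ _ (or_introl eq_refl) Hp Hq)).
    intros z Hz. rewrite CR2, <- CR1 by exact Hz. apply Ceq; unfold Re, Im; simpl; ring.
  - apply (C1on_holo Omega _ (fun z => (Im (px z), Im (qx z)) : C)); [|exact HO].
    refine (C1on_eq_y _ _ _ _ _ HO _ (C1on_part Im _ _ _ _ _ _ _ (or_intror eq_refl) Hp Hq)).
    intros z Hz. rewrite CR2, <- CR1 by exact Hz. apply Ceq; unfold Re, Im; simpl; ring.
  - intros z Hz. rewrite E by exact Hz. do 2 f_equal.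
    apply functional_extensionality. intros w. unfold bic. cbn [Re Im fst snd].
    f_equal; apply surjective_pairing.
Qed.

(** Continuity of the components of [bic F1 F2]. *)
Ltac cont_bic := unfold bic, Sc, Vec; cbn [fst snd]; cont.

Lemma Bnorm_le (W : B) : Bnorm W <= Cmod (Sc W) + Cmod (Vec W).
Proof.
  unfold Bnorm. assert (H1 := Cmod_ge_0 (Sc W)). assert (H2 := Cmod_ge_0 (Vec W)).
  rewrite <- (sqrt_pow2 (Cmod (Sc W) + Cmod (Vec W))) by lra. apply sqrt_le_1_alt. nra.
Qed.

Lemma Bnorm_ge (W : B) : Cmod (Sc W) <= Bnorm W /\ Cmod (Vec W) <= Bnorm W.
Proof.
  unfold Bnorm. assert (H1 := Cmod_ge_0 (Sc W)). assert (H2 := Cmod_ge_0 (Vec W)).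
  split; [rewrite <- (sqrt_pow2 (Cmod (Sc W))) at 1 by lra
         |rewrite <- (sqrt_pow2 (Cmod (Vec W))) at 1 by lra]; apply sqrt_le_1_alt; nra.
Qed.

(** The transmutation is bounded in the uniform norm on star-shaped sets. *)
Lemma TB_bound {Omega rho f Gf Gi} (st : setting Omega rho f Gf Gi) (N : C -> Prop) F1 F2 e z :
  star_shaped N -> (forall w, N w -> Omega w) ->
  (forall w, N w -> continuous F1 w) -> (forall w, N w -> continuous F2 w) -> 0 <= e ->
  (forall w, N w -> Cmod (F1 w) <= e) -> (forall w, N w -> Cmod (F2 w) <= e) -> N z ->
  Bnorm (TB Gf Gi (bic F1 F2) z) <= 2 * e * (2 + s_Af st * rho + s_Ai st * rho).
Proof.
  intros SN NO C1' C2 He B1' B2 Hz.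
  assert (Hr : forall w, N w -> Cmod w <= rho) by (intros w Hw; left; now apply (s_rho st), NO).
  assert (Q : forall (p : C -> R) w, p = Re \/ p = Im -> N w ->
    Cmod ((p (F1 w), p (F2 w)) : C) <= 2 * e).
  { intros p w Hp Hw. eapply Rle_trans; [apply Cmod_le_sum|].
    change (Rabs (p (F1 w)) + Rabs (p (F2 w)) <= 2 * e).
    generalize (B1' w Hw) (B2 w Hw) (Re_le (F1 w)) (Im_le (F1 w)) (Re_le (F2 w)) (Im_le (F2 w)).
    destruct Hp; subst p; lra. }
  replace (2 * e * (2 + s_Af st * rho + s_Ai st * rho))
    with (2 * e * (1 + s_Af st * rho) + 2 * e * (1 + s_Ai st * rho)) by ring.
  eapply Rle_trans; [apply Bnorm_le|]. apply Rplus_le_compat.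
  - apply (transmute_bound rho _ Gf _ _ N _ _ z (s_kf st) (s_Gf st) SN Hr); [cont_bic|lra| |exact Hz].
    intros w Hw. apply (Q Re w); auto.
  - apply (transmute_bound rho _ Gi _ _ N _ _ z (s_ki st) (s_Gi st) SN Hr); [cont_bic|lra| |exact Hz].
    intros w Hw. apply (Q Im w); auto.
Qed.

Lemma TB_add {Omega rho f Gf Gi} (st : setting Omega rho f Gf Gi) (N : C -> Prop) (c : R) F1 F2 H1 H2 z :
  star_shaped N -> (forall w, N w -> Omega w) ->
  (forall w, N w -> continuous F1 w) -> (forall w, N w -> continuous F2 w) ->
  (forall w, N w -> continuous H1 w) -> (forall w, N w -> continuous H2 w) -> N z ->
  TB Gf Gi (bic (fun w => F1 w + RtoC c * H1 w)%C (fun w => F2 w + RtoC c * H2 w)%C) z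
  = Bplus (TB Gf Gi (bic F1 F2) z) (Bscal (RtoC c) (TB Gf Gi (bic H1 H2) z)).
Proof.
  intros SN NO c1 c2 c3 c4 Hz.
  assert (Hr : forall w, N w -> Cmod w <= rho) by (intros w Hw; left; now apply (s_rho st), NO).
  unfold TB, Bplus, Bscal. cbn [Sc Vec fst snd]. f_equal.
  - rewrite <- (Cmult_1_l (transmute Gf (fun w => Sc (bic F1 F2 w)) z)).
    rewrite <- (transmute_comb rho _ Gf _ _ N _ _ _ _ z (s_kf st) (s_Gf st) SN Hr); [|cont_bic|cont_bic|exact Hz].
    apply transmute_ext. intros s _. apply Ceq; unfold bic, coef_B, Sc, Vec, Re, Im; simpl; ring.
  - rewrite <- (Cmult_1_l (transmute Gi (fun w => Vec (bic F1 F2 w)) z)).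
    rewrite <- (transmute_comb rho _ Gi _ _ N _ _ _ _ z (s_ki st) (s_Gi st) SN Hr); [|cont_bic|cont_bic|exact Hz].
    apply transmute_ext. intros s _. apply Ceq; unfold bic, coef_B, Sc, Vec, Re, Im; simpl; ring.
Qed.

(** * Formal powers *)

Lemma C1on_subset (U D : C -> Prop) F Fx Fy :
  (forall z, U z -> D z) -> C1on D F Fx Fy -> C1on U F Fx Fy.
Proof. intros H [a b c d e]. split; auto. Qed.

Lemma holo_power (U : C -> Prop) n : open U -> holo U (fun z => z ^ n)%C.
Proof.
  intros HO.
  assert (H : exists P, C1on U (fun z => z ^ n)%C P (fun z => Ci * P z)%C).
  { destruct n as [|n].
    - exists (fun _ => RtoC 0).
      exact (C1on_subset U _ _ _ _ (fun _ _ => I) (C1on_const (RtoC 1))).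
    - exists (fun z => RtoC (INR (S n)) * z ^ n)%C. split; try solve [cont]; intros z _.
      + refine (CD_eq _ _ _ _ (CD_pow _ n _ _ (CD_line_x (Im z) (Re z))) _).
        cbv beta. norm_pair. replace ((Re z, Im z) : C) with z by (now destruct z). ring.
      + refine (CD_eq _ _ _ _ (CD_pow _ n _ _ (CD_line_y (Re z) (Im z))) _).
        cbv beta. norm_pair. replace ((Re z, Im z) : C) with z by (now destruct z). ring. }
  destruct H as [P H]. exact (proj1 (C1on_holo _ _ _ H HO)).
Qed.

(** The powers of [x + j y] are those of [x + i y] with [j] in the place of [i]. *)
Lemma Bpow_hat z n : Bpow (hat z) n = bic (fun z => z ^ n)%C (fun _ => RtoC 0) z.
Proof.
  unfold bic. change ((Re (RtoC 0)), Im (RtoC 0)) with (0, 0).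
  change (Bpow (hat z) n = (RtoC (Re (z ^ n)%C), RtoC (Im (z ^ n)%C))).
  induction n as [|n IH]; [reflexivity|]. simpl Bpow. rewrite IH. simpl Cpow.
  unfold Bmult, hat, Sc, Vec. cbn [fst snd]. rewrite <- !RtoC_mult, <- RtoC_minus, <- RtoC_plus.
  reflexivity.
Qed.

Lemma Bj_Bpow_hat z n :
  Bmult Bj (Bpow (hat z) n) = bic (fun z => Ci * z ^ n)%C (fun _ => RtoC 0) z.
Proof.
  rewrite Bpow_hat. unfold Bmult, Bj, bic, Sc, Vec. cbn [fst snd].
  f_equal; apply Ceq; unfold Re, Im; simpl; ring.
Qed.

Lemma Z1_bic Gf Gi n : Z1 Gf Gi n = TB Gf Gi (bic (fun z => z ^ n)%C (fun _ => RtoC 0)).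
Proof. unfold Z1. f_equal. apply functional_extensionality. intros z. apply Bpow_hat. Qed.

Lemma Zj_bic Gf Gi n : Zj Gf Gi n = TB Gf Gi (bic (fun z => Ci * z ^ n)%C (fun _ => RtoC 0)).
Proof. unfold Zj. f_equal. apply functional_extensionality. intros z. apply Bj_Bpow_hat. Qed.

Lemma formal_powers_Vekua {Omega rho f Gf Gi} (st : setting Omega rho f Gf Gi) n :
  Vekua Omega f (Z1 Gf Gi n) /\ Vekua Omega f (Zj Gf Gi n).
Proof.
  assert (HO := s_open st).
  assert (H0 : holo Omega (fun _ => RtoC 0))
    by exact (C1on_subset Omega _ _ _ _ (fun _ _ => I) (holo_const (RtoC 0))).
  rewrite Z1_bic, Zj_bic. split; apply (bic_Vekua st); auto using holo_power.
  destruct (holo_power Omega n HO) as [a b c d e].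
  apply (C1on_holo Omega _ (fun z => Ci * Dx (fun z => z ^ n)%C z)%C); [|exact HO].
  split; try solve [cont]; intros z Hz; eapply CD_eq;
    [apply (CD_mult (fun _ => Ci) _ _ _ _ (CD_const _ _) (d z Hz))|ring
    |apply (CD_mult (fun _ => Ci) _ _ _ _ (CD_const _ _) (e z Hz))|ring].
Qed.

(** The formal power with coefficient [a + i b] is the transmutation of
    [a z^n + i b z^n]. *)
Lemma Zpow_TB {Omega rho f Gf Gi} (st : setting Omega rho f Gf Gi) n a b z : Omega z ->
  Zpow Gf Gi n (coef_B a b) z = TB Gf Gi (bic (fun w => a * w ^ n)%C (fun w => b * w ^ n)%C) z.
Proof.
  intros Hz.
  assert (Hr : forall w, Omega w -> Cmod w <= rho) by (intros w Hw; left; now apply (s_rho st)).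
  unfold Zpow. rewrite Z1_bic, Zj_bic. unfold TB, Bplus, Bscal. cbn [Sc Vec fst snd].
  f_equal; symmetry.
  - rewrite <- (transmute_comb rho _ Gf _ _ Omega _ _ _ _ z (s_kf st) (s_Gf st) (s_star st) Hr);
      [|cont_bic|cont_bic|exact Hz].
    apply transmute_ext. intros s _. apply Ceq; unfold bic, coef_B, Sc, Vec, Re, Im; simpl; ring.
  - rewrite <- (transmute_comb rho _ Gi _ _ Omega _ _ _ _ z (s_ki st) (s_Gi st) (s_star st) Hr);
      [|cont_bic|cont_bic|exact Hz].
    apply transmute_ext. intros s _. apply Ceq; unfold bic, coef_B, Sc, Vec, Re, Im; simpl; ring.
Qed.

Lemma formal_polynomial_TB {Omega rho f Gf Gi} (st : setting Omega rho f Gf Gi) a b n z : Omega z ->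
  sum_n (G := B_NormedModule) (fun k => Zpow Gf Gi k (coef_B (a k) (b k)) z) n
  = TB Gf Gi (bic (fun w => Csum (fun k => a k * w ^ k)%C (S n))
                  (fun w => Csum (fun k => b k * w ^ k)%C (S n))) z.
Proof.
  intros Hz.
  assert (Cs : forall (c : nat -> C) m w, continuous (fun w => Csum (fun k => c k * w ^ k)%C m) w)
    by (intros c m w; apply (Csum_continuous (fun k w => c k * w ^ k)%C); cont).
  induction n as [|n IH].
  - rewrite sum_O, (Zpow_TB st) by exact Hz. do 2 f_equal;
      apply functional_extensionality; intros w; simpl Csum; now rewrite Cplus_0_l.
  - rewrite sum_Sn, IH, (Zpow_TB st) by exact Hz.
    change (Bplus (TB Gf Gi (bic (fun w => Csum (fun k => a k * w ^ k)%C (S n))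
                  (fun w => Csum (fun k => b k * w ^ k)%C (S n))) z)
      (TB Gf Gi (bic (fun w => a (S n) * w ^ S n)%C
         (fun w => b (S n) * w ^ S n)%C) z) =
      TB Gf Gi (bic (fun w => Csum (fun k => a k * w ^ k)%C (S n) + a (S n) * w ^ S n)%C
        (fun w => Csum (fun k => b k * w ^ k)%C (S n) + b (S n) * w ^ S n)%C) z).
    assert (X := TB_add st Omega 1 _ _ (fun w => a (S n) * w ^ S n)%C
      (fun w => b (S n) * w ^ S n)%C z (s_star st) (fun _ Hw => Hw)
      (fun w _ => Cs a (S n) w) (fun w _ => Cs b (S n) w)
      ltac:(cont) ltac:(cont) Hz).
    transitivity (Bplus (TB Gf Gi (bic (fun w => Csum (fun k => a k * w ^ k)%C (S n))
                  (fun w => Csum (fun k => b k * w ^ k)%C (S n))) z)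
      (Bscal (RtoC 1) (TB Gf Gi (bic (fun w => a (S n) * w ^ S n)%C
         (fun w => b (S n) * w ^ S n)%C) z))).
    + f_equal. unfold Bscal. rewrite !Cmult_1_l. apply surjective_pairing.
    + etransitivity; [exact (eq_sym X)|]. do 2 f_equal; apply functional_extensionality; intros w;
      simpl Csum; now rewrite Cmult_1_l.
Qed.

(** Polynomial approximation of [F1], [F2] on a star-shaped set carries over to
    the transmuted functions. *)
Lemma approximation_bound {Omega rho f Gf Gi} (st : setting Omega rho f Gf Gi)
  (N : C -> Prop) F1 F2 (a b : nat -> C) n e z :
  star_shaped N -> (forall w, N w -> Omega w) -> holo Omega F1 -> holo Omega F2 -> 0 <= e ->
  (forall w, N w -> Cmod (F1 w - Csum (fun k => a k * w ^ k) (S n))%C <= e) ->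
  (forall w, N w -> Cmod (F2 w - Csum (fun k => b k * w ^ k) (S n))%C <= e) ->
  N z ->
  Bnorm (Bminus (sum_n (G := B_NormedModule) (fun k => Zpow Gf Gi k (coef_B (a k) (b k)) z) n)
    (TB Gf Gi (bic F1 F2) z)) <= 2 * e * (2 + s_Af st * rho + s_Ai st * rho).
Proof.
  intros SN NO H1 H2 He E1 E2 Hz.
  rewrite (formal_polynomial_TB st) by auto.
  pose (p := fun (c : nat -> C) w => Csum (fun k => c k * w ^ k)%C (S n)).
  change (Bnorm (Bminus (TB Gf Gi (bic (p a) (p b)) z) (TB Gf Gi (bic F1 F2) z))
    <= 2 * e * (2 + s_Af st * rho + s_Ai st * rho)).
  assert (Cp : forall c w, continuous (p c) w)
    by (intros c w; apply (Csum_continuous (fun k w => c k * w ^ k)%C); cont).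
  assert (C1' : forall w, N w -> continuous F1 w) by (intros w Hw; apply (C1_cont H1), NO, Hw).
  assert (C2 : forall w, N w -> continuous F2 w) by (intros w Hw; apply (C1_cont H2), NO, Hw).
  assert (X := TB_add st N (-1) (p a) (p b) F1 F2 z SN NO
    (fun w _ => Cp a w) (fun w _ => Cp b w) C1' C2 Hz).
  replace (Bminus (TB Gf Gi (bic (p a) (p b)) z) (TB Gf Gi (bic F1 F2) z))
    with (TB Gf Gi (bic (fun w => p a w + RtoC (-1) * F1 w)%C (fun w => p b w + RtoC (-1) * F2 w)%C) z)
    by (rewrite X; unfold Bplus, Bscal, Bminus; cbn [Sc Vec fst snd]; f_equal; ring).
  assert (Q : forall u v : C, Cmod (u - v) <= e -> Cmod (v + RtoC (-1) * u) <= e).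
  { intros u v H. replace (v + RtoC (-1) * u)%C with (- (u - v))%C by ring. now rewrite Cmod_opp. }
  apply (TB_bound st N _ _ _ _ SN NO); [cont|cont|exact He| | |exact Hz]; intros w Hw.
  - apply Q, E1, Hw.
  - apply Q, E2, Hw.
Qed.

Lemma Csum_pad (u : nat -> C) m n : (m <= n)%nat -> (forall k, (m <= k)%nat -> u k = RtoC 0) ->
  Csum u n = Csum u m.
Proof.
  intros H Z. induction H as [|n H IH]; [reflexivity|]. simpl. rewrite IH, Z by exact H. ring.
Qed.

Lemma peval_pad l z n : (length l <= n)%nat ->
  Csum (fun k => nth k l (RtoC 0) * z ^ k)%C n = peval l z.
Proof.
  intros H. rewrite peval_Csum. apply Csum_pad; [exact H|].
  intros k Hk. rewrite nth_overflow by exact Hk. ring.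
Qed.

Lemma s_norm_pos {Omega rho f Gf Gi} (st : setting Omega rho f Gf Gi) :
  0 < rho /\ 0 < 2 + s_Af st * rho + s_Ai st * rho.
Proof.
  assert (P1 := rk_pos (s_kf st)). assert (P2 := rk_pos (s_ki st)).
  assert (Pr : 0 < rho) by (generalize (s_rho st _ (s_0 st)); rewrite Cmod_0; lra).
  assert (0 < s_Af st * rho) by nra. assert (0 < s_Ai st * rho) by nra. lra.
Qed.

(** The two coefficient sequences are packed with the degree in one object. *)
Lemma Vekua_approximation {Omega rho f Gf Gi} (st : setting Omega rho f Gf Gi)
  (W : C -> B) (K : C -> Prop) eps :
  Vekua Omega f W -> compactC K -> (forall z, K z -> Omega z) -> 0 < eps ->
  exists p : nat * ((nat -> C) * (nat -> C)), forall z, K z ->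
    Bnorm (Bminus (sum_n (G := B_NormedModule)
      (fun n => Zpow Gf Gi n (coef_B (fst (snd p) n) (snd (snd p) n)) z) (fst p)) (W z)) < eps.
Proof.
  intros HW HK HKO He.
  destruct (Vekua_holomorphic_pair st W HW) as [F1 [F2 [H1 [H2 EW]]]].
  assert (HO := s_open st). assert (HS := s_star st).
  assert (Hr : forall z, Omega z -> Cmod z <= rho) by (intros z Hz; left; now apply (s_rho st)).
  destruct (s_norm_pos st) as [Pr Hc].
  set (c := 2 + s_Af st * rho + s_Ai st * rho) in *.
  assert (He' : 0 < eps / (4 * c)) by (apply Rdiv_lt_0_compat; lra).
  destruct (Runge_star Omega K F1 rho HO HS Hr Pr H1 HK HKO _ He') as [l1 L1].
  destruct (Runge_star Omega K F2 rho HO HS Hr Pr H2 HK HKO _ He') as [l2 L2].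
  set (n := Nat.max (length l1) (length l2)).
  exists (n, (fun k => nth k l1 (RtoC 0), fun k => nth k l2 (RtoC 0))). cbn [fst snd].
  intros z Hz. rewrite EW by auto.
  apply Rle_lt_trans with (2 * (eps / (4 * c)) * c).
  - apply (approximation_bound st (star_hull K)); auto.
    + apply star_hull_star.
    + now apply star_hull_sub.
    + lra.
    + intros w Hw. rewrite peval_pad by (unfold n; lia). left. now apply L1.
    + intros w Hw. rewrite peval_pad by (unfold n; lia). left. now apply L2.
    + now apply star_hull_incl.
  - replace (2 * (eps / (4 * c)) * c) with (eps / 2) by (field; lra). lra.
Qed.

(** * Expansion in a disk *)

(** [F] is composed with the radial retraction on the disk, in order to be
    continuous on the plane. *)
Lemma bounded_disc (U : C -> Prop) (F : C -> C) (r : R) : 0 < r ->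
  (forall v, Cmod v <= r -> U v) -> (forall v, U v -> continuous F v) ->
  exists M, 0 < M /\ forall v, Cmod v <= r -> Cmod (F v) <= M.
Proof.
  intros Hr HU CF.
  set (ret := fun v : C => (RtoC (r / Rmax r (Cmod v)) * v)%C).
  assert (Pm : forall v, 0 < Rmax r (Cmod v)) by (intros v; eapply Rlt_le_trans; [exact Hr|apply Rmax_l]).
  assert (Hin : forall v, U (ret v)).
  { intros v. apply HU. unfold ret. rewrite Cmod_scal by (left; apply Rdiv_lt_0_compat; auto).
    assert (Pv := Pm v). apply Rmult_le_reg_r with (Rmax r (Cmod v)); [exact Pv|].
    replace (r / Rmax r (Cmod v) * Cmod v * Rmax r (Cmod v)) with (r * Cmod v) by (field; lra).
    apply Rmult_le_compat_l; [lra|apply Rmax_r]. }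
  assert (Cmx : forall v, continuous (fun v : C => Rmax r (Cmod v)) v).
  { intros v. apply filterlim_locally. intros eps.
    assert (L := proj1 (filterlim_locally _ _) (continuous_Cmod (fun v : C => v) v (continuous_Cid v)) eps).
    revert L. apply filter_imp. intros w Hw.
    change (Rabs (Cmod w - Cmod v) < eps) in Hw. change (Rabs (Rmax r (Cmod w) - Rmax r (Cmod v)) < eps).
    eapply Rle_lt_trans; [|exact Hw].
    unfold Rmax. repeat destruct Rle_dec; unfold Rabs; repeat destruct Rcase_abs; lra. }
  destruct (bounded_rect (fun v => F (ret v)) (- r) r (- r) r) as [M [HM HB]].
  - intros v. apply (continuous_comp ret F); [|now apply CF].
    apply continuous_Cmult; [|cont]. apply continuous_RtoC.
    apply (continuous_Rmult (fun _ => r)); [cont|].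
    apply (continuous_Rinv_fun (fun v : C => Rmax r (Cmod v))); [apply Cmx|apply Rgt_not_eq, Pm].
  - exists M. split; [exact HM|]. intros v Hv.
    assert (R1 : ret v = v).
    { unfold ret. rewrite Rmax_left by exact Hv. unfold Rdiv. rewrite Rinv_r by lra. ring. }
    rewrite <- R1. destruct v as [x y].
    assert (X := Re_le (x, y)). assert (Y := Im_le (x, y)). unfold Re, Im in X, Y; cbn [fst snd] in X, Y.
    apply (HB x y); apply Rabs_le_between; lra.
Qed.

(** The Taylor coefficients at the origin. *)
Definition taylor_coef (F : C -> C) (k : nat) : C := (RtoC (/ INR (fact k)) * Dk F k 0)%C.

(** The Cauchy estimates on the circle of radius [(r + rho) / 2]. *)
Lemma disc_Taylor (U : C -> Prop) (F : C -> C) (rho r : R) : open U -> holo U F ->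
  (forall v, Cmod v < rho -> U v) -> 0 <= r < rho ->
  exists M, 0 < M /\ forall z, Cmod z <= r -> forall n,
    Cmod (F z - Csum (fun k => taylor_coef F k * z ^ k) n)%C <= M * (r / ((r + rho) / 2)) ^ n /\
    Cmod (taylor_coef F n * z ^ n)%C <= M * (r / ((r + rho) / 2)) ^ n.
Proof.
  intros HO HF HU Hr. set (d := (r + rho) / 2). assert (Hd : r < d < rho) by (unfold d; lra).
  assert (HUd : forall v, Cmod (v - 0) <= d -> U v).
  { intros v Hv. apply HU. replace (v - 0)%C with v in Hv by ring. lra. }
  destruct (bounded_disc U F d ltac:(lra) ltac:(intros v Hv; apply HU; lra) (C1_cont HF))
    as [M [HM HB]].
  assert (HB' : forall v, Cmod (v - 0) <= d -> Cmod (F v) <= M)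
    by (intros v Hv; apply HB; replace (v - 0)%C with v in Hv by ring; exact Hv).
  set (q := r / d).
  assert (Hq : 0 <= q < 1).
  { unfold q. split; [apply Rdiv_le_0_compat; lra|].
    apply Rmult_lt_reg_r with d; [lra|]. unfold Rdiv. rewrite Rmult_assoc, Rinv_l; lra. }
  assert (EC : forall k, coef F 0 d k = taylor_coef F k).
  { intros k. unfold taylor_coef.
    rewrite <- (coef_Dk U F 0 d k) by (auto; lra).
    rewrite RtoC_inv by apply INR_fact_neq_0. field.
    intros E0. apply RtoC_inj in E0. revert E0. apply INR_fact_neq_0. }
  assert (I1 : 1 <= / (1 - q)) by (rewrite <- Rinv_1 at 1; apply Rinv_le_contravar; lra).
  exists (M * / (1 - q)). split; [apply Rmult_lt_0_compat; [lra|apply Rinv_0_lt_compat; lra]|].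
  intros z Hz n. assert (Pz := Cmod_ge_0 z).
  assert (Qz : 0 <= Cmod z / d <= q).
  { unfold q. split; [apply Rdiv_le_0_compat; lra|]. apply Rmult_le_compat_r; [|exact Hz].
    left; apply Rinv_0_lt_compat; lra. }
  assert (Pq : 0 <= q ^ n) by (apply pow_le; lra).
  split.
  - rewrite (Csum_ext _ (fun k => coef F 0 d k * z ^ k)%C) by (intros k; now rewrite EC).
    replace (F z) with (F (0 + z)%C) by (f_equal; ring).
    eapply Rle_trans; [apply (Taylor_bound U F 0 z d M n); auto; lra|].
    replace (M * / (1 - q) * q ^ n) with (M * q ^ n * / (1 - q)) by ring.
    apply Rmult_le_compat.
    + apply Rmult_le_pos; [lra|]. apply pow_le; lra.
    + left; apply Rinv_0_lt_compat; lra.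
    + apply Rmult_le_compat_l; [lra|]. now apply pow_incr.
    + apply Rinv_le_contravar; lra.
  - rewrite <- EC, Cmod_mult, Cmod_pow.
    assert (B1' := coef_bound U F 0 d M n ltac:(lra) HUd (C1_cont HF) HB').
    apply Rle_trans with (M * (/ d) ^ n * Cmod z ^ n).
    + apply Rmult_le_compat_r; [now apply pow_le|exact B1'].
    + replace (M * (/ d) ^ n * Cmod z ^ n) with (M * (Cmod z / d) ^ n)
        by (unfold Rdiv; rewrite Rpow_mult_distr; ring).
      apply Rle_trans with (M * q ^ n).
      * apply Rmult_le_compat_l; [lra|]. now apply pow_incr.
      * apply Rmult_le_compat_r; [exact Pq|]. rewrite <- (Rmult_1_r M) at 1. apply Rmult_le_compat_l; lra.
Qed.

Lemma disc_expansion {Omega rho f Gf Gi} (st : setting Omega rho f Gf Gi) (F1 F2 : C -> C) (r : R) :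
  (forall z, Cmod z < rho -> Omega z) -> holo Omega F1 -> holo Omega F2 -> 0 <= r < rho ->
  exists M q, 0 <= q < 1 /\ forall z, Cmod z <= r -> forall n,
    Bnorm (Bminus (sum_n (G := B_NormedModule)
      (fun n => Zpow Gf Gi n (coef_B (taylor_coef F1 n) (taylor_coef F2 n)) z) n)
      (TB Gf Gi (bic F1 F2) z)) <= M * q ^ n /\
    Bnorm (Zpow Gf Gi n (coef_B (taylor_coef F1 n) (taylor_coef F2 n)) z) <= M * q ^ n.
Proof.
  intros HD H1 H2 Hr.
  assert (HO := s_open st). destruct (s_norm_pos st) as [Pr Hc].
  set (c := 2 + s_Af st * rho + s_Ai st * rho) in *.
  destruct (disc_Taylor Omega F1 rho r HO H1 HD Hr) as [M1 [PM1 T1]].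
  destruct (disc_Taylor Omega F2 rho r HO H2 HD Hr) as [M2 [PM2 T2]].
  set (q := r / ((r + rho) / 2)) in *.
  assert (Hq : 0 <= q < 1).
  { unfold q. split; [apply Rdiv_le_0_compat; lra|].
    apply Rmult_lt_reg_r with ((r + rho) / 2); [lra|]. unfold Rdiv at 1.
    rewrite Rmult_assoc, Rinv_l; lra. }
  exists (2 * (M1 + M2) * c), q. split; [exact Hq|]. intros z Hz n.
  set (N := fun w : C => Cmod w <= r).
  assert (SN : star_shaped N).
  { intros w s Hw Hs. unfold N in *. rewrite Cmod_scal by lra. generalize (Cmod_ge_0 w). nra. }
  assert (NO : forall w, N w -> Omega w) by (intros w Hw; apply HD; unfold N in Hw; lra).
  assert (Pq : forall m, 0 <= q ^ m) by (intros m; apply pow_le; lra).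
  assert (Mq : forall m, M1 * q ^ m <= (M1 + M2) * q ^ m /\ M2 * q ^ m <= (M1 + M2) * q ^ m)
    by (intros m; split; apply Rmult_le_compat_r; auto; lra).
  assert (PM : forall m, 0 <= (M1 + M2) * q ^ m) by (intros m; apply Rmult_le_pos; [lra|apply Pq]).
  split.
  - apply Rle_trans with (2 * ((M1 + M2) * q ^ S n) * c).
    + apply (approximation_bound st N); auto; intros w Hw.
      * eapply Rle_trans; [apply (T1 w Hw (S n))|apply Mq].
      * eapply Rle_trans; [apply (T2 w Hw (S n))|apply Mq].
    + assert (q ^ S n <= q ^ n) by (simpl; generalize (Pq n); nra).
      replace (2 * (M1 + M2) * c * q ^ n) with (2 * ((M1 + M2) * q ^ n) * c) by ring.
      apply Rmult_le_compat_r; [lra|]. apply Rmult_le_compat_l; [lra|].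
      apply Rmult_le_compat_l; lra.
  - rewrite (Zpow_TB st) by auto.
    replace (2 * (M1 + M2) * c * q ^ n) with (2 * ((M1 + M2) * q ^ n) * c) by ring.
    apply (TB_bound st N _ _ _ _ SN NO); [cont|cont|apply PM| | |exact Hz]; intros w Hw.
    + eapply Rle_trans; [apply (T1 w Hw n)|apply Mq].
    + eapply Rle_trans; [apply (T2 w Hw n)|apply Mq].
Qed.

Lemma compact_disc (K : C -> Prop) rho : 0 < rho -> compactC K -> (forall z, K z -> Cmod z < rho) ->
  exists r, 0 <= r < rho /\ forall z, K z -> Cmod z <= r.
Proof.
  intros Hrho HK HKr.
  destruct (HK R (fun i w => 0 <= i < rho /\ Cmod (w - 0) < i)) as [l Hl].
  - intros i w [Hi Hw]. generalize (open_disc 0 i w Hw). apply filter_imp. intros v Hv; now split.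
  - intros z Hz. exists ((Cmod z + rho) / 2). specialize (HKr z Hz).
    replace (z - 0)%C with z by ring. generalize (Cmod_ge_0 z). lra.
  - assert (L : exists r, 0 <= r < rho /\ forall i, In i l -> 0 <= i < rho -> i <= r).
    { clear Hl. induction l as [|i l [r [Hr H]]]; [exists 0; split; [lra|intros i []]|].
      exists (if Rlt_dec i rho then Rmax r i else r). split.
      - destruct Rlt_dec; [|exact Hr]. unfold Rmax; destruct Rle_dec; lra.
      - intros j [Hj|Hj] Hi; destruct Rlt_dec.
        + subst j. apply Rmax_r.
        + subst j. lra.
        + eapply Rle_trans; [now apply (H j)|apply Rmax_l].
        + now apply H. }
    destruct L as [r [Hr L]]. exists r. split; [exact Hr|]. intros z Hz.
    destruct (Hl z Hz) as [i [Hi [Hir Hzi]]]. replace (z - 0)%C with z in Hzi by ring.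
    specialize (L i Hi Hir). lra.
Qed.

Lemma geometric_eventually (M q eps : R) : 0 <= q < 1 -> 0 < eps ->
  exists n, forall m, (n <= m)%nat -> M * q ^ m < eps.
Proof.
  intros Hq He.
  assert (L : is_lim_seq (fun m => M * q ^ m) 0).
  { replace (Finite 0) with (Rbar_mult M 0) by (simpl; f_equal; ring).
    apply is_lim_seq_scal_l, is_lim_seq_geom. rewrite Rabs_pos_eq; lra. }
  destruct (lim_zero_small _ eps He L) as [n Hn]. exists n. intros m Hm.
  specialize (Hn m Hm). now apply (Rle_lt_trans _ _ _ (Rle_abs _)) in Hn.
Qed.

(** Convergence of a series in [B], expressed with [Bnorm]. *)
Lemma is_series_B (u : nat -> B) (l : B) :
  (forall eps, 0 < eps -> exists N, forall n, (N <= n)%nat ->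
     Bnorm (Bminus (sum_n (G := B_NormedModule) u n) l) < eps) ->
  is_series (V := B_NormedModule) u l.
Proof.
  intros H. apply filterlim_locally. intros eps.
  destruct (H eps (cond_pos eps)) as [N HN]. exists N. intros n Hn. specialize (HN n Hn).
  set (s := sum_n (G := B_NormedModule) u n) in *.
  destruct (Bnorm_ge (Bminus s l)) as [H1 H2].
  assert (A1 := Re_le (Sc (Bminus s l))). assert (A2 := Im_le (Sc (Bminus s l))).
  assert (A3 := Re_le (Vec (Bminus s l))). assert (A4 := Im_le (Vec (Bminus s l))).
  split; split.
  - change (Rabs (Re (Sc (Bminus s l))) < eps). lra.
  - change (Rabs (Im (Sc (Bminus s l))) < eps). lra.
  - change (Rabs (Re (Vec (Bminus s l))) < eps). lra.
  - change (Rabs (Im (Vec (Bminus s l))) < eps). lra.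
Qed.

Theorem theorem46
  (Omega : C -> Prop) (rho : R) (qf f : R -> C) (Gf Gi : R * R -> C)
  (hOmega : star_shaped_bounded_domain Omega)
  (hrho : is_sup_modulus Omega rho)
  (hf : generating_function Omega rho qf f)
  (hGf : is_kernel rho qf Gf)
  (hGi : is_kernel rho (q_inv qf f) Gi) :
  (forall n : nat, Vekua Omega f (Z1 Gf Gi n) /\ Vekua Omega f (Zj Gf Gi n)) /\
  (forall W : C -> B, Vekua Omega f W ->
     forall K : C -> Prop, compactC K -> (forall z, K z -> Omega z) ->
     exists S : nat -> C -> B,
       (forall n, formal_polynomial Omega Gf Gi (S n)) /\
       converges_uniformly_on K S W) /\
  ((forall z, Omega z <-> Cmod z < rho) ->
   forall W : C -> B, Vekua Omega f W ->
     exists A : nat -> B,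
       (forall z, Cmod z < rho ->
          is_series (V := B_NormedModule) (fun n => Zpow Gf Gi n (A n) z) (W z)) /\
       (forall z, Cmod z < rho ->
          ex_series (fun n => Bnorm (Zpow Gf Gi n (A n) z))) /\
       (forall K : C -> Prop, compactC K -> (forall z, K z -> Cmod z < rho) ->
          converges_uniformly_on K
            (fun N z => sum_n (G := B_NormedModule)
                          (fun n => Zpow Gf Gi n (A n) z) N)
            W)).
Proof.
  destruct (setting_exists Omega rho qf f Gf Gi hOmega hrho hf hGf hGi) as [st].
  split; [|split].
  - intros n. apply (formal_powers_Vekua st).
  - intros W HW K HK HKO.
    assert (P : forall n : nat, 0 < / INR (S n))
      by (intros n; apply Rinv_0_lt_compat, lt_0_INR, Nat.lt_0_succ).
    set (p := fun n => proj1_sig (constructive_indefinite_description _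
      (Vekua_approximation st W K _ HW HK HKO (P n)))).
    exists (fun n z => sum_n (G := B_NormedModule)
      (fun k => Zpow Gf Gi k (coef_B (fst (snd (p n)) k) (snd (snd (p n)) k)) z) (fst (p n))).
    split.
    + intros n. exists (fst (p n)), (fun k => coef_B (fst (snd (p n)) k) (snd (snd (p n)) k)).
      reflexivity.
    + intros eps He. destruct (archimed_cor1 eps He) as [N [HN1 HN2]].
      exists N. intros n Hn z Hz.
      assert (Q := proj2_sig (constructive_indefinite_description _
        (Vekua_approximation st W K _ HW HK HKO (P n))) z Hz).
      fold (p n) in Q. eapply Rlt_trans; [exact Q|]. eapply Rle_lt_trans; [|exact HN1].
      apply Rinv_le_contravar; [now apply lt_0_INR|]. apply le_INR. lia.
  - intros HD W HW.
    destruct (Vekua_holomorphic_pair st W HW) as [F1 [F2 [H1 [H2 EW]]]].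
    assert (HD' : forall z, Cmod z < rho -> Omega z) by (intros z; apply HD).
    destruct (s_norm_pos st) as [Pr _].
    exists (fun n => coef_B (taylor_coef F1 n) (taylor_coef F2 n)). split; [|split].
    + intros z Hz. rewrite EW by auto.
      destruct (disc_expansion st F1 F2 _ HD' H1 H2 (conj (Cmod_ge_0 z) Hz)) as [M [q [Hq B]]].
      apply is_series_B. intros eps He.
      destruct (geometric_eventually M q eps Hq He) as [n Hn]. exists n. intros m Hm.
      eapply Rle_lt_trans; [apply (B z (Rle_refl _) m)|now apply Hn].
    + intros z Hz.
      destruct (disc_expansion st F1 F2 _ HD' H1 H2 (conj (Cmod_ge_0 z) Hz)) as [M [q [Hq B]]].
      apply (ex_series_le (V := R_CompleteNormedModule) _ (fun n => M * q ^ n)).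
      * intros n. change (Rabs (Bnorm (Zpow Gf Gi n (coef_B (taylor_coef F1 n) (taylor_coef F2 n)) z))
          <= M * q ^ n).
        rewrite Rabs_pos_eq by apply sqrt_pos. apply (B z (Rle_refl _) n).
      * apply (ex_series_scal (V := R_NormedModule) M (fun n => q ^ n)), ex_series_geom.
        rewrite Rabs_pos_eq; lra.
    + intros K HK HKr. destruct (compact_disc K rho Pr HK HKr) as [r [Hr HKr']].
      destruct (disc_expansion st F1 F2 r HD' H1 H2 Hr) as [M [q [Hq B]]].
      intros eps He. destruct (geometric_eventually M q eps Hq He) as [n Hn].
      exists n. intros m Hm z Hz. rewrite EW by auto.
      eapply Rle_lt_trans; [apply (B z (HKr' z Hz) m)|now apply Hn].
Qed.
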